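(* Let $\widetilde{T}$ be a complete theory in a language $\widetilde{\mathcal{L}}$ which eliminates quantifiers and imaginaries. Let $T$ be a complete theory in a language $\mathcal{L}\supseteq\widetilde{\mathcal{L}}$ containing the universal part of $\widetilde{T}$. Let $M$ be an $|\mathcal{L}|^{+}$-saturated and $|\mathcal{L}|^{+}$-homogeneous model of $T$ and let $\widetilde{M}\models\widetilde{T}$ be such that the reduct $M|_{\widetilde{\mathcal{L}}}$ is a substructure of $\widetilde{M}$ and such that any automorphism of $M$ extends to an automorphism of $\widetilde{M}$. Suppose that the following conditions (i)–(v) hold for any $A=\mathrm{acl}_{\mathcal{L}}(A)\subseteq M$ and any $c\in\mathrm{dom}(M)$: (i) (Relative algebraic boundedness) For every $M'\prec M$, $\mathrm{dcl}_{\mathcal{L}}(M'c)\subseteq\mathrm{acl}_{\widetilde{\mathcal{L}}}(M'c)$. (ii) (Internalizing $\widetilde{\mathcal{L}}$-codes) For all $\epsilon\in\mathrm{dcl}_{\widetilde{\mathcal{L}}}(M)$, there exists a tuple $\eta$ of elements of $M$ such that an automorphism of $\widetilde{M}$ that stabilizes $M$ setwise fixes $\epsilon$ if and only if it fixes $\eta$. (iii) (Unary EI) Every $\mathcal{L}(M)$-definable unary subset of $\mathrm{dom}(M)$ is coded in $M$. (iv) (Invariant types) There exists an $\mathrm{Aut}(\widetilde{M}/A)$-invariant type $\widetilde{p}$ over $\widetilde{M}$ such that $\widetilde{p}|M$ is consistent with $\mathrm{tp}_{\mathcal{L}}(c/A)$. Moreover, for any $\widetilde{\mathcal{L}}(\widetilde{M})$-definable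 function $r$ whose domain contains $\widetilde{p}$, let $\partial_{\widetilde{p}}r$ be the $\widetilde{p}$-germ of $r$. Then there exist a directed order $I$ and a sequence $(\epsilon_i)_{i\in I}$, with $\epsilon_i\in\mathrm{dcl}_{\widetilde{\mathcal{L}}}(A,\ulcorner r\urcorner)$, such that $\sigma\in\mathrm{Aut}(\widetilde{M}/A)$ fixes $\partial_{\widetilde{p}}r$ if and only if $\sigma$ fixes almost every $\epsilon_i$, i.e. there is $i_0\in I$ such that $\sigma$ fixes $\epsilon_i$ for all $i\geq i_0$. (v) (Weak rigidity) $\mathrm{acl}_{\mathcal{L}}(Ac)\subseteq\mathrm{dcl}_{\mathcal{L}}(Ac)$. Then $T$ eliminates imaginaries.
   Context: Theories are many-sorted, with a distinguished collection of sorts called dominant sorts, such that for any sort $S$ there is a $\emptyset$-definable partial function from a finite product of dominant sorts onto $S$. For a model $M$, $\mathrm{dom}(M)$ is the set of elements of $M$ of dominant sorts; a unary subset is a definable subset of a single dominant sort. $\mathrm{dcl}_{\mathcal{L}},\mathrm{acl}_{\mathcal{L}},\mathrm{tp}_{\mathcal{L}}$ denote definable closure, algebraic closure and type in the model $M$ of $T$ (closures restricted to elements of $M$, not of $M^{\mathrm{eq}}$); $\mathrm{dcl}_{\widetilde{\mathcal{L}}},\mathrm{acl}_{\widetilde{\mathcal{L}}}$ denote the closures in $\widetilde{M}\models\widetilde{T}$. $\mathcal{L}(M)$-definable means $\mathcal{L}$-definable with parameters in $M$. A definable set $X$ in $M$ is coded in $M$ if $X=R(M;b)$ for some formula $R$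 without parameters and tuple $b$ of $M$ such that $b\neq b'$ implies $R(M;b)\neq R(M;b')$; then $b$ (or $\mathrm{dcl}(b)$) is called a code of $X$. $\ulcorner r\urcorner$ denotes a code in $\widetilde{M}$ of the (graph of the) function $r$. A theory eliminates imaginaries if every definable set in every model is coded. For a type $q$ over $N$ and $B\subseteq N$, $q|B$ is its restriction to $B$; it is $\mathrm{Aut}(N/B)$-invariant if it is fixed by all automorphisms of $N$ fixing $B$ pointwise. Two $\widetilde{\mathcal{L}}(\widetilde{M})$-definable functions $r,r'$ have the same $\widetilde{p}$-germ if they agree on a realization of $\widetilde{p}$ over $\widetilde{M}$. *)

(* Defs.v *)
From mathcomp Require Import all_boot.
From mathcomp Require Import all_classical.

Set Implicit Arguments.
Unset Strict Implicit.
Unset Printing Implicit Defensive.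

Local Open Scope classical_set_scope.
Local Open Scope card_scope.

(*  Many-sorted first-order logic over a type [S] of sorts.  Sorts are allowed
    to be empty in a structure; for this reason formulas are well scoped: they
    are indexed by the family [V : S -> Type] of their possible free variables,
    [V s] being the variables of sort [s]. *)

Definition fammap (S : Type) (V W : S -> Type) := forall s, V s -> W s.

Definition famid (S : Type) (V : S -> Type) : fammap V V := fun _ v => v.

Definition famcomp (S : Type) (U V W : S -> Type) (g : fammap V W)
  (f : fammap U V) : fammap U W := fun s v => g s (f s v).

Definition famsum (S : Type) (V W : S -> Type) : S -> Type :=
  fun s => (V s + W s)%type.

Definition famcase (S : Type) (V W U : S -> Type) (f : fammap V U)
  (g : fammap W U) : fammap (famsum V W) U :=
  fun s v => match v with inl x => f s x | inr y => g s y end.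

(* [bind V s] is [V] with one more variable, of sort [s]. *)
Inductive bind (S : Type) (V : S -> Type) (s : S) : S -> Type :=
| new : bind V s s
| old s' : V s' -> bind V s s'.
Arguments new {S V s}.
Arguments old {S V s s'}.

Definition bindenv (S : Type) (V M : S -> Type) (s : S) (a : M s)
  (rho : fammap V M) : fammap (bind V s) M :=
  fun _ v => match v in bind _ _ s' return M s' with
             | new => a
             | old s' w => rho s' w
             end.

Definition bindmap (S : Type) (V W : S -> Type) (s : S) (f : fammap V W) :
  fammap (bind V s) (bind W s) :=
  fun _ v => match v in bind _ _ s' return bind W s s' with
             | new => new
             | old s' w => old (f s' w)
             end.

Fixpoint var (S : Type) (Gamma : seq S) : S -> Type :=
  if Gamma is s :: Delta then bind (var Delta) s else fun=> void.

Definition novar (S : Type) (M : S -> Type) : fammap (var [::]) M :=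
  fun _ v => match v : void with end.

Definition tup (S : Type) (M : S -> Type) (Gamma : seq S) :=
  fammap (var Gamma) M.

Definition tcons (S : Type) (M : S -> Type) (Gamma : seq S) (s : S) (a : M s)
  (x : tup M Gamma) : tup M (s :: Gamma) := bindenv a x.

Definition tup1 (S : Type) (M : S -> Type) (s : S) (a : M s) : tup M [:: s] :=
  tcons a (@novar S M).

Definition elt (S : Type) (M : S -> Type) := {s : S & M s}.

Definition elt_map (S : Type) (M N : S -> Type) (f : fammap M N) (e : elt M) :
  elt N := Tagged N (f (tag e) (tagged e)).

Definition tup_elts (S : Type) (M : S -> Type) (Gamma : seq S)
  (b : tup M Gamma) : set (elt M) :=
  [set e | exists v : var Gamma (tag e), b _ v = tagged e].

Definition over (S : Type) (M : S -> Type) (A : set (elt M)) : S -> Type :=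
  fun s => {a : M s | A (Tagged M a)}.

Definition overval (S : Type) (M : S -> Type) (A : set (elt M)) :
  fammap (over A) M := fun _ a => sval a.

Record language (S : Type) := Language {
  func : seq S -> S -> Type;
  relsym : seq S -> Type
}.

(* The symbols of the language, with [nat] added: the type of cardinality [|L|],
   the usual cardinal max(number of symbols, aleph_0), which is also the number
   of formulas. *)
Definition symbols (S : Type) (L : language S) : Type :=
  (nat + S + {Gamma : seq S & {s : S & func L Gamma s}}
       + {Gamma : seq S & relsym L Gamma})%type.

Inductive term (S : Type) (L : language S) (V : S -> Type) : S -> Type :=
| Var s : V s -> term L V s
| App Gamma s : func L Gamma s -> (forall s', var Gamma s' -> term L V s') ->
    term L V s.

Inductive formula (S : Type) (L : language S) (V : S -> Type) : Type :=
| Fal : formula L V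
| Eq s : term L V s -> term L V s -> formula L V
| Rel Gamma : relsym L Gamma -> fammap (var Gamma) (term L V) -> formula L V
| Imp : formula L V -> formula L V -> formula L V
| All s : formula L (bind V s) -> formula L V.
Arguments Fal {S L V}.

Definition Neg (S : Type) (L : language S) (V : S -> Type)
  (phi : formula L V) := Imp phi Fal.

Definition sentence (S : Type) (L : language S) := formula L (var [::]).

Fixpoint trename (S : Type) (L : language S) (V W : S -> Type)
  (f : fammap V W) (s : S) (t : term L V s) : term L W s :=
  match t with
  | Var _ v => Var L (f _ v)
  | App _ _ g args => App g (fun s' v => trename f (args s' v))
  end.

Fixpoint rename (S : Type) (L : language S) (V W : S -> Type)
  (f : fammap V W) (phi : formula L V) : formula L W :=
  match phi with
  | Fal => Fal
  | Eq _ t u => Eq (trename f t) (trename f u)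
  | Rel _ P args => Rel P (fun s v => trename f (args s v))
  | Imp phi1 phi2 => Imp (rename f phi1) (rename f phi2)
  | All s phi1 => All (rename (bindmap f) phi1)
  end.

Fixpoint quantifier_free (S : Type) (L : language S) (V : S -> Type)
  (phi : formula L V) : bool :=
  match phi with
  | Imp phi1 phi2 => quantifier_free phi1 && quantifier_free phi2
  | All _ _ => false
  | _ => true
  end.

Fixpoint universal (S : Type) (L : language S) (V : S -> Type)
  (phi : formula L V) : bool :=
  if phi is All _ phi1 then universal phi1 else quantifier_free phi.

(* [L0] is contained in [L]; both have the same sorts [S]. *)
Record sublanguage (S : Type) (L0 L : language S) := Sublanguage {
  sub_func : forall Gamma s, func L0 Gamma s -> func L Gamma s;
  sub_rel : forall Gamma, relsym L0 Gamma -> relsym L Gamma;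
  sub_func_inj : forall Gamma s, injective (@sub_func Gamma s);
  sub_rel_inj : forall Gamma, injective (@sub_rel Gamma)
}.

Record structure (S : Type) (L : language S) := Structure {
  carrier :> S -> Type;
  func_in : forall Gamma s, func L Gamma s -> tup carrier Gamma -> carrier s;
  rel_in : forall Gamma, relsym L Gamma -> tup carrier Gamma -> Prop
}.

Definition reduct (S : Type) (L0 L : language S) (i : sublanguage L0 L)
  (M : structure L) : structure L0 :=
  @Structure S L0 M (fun _ _ f => func_in (sub_func i f))
    (fun _ P => rel_in (sub_rel i P)).

Fixpoint eval (S : Type) (L : language S) (M : structure L) (V : S -> Type)
  (rho : fammap V M) (s : S) (t : term L V s) : M s :=
  match t with
  | Var _ v => rho _ v
  | App _ _ f args => func_in f (fun s' v => eval rho (args s' v))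
  end.

Fixpoint sat (S : Type) (L : language S) (M : structure L) (V : S -> Type)
  (rho : fammap V M) (phi : formula L V) : Prop :=
  match phi with
  | Fal => False
  | Eq _ t u => eval rho t = eval rho u
  | Rel _ P args => rel_in P (fun s v => eval rho (args s v))
  | Imp phi1 phi2 => sat rho phi1 -> sat rho phi2
  | All s phi1 => forall a : M s, sat (bindenv a rho) phi1
  end.

Definition holds (S : Type) (L : language S) (M : structure L)
  (phi : sentence L) := sat (@novar S M) phi.

Definition models (S : Type) (L : language S) (M : structure L)
  (T : set (sentence L)) := forall phi, T phi -> holds M phi.

Definition entails (S : Type) (L : language S) (T : set (sentence L))
  (phi : sentence L) := forall M : structure L, models M T -> holds M phi.

Definition complete_theory (S : Type) (L : language S)
  (T : set (sentence L)) :=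
  (exists M : structure L, models M T) /\
  forall phi, entails T phi \/ entails T (Neg phi).

Definition eliminates_quantifiers (S : Type) (L : language S)
  (T : set (sentence L)) :=
  forall (Gamma : seq S) (phi : formula L (var Gamma)),
  exists2 psi : formula L (var Gamma), quantifier_free psi &
  forall M : structure L, models M T ->
  forall x : tup M Gamma, sat x phi <-> sat x psi.

Definition contains_universal_part (S : Type) (L0 L : language S)
  (i : sublanguage L0 L) (T0 : set (sentence L0)) (T : set (sentence L)) :=
  forall phi, universal phi -> entails T0 phi ->
  forall M : structure L, models M T -> holds (reduct i M) phi.

(* [D] is a collection of dominant sorts for [T]: the formula [phi], whose
   variables are [x] in the product [Gamma] and the new variable [y] of sort
   [s], defines the graph of a partial function [x |-> y] onto the sort [s]. *)
Definition dominant (S : Type) (L : language S) (T : set (sentence L))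
  (D : set S) :=
  forall s : S, exists2 Gamma : seq S, (forall s', var Gamma s' -> D s') &
  exists phi : formula L (bind (var Gamma) s),
  forall M : structure L, models M T ->
    (forall (x : tup M Gamma) (y y' : M s),
       sat (bindenv y x) phi -> sat (bindenv y' x) phi -> y = y') /\
    (forall y : M s, exists x : tup M Gamma, sat (bindenv y x) phi).

Definition embedding (S : Type) (L : language S) (M N : structure L)
  (h : fammap M N) :=
  [/\ forall s, injective (h s),
      forall Gamma s (f : func L Gamma s) (x : tup M Gamma),
        h s (func_in f x) = func_in f (famcomp h x)
    & forall Gamma (P : relsym L Gamma) (x : tup M Gamma),
        rel_in P x <-> rel_in P (famcomp h x)].

Definition automorphism (S : Type) (L : language S) (M : structure L)
  (sigma : fammap M M) :=
  embedding sigma /\ forall s (y : M s), exists x, sigma s x = y.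

Definition fixes (S : Type) (M : S -> Type) (sigma : fammap M M)
  (e : elt M) := elt_map sigma e = e.

Definition elementary_on (S : Type) (L : language S) (M N : structure L)
  (A : set (elt M)) (f : fammap M N) :=
  forall (Gamma : seq S) (phi : formula L (var Gamma)) (x : tup M Gamma),
  tup_elts x `<=` A -> sat x phi <-> sat (famcomp f x) phi.

Definition elementary_embedding (S : Type) (L : language S)
  (M N : structure L) (f : fammap M N) := elementary_on setT f.

Definition defset (S : Type) (L : language S) (M : structure L)
  (Gamma Delta : seq S) (phi : formula L (famsum (var Gamma) (var Delta)))
  (b : tup M Delta) : set (tup M Gamma) := [set x | sat (famcase x b) phi].

Definition definable (S : Type) (L : language S) (M : structure L)
  (A : set (elt M)) (Gamma : seq S) (X : set (tup M Gamma)) :=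
  exists (Delta : seq S) (phi : formula L (famsum (var Gamma) (var Delta)))
    (b : tup M Delta), tup_elts b `<=` A /\ X = defset phi b.

Definition dcl (S : Type) (L : language S) (M : structure L)
  (A : set (elt M)) : set (elt M) :=
  [set e | definable A [set tup1 (tagged e)]].

Definition acl (S : Type) (L : language S) (M : structure L)
  (A : set (elt M)) : set (elt M) :=
  [set e | exists X : set (tup M [:: tag e]),
     [/\ definable A X, finite_set X & X (tup1 (tagged e))]].

Definition is_code (S : Type) (L : language S) (M : structure L)
  (Gamma Delta : seq S) (X : set (tup M Gamma)) (b : tup M Delta) :=
  exists R : formula L (famsum (var Gamma) (var Delta)),
  X = defset R b /\ forall b', b <> b' -> defset R b <> defset R b'.

Definition coded (S : Type) (L : language S) (M : structure L)
  (Gamma : seq S) (X : set (tup M Gamma)) :=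
  exists (Delta : seq S) (b : tup M Delta), is_code X b.

Definition eliminates_imaginaries (S : Type) (L : language S)
  (T : set (sentence L)) :=
  forall M : structure L, models M T ->
  forall (Gamma : seq S) (X : set (tup M Gamma)), definable setT X -> coded X.

(*  A formula in one variable of sort [s] with parameters in [A] is a formula
    whose variables are the new variable of [bind (over A) s] and the elements
    of [A], each standing for itself.  When [A] is all of [M] we use
    [bind M s]. *)

Definition tp (S : Type) (L : language S) (M : structure L)
  (A : set (elt M)) (s : S) (c : M s) : set (formula L (bind (over A) s)) :=
  [set phi | sat (bindenv c (@overval S M A)) phi].
Arguments tp {S L M} A {s} c.

(* [|L|^+]-saturation: the realization of types over at most [|L|] parameters. *)
Definition saturated (S : Type) (L : language S) (M : structure L) :=
  forall A : set (elt M), A #<= [set: symbols L] ->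
  forall (s : S) (q : set (formula L (bind (over A) s))),
  (forall F, finite_set F -> F `<=` q -> exists a : M s, F `<=` tp A a) ->
  exists a : M s, q `<=` tp A a.

(* [|L|^+]-homogeneity, in the strong sense: small partial elementary maps
   extend to automorphisms. *)
Definition homogeneous (S : Type) (L : language S) (M : structure L) :=
  forall (A : set (elt M)) (f : fammap M M), A #<= [set: symbols L] ->
  elementary_on A f ->
  exists2 sigma : fammap M M, automorphism sigma &
  forall e, A e -> elt_map sigma e = elt_map f e.

Definition sat_at (S : Type) (L : language S) (M : structure L) (s : S)
  (a : M s) (phi : formula L (bind M s)) := sat (bindenv a (@famid S M)) phi.

Definition complete_type (S : Type) (L : language S) (N : structure L)
  (s : S) (p : set (formula L (bind N s))) :=
  (forall F, finite_set F -> F `<=` p ->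
     exists a : N s, forall phi, F phi -> sat_at a phi) /\
  (forall phi, p phi \/ p (Neg phi)).

Definition automorphism_over (S : Type) (L : language S) (N : structure L)
  (A : set (elt N)) (sigma : fammap N N) :=
  automorphism sigma /\ forall e, A e -> fixes sigma e.

Definition invariant_type (S : Type) (L : language S) (N : structure L)
  (A : set (elt N)) (s : S) (p : set (formula L (bind N s))) :=
  forall sigma, automorphism_over A sigma ->
  forall phi, p phi <-> p (rename (bindmap sigma) phi).

(* The consistency of [p|M] with [tp(c/A)], for a substructure [M] (embedded by
   [h]) of [N] in a smaller language.  The formulas of [p] are evaluated in [N];
   when the theory of [N] eliminates quantifiers they can be taken
   quantifier-free, and evaluated in [M] as well. *)
Definition consistent_with_tp (S : Type) (L0 L : language S)
  (M : structure L) (N : structure L0) (h : fammap M N) (s : S)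
  (p : set (formula L0 (bind N s))) (A : set (elt M)) (c : M s) :=
  forall (F : set (formula L0 (bind M s)))
    (G : set (formula L (bind (over A) s))),
  finite_set F -> F `<=` [set phi | p (rename (bindmap h) phi)] ->
  finite_set G -> G `<=` tp A c ->
  exists d : M s,
    (forall phi, F phi -> sat_at (h s d) (rename (bindmap h) phi)) /\
    G `<=` tp A d.

(* The definable set [X] belongs to the type [p]. *)
Definition in_type (S : Type) (L : language S) (N : structure L) (s : S)
  (p : set (formula L (bind N s))) (X : set (N s)) :=
  exists2 phi, p phi & X = [set a | sat_at a phi].

Definition definable_function (S : Type) (L : language S) (N : structure L)
  (s : S) (Gamma : seq S) (r : set (tup N (s :: Gamma))) :=
  definable setT r /\
  forall (a : N s) (y y' : tup N Gamma),
    r (tcons a y) -> r (tcons a y') -> y = y'.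

Definition domain (S : Type) (N : S -> Type) (s : S) (Gamma : seq S)
  (r : set (tup N (s :: Gamma))) : set (N s) :=
  [set a | exists y : tup N Gamma, r (tcons a y)].

(* The formula [r(x) = r'(x)] belongs to [p], that is, [r] and [r'] agree on
   a realization of [p]. *)
Definition same_germ (S : Type) (L : language S) (N : structure L) (s : S)
  (p : set (formula L (bind N s))) (Gamma : seq S)
  (r r' : set (tup N (s :: Gamma))) :=
  in_type p [set a | exists y : tup N Gamma, r (tcons a y) /\ r' (tcons a y)].

(* Only meaningful when [p] is invariant under [sigma]. *)
Definition fixes_germ (S : Type) (L : language S) (N : structure L) (s : S)
  (p : set (formula L (bind N s))) (Gamma : seq S)
  (r : set (tup N (s :: Gamma))) (sigma : fammap N N) :=
  same_germ p r (famcomp sigma @` r).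

Definition directed_order (I : Type) (le : I -> I -> Prop) :=
  [/\ (forall i, le i i) /\ (forall i j k, le i j -> le j k -> le i k),
      forall i j, le i j -> le j i -> i = j,
      inhabited I
    & forall i j, exists k, le i k /\ le j k].

(* Main.v *)
From Pilot Require Import Defs.
From HB Require Import structures.
From Stdlib Require List.
From mathcomp Require Import all_boot.
From mathcomp Require Import all_classical.
Import Pilot.Defs.

(** In the saturated and homogeneous model [M], coding a definable set [X] amounts
    to finding a finite set of elements of [M] with the same stabilizer as [X] in
    the automorphism group: a formula that codes [X] is then extracted by
    compactness ([coded_of_stabilizer]).  Compactness again shows that finitely
    many formulas code all the members of a definable family, so the conclusion
    passes to all models of the complete theory
    ([eliminates_imaginaries_transfer]).  The parameters of [X] may be taken of
    dominant sorts ([dominant_tuple]).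

    The heart of the proof ([coded_over]) is an induction on the tuple of
    parameters of [X], over an arbitrary small set [A0] of constants.  If the first
    parameter [c] is added to the constants, induction gives a tuple [eta] that
    codes [X] over [A0] and [c].  Write [eta] as the value at [c] of a definable
    partial function [f], which sends [x] to a code of [X] relative to [x]: two
    conjugates of [f] that agree at a single point come from the same conjugate of
    [X].  Let [A] be the set of the elements of [M] with finitely many conjugates
    over [A0] and [X].  By P. M. Neumann's separation lemma and saturation, a small
    set disjoint from [A] can be moved, all points at once, by an automorphism that
    fixes [X] and the points of [A] ([move_outside]).  In particular the code of a
    unary set that is definable from [X] and [A] cannot lie outside [A], so such a
    set is [A]-definable ([coded_dfn_real_acl]).

    Let [p] be the invariant type attached to [A] and [c], and call generic the
    points that realize both [p] and the type of [c] over [A].  Relative algebraic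
    boundedness and compactness provide a family [E] of finite sets, definable in
    the small language over [M], such that [f x] is in [E x] for all generic [x].
    If [E] has least generic cardinality [n], its germ is fixed by the automorphisms
    over [A] that fix [f]: otherwise the intersection of [E] with a conjugate would
    be smaller.  By elimination of imaginaries [E] is given by a function, and its
    germ is determined by almost all the members of a family of elements, each of
    them interdefinable with a tuple of [M].  Almost all these tuples lie in [A],
    for otherwise [move_outside] would move cofinally many of them by an
    automorphism that fixes the germ.  Hence the germ of [E] is fixed by all the
    automorphisms over [A] ([canonical_good]); at a generic point the conjugates of
    [f] over [A] take their values in one set of [n] elements, and among [n + 1] of
    them two agree ([conjugates_meet]).

    Consequently [eta] has at most [n] conjugates over [A] and [c].  It is algebraic
    over them, so by weak rigidity it is fixed by the automorphisms over [A] and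
    [c], and [X] is definable over [A] and [c].  The set of points [x] that define
    [X] in the way [c] does is unary, hence [A]-definable, and contains all the
    conjugates of [c] over [A]; therefore [X] is [A]-definable.  Finally the tuple of
    [A] that defines [X] has finitely many conjugates over [A0] and [X], and finite
    sets of tuples of [M] are coded, because their codes in the large structure can
    be internalized ([finite_coded]). *)

Set Implicit Arguments.
Unset Strict Implicit.
Unset Printing Implicit Defensive.

Local Open Scope classical_set_scope.
Local Open Scope card_scope.

(** * Cardinal arithmetic *)

Definition injects (T K : Type) := exists f : T -> K, injective f.

Lemma injects_refl T : injects T T.
Proof. by exists id. Qed.

Lemma injects_trans T U K : injects T U -> injects U K -> injects T K.
Proof. by move=> [f fi] [g gi]; exists (g \o f); exact: inj_comp. Qed.

Lemma injects_sig T (A B : set T) :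
  A `<=` B -> injects {x | A x} {x | B x}.
Proof.
move=> AB; exists (fun x => exist B (sval x) (AB _ (svalP x))).
by move=> [x Ax] [y Ay] /= [xy]; exact: eq_exist.
Qed.

Lemma injects_setP T K (A : set T) : inhabited K ->
  A #<= [set: K] <-> injects {x | A x} K.
Proof.
move=> [k0]; pose pK := isPointed.Build K k0.
pose K' : pointedType := HB.pack K (gen_eqMixin K) (gen_choiceMixin K) pK.
split.
  move=> /(@pcard_injP T K')[f finj]; exists (fun x => f (sval x)).
  move=> [x Ax] [y Ay] /= xy; apply: eq_exist.
  by apply: finj => //; rewrite inE.
move=> [f fi]; apply/(@pcard_injP T K').
exists (fun x => if pselect (A x) is left Ax then f (exist _ x Ax) else k0).
move=> x y; rewrite !inE => Ax Ay.
by case: pselect => // Ax'; case: pselect => // Ay' /fi [].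
Qed.

(** A maximal one-to-one correspondence between a part of [T] and a part of [U]
    must exhaust one of the two types. *)
Lemma injects_comparable (T U : Type) : injects T U \/ injects U T.
Proof.
pose P (F : set (T * U)) :=
  (forall x y y', F (x, y) -> F (x, y') -> y = y') /\
  (forall x x' y, F (x, y) -> F (x', y) -> x = x').
have [F [[F1 F2] Fmax]] : exists F, P F /\ forall B, F `<` B -> ~ P B.
  apply: Zorn_bigcup => C CP Ctot; split.
    move=> x y y' [X CX Xy] [Y CY Yy'].
    have [XY|YX] := Ctot _ _ CX CY.
      exact: (CP _ CY).1 (XY _ Xy) Yy'.
    exact: (CP _ CX).1 Xy (YX _ Yy').
  move=> x y y' [X CX Xy] [Y CY Yy'].
  have [XY|YX] := Ctot _ _ CX CY.
    exact: (CP _ CY).2 (XY _ Xy) Yy'.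
  exact: (CP _ CX).2 Xy (YX _ Yy').
have [domF|] := pselect (forall x, exists y, F (x, y)).
  left; have [f fP] := choice domF; exists f => x x' xx'.
  by apply: F2 (fP x) _; rewrite xx'.
move=> /existsNP[x /forallNP Fx].
have [ranF|] := pselect (forall y, exists x, F (x, y)).
  right; have [f fP] := choice ranF; exists f => y y' yy'.
  by apply: F1 (fP y) _; rewrite yy'.
move=> /existsNP[y /forallNP Fy]; exfalso.
apply: (Fmax (F `|` [set (x, y)])).
  split; first by left.
  by move=> /(_ (x, y)); move=> H; apply: (Fx y); apply: H; right.
split.
  move=> a b b' [Fab|[-> ->]] [Fab'|[]].
  - exact: F1 Fab Fab'.
  - by move=> ax; case: (Fx b); rewrite -ax.
  - by move: Fab' => /Fx.
  - by move=> ->.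
move=> a a' b [Fab|[-> ->]] [Fab'|[]].
- exact: F2 Fab Fab'.
- by move=> _ bx; case: (Fy a); rewrite -bx.
- by move: Fab' => /Fy.
- by move=> ->.
Qed.

(** Hessenberg's theorem.  A maximal injection of [X * X] into a subset [X]
    has [X] as large as the whole of [K]: otherwise the complement of [X]
    contains a copy [Y] of [X], and the rest of the square of [X + Y], which
    still has the cardinality of [X], can be sent into [Y]. *)
Lemma injects_square K : injects nat K -> injects (K * K) K.
Proof.
move=> [i0 i0inj].
pose dom (F : set ((K * K) * K)) := [set x | exists z, F ((x, x), z)].
pose valid F := [/\ forall p z z', F (p, z) -> F (p, z') -> z = z',
  forall p p' z, F (p, z) -> F (p', z) -> p = p',
  forall x y z, F ((x, y), z) -> [/\ dom F x, dom F y & dom F z]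
  & forall x y, dom F x -> dom F y -> exists z, F ((x, y), z)].
pose F0 : set ((K * K) * K) := [set w | exists m n,
  w = ((i0 m, i0 n), i0 (pickle (m, n)))].
have domF0 n : dom F0 (i0 n) by exists (i0 (pickle (n, n))), n, n.
have pinj : injective (@pickle (nat * nat)%type) by exact: pcan_inj pickleK.
have valid0 : valid F0.
  split.
  - move=> p z z' [m [n [-> ->]]] [m' [n' [/i0inj -> /i0inj -> ->]]] //.
  - move=> p p' z [m [n [-> ->]]] [m' [n' [-> /i0inj/pinj[-> ->]]]] //.
  - by move=> x y z [m [n [-> -> ->]]]; split.
  - by move=> x y [_ [m [_ [-> _ _]]]] [_ [n [_ [-> _ _]]]];
      exists (i0 (pickle (m, n))), m, n.
have [G [vG Gmax]] : exists G, valid (F0 `|` G) /\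
    forall B, G `<` B -> ~ valid (F0 `|` B).
  apply: (@Zorn_bigcup _ (fun G => valid (F0 `|` G))) => C CP Ctot.
  have [->|[G0 CG0]] : C = set0 \/ C !=set0 by have [|/set0P] := eqVneq C set0; [left|right].
    by rewrite bigcup_set0 setU0.
  set U := F0 `|` _.
  have sub X : C X -> F0 `|` X `<=` U.
    by move=> CX w [?|?]; [left|right; exists X].
  have domsub X x : C X -> dom (F0 `|` X) x -> dom U x.
    by move=> CX [z /(sub _ CX) ?]; exists z.
  have two a b : U a -> U b -> exists2 X, C X & (F0 `|` X) a /\ (F0 `|` X) b.
    move=> [a0|[X CX Xa]] [b0|[Y CY Yb]].
    - by exists G0 => //; split; left.
    - by exists Y => //; split; [left|right].
    - by exists X => //; split; [right|left].
    - have [XY|YX] := Ctot _ _ CX CY.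
        by exists Y => //; split; right => //; apply: XY.
      by exists X => //; split; right => //; apply: YX.
  split.
  - by move=> p z z' Ua Ub; have [X /CP[+ _ _ _] [? ?]] := two _ _ Ua Ub; apply; eassumption.
  - by move=> p p' z Ua Ub; have [X /CP[_ + _ _] [? ?]] := two _ _ Ua Ub; apply; eassumption.
  - move=> x y z Ua; have [X CX [Xa _]] := two _ _ Ua Ua.
    have [_ _ /(_ _ _ _ Xa)[dx dy dz] _] := CP _ CX.
    by split; exact: domsub CX _.
  - move=> x y [z Ua] [t Ub]; have [X CX [Xa Xb]] := two _ _ Ua Ub.
    have [_ _ _ /(_ x y)[||w Xw]] := CP _ CX; [by exists z|by exists t|].
    by exists w; apply: sub Xw.
set F := F0 `|` G in vG.
have [Ffun Finj Fdom Ftot] := vG.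
pose X := {x | dom F x}.
have domF n : dom F (i0 n) by exists (i0 (pickle (n, n))); left; exists n, n.
have [x0 [x1 x01]] : exists x0 x1 : X, x0 <> x1.
  exists (exist _ (i0 0) (domF 0)), (exist _ (i0 1) (domF 1)).
  by move=> /(congr1 sval)/= /i0inj.
have [phi phiP] : exists phi : X * X -> X,
    forall p, F ((sval p.1, sval p.2), sval (phi p)).
  suff H : forall p : X * X, exists z : X, F ((sval p.1, sval p.2), sval z).
    have [phi phiP] := choice H; by exists phi.
  move=> [[x dx] [y dy]] /=.
  have [z Fz] := Ftot _ _ dx dy; have [_ _ dz] := Fdom _ _ _ Fz.
  by exists (exist _ z dz).
have phi_inj : injective phi.
  move=> p q pq; have := phiP p; rewrite pq => /Finj/(_ (phiP q)).
  move: p q {pq} => [[x dx] [y dy]] [[x' dx'] [y' dy']] /= [xx yy].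
  by congr pair; exact: eq_exist.
have XK : injects X K by exists sval => -[x dx] [y dy] /= xy; exact: eq_exist.
have XX : injects (X * X) X by exists phi.
(* A copy of [X] inside its complement, unless [X] has the cardinality of [K]. *)
have [[g ginj]|[g ginj]] := injects_comparable {x | ~ dom F x} X.
  pose c x := if pselect (dom F x) is left dx then phi (x0, exist _ x dx) else
    if pselect (~ dom F x) is left dx then phi (x1, g (exist _ x dx)) else x0.
  have cinj : injective c.
    move=> x y; rewrite /c; case: pselect => dx.
      case: pselect => dy; first by move=> /phi_inj[].
      by case: pselect => // dy'; move=> /phi_inj[].
    case: pselect => // dx'; case: pselect => dy; first by move=> /phi_inj[] /esym.
    by case: pselect => // dy'; move=> /phi_inj[] /ginj[].
  apply: injects_trans XK; apply: injects_trans XX.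
  exists (fun p => (c p.1, c p.2)) => -[x y] [x' y'] /= [/cinj -> /cinj ->] //.
exfalso.
have Yout x : ~ dom F (sval (g x)) by exact: svalP (g x).
pose Y := [set y | exists x, y = sval (g x)].
(* [c y p]: the pair [p] is the code of the point [y] of [X] or of [Y]; the first
   component tells which of the two. *)
pose c (y : K) : set (X * X) := [set p | (sval p.2 = y /\ p.1 = x0) \/ (sval (g p.2) = y /\
    p.1 = x1)].
have cinj y y' p : c y p -> c y' p -> y = y'.
  by move=> [[<- e]|[<- e]] [[<- e']|[<- e']] //; case: x01; rewrite -e -e'.
have cfun y p p' : c y p -> c y p' -> p = p'.
  move: p p' => [a b] [a' b'].
  move=> [[/= <- ->]|[/= <- ->]] [[/= bb ->]|[/= bb ->]].
  - congr pair; move: b b' bb => [? ?] [? ?] /= bb; exact: eq_exist.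
  - by case: (Yout b'); rewrite bb; exact: svalP b.
  - by case: (Yout b); rewrite -bb; exact: svalP b'.
  - congr pair; apply: ginj; move: bb.
    move: (g b) (g b') => [? ?] [? ?] /= bb; exact: eq_exist.
have ctot y : dom F y \/ Y y -> exists p, c y p.
  move=> [dy|[x ->]]; first by exists (x0, exist _ y dy); left.
  by exists (x1, x); right.
pose G' := [set w : (K * K) * K | ~ (dom F w.1.1 /\ dom F w.1.2) /\
   exists p q, [/\ c w.1.1 p, c w.1.2 q & w.2 = sval (g (phi (phi p, phi q)))]].
have domE x : dom (F0 `|` (G `|` G')) x = (dom F x \/ Y x).
  apply/propext; split=> [[z]|[[z Fz]|Yx]].
  - rewrite setUA -/F => -[Fz|[/= ndx [p [_ [[[<- _]|[<- _]] _ _]]]]].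
    + by left; exists z.
    + by left; exact: svalP p.2.
    + by right; exists p.2.
  - by exists z; rewrite setUA; left.
  - have [p cp] := ctot _ (or_intror Yx).
    exists (sval (g (phi (phi p, phi p)))); rewrite setUA; right; split=> /=.
      by move: Yx => [y ->] [/Yout].
    by exists p, p.
apply: (Gmax (G `|` G')).
  split; first by left.
  move=> sub; have Yx : Y (sval (g x0)) by exists x0.
  have [p cp] := ctot _ (or_intror Yx).
  have : G ((sval (g x0), sval (g x0)), sval (g (phi (phi p, phi p)))).
    by apply: sub; right; split=> /=; [move=> [/Yout]|exists p, p].
  by move=> Gx; have [/Yout] : [/\ dom F (sval (g x0)), dom F (sval (g x0)) & dom F (sval
      (g (phi (phi p, phi p))))] by apply: Fdom; right.
split.
- move=> [x y] z z'; rewrite setUA => -[Fz|[/= nd [p [q [cp cq ->]]]]] [Fz'|[/= nd' [p' [q'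
    [cp' cq' ->]]]]].
  + exact: Ffun Fz Fz'.
  + by have [dx dy _] := Fdom _ _ _ Fz; case: nd'.
  + by have [dx dy _] := Fdom _ _ _ Fz'; case: nd.
  + by rewrite (cfun _ _ _ cp cp') (cfun _ _ _ cq cq').
- move=> [x y] [x' y'] z; rewrite setUA => -[Fz|[/= nd [p [q [cp cq zE]]]]] [Fz'|[/= nd'
    [p' [q' [cp' cq' zE']]]]].
  + exact: Finj Fz Fz'.
  + by have [_ _] := Fdom _ _ _ Fz; rewrite zE' => /Yout.
  + by have [_ _] := Fdom _ _ _ Fz'; rewrite zE => /Yout.
  + move: zE; rewrite zE' => gg.
    have : g (phi (phi p', phi q')) = g (phi (phi p, phi q)).
      by move: (g _) (g _) gg => [? ?] [? ?] /= gg; exact: eq_exist.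
    move=> /ginj/phi_inj[/phi_inj pp /phi_inj qq]; subst p' q'.
    by rewrite (cinj _ _ _ cp cp') (cinj _ _ _ cq cq').
- move=> x y z H; rewrite !domE; move: H; rewrite setUA => -[/Fdom[dx dy dz]|[/= nd [p [q
    [cp cq ->]]]]].
    by split; left.
  split; last by right; exists (phi (phi p, phi q)).
    by move: cp => [[<- _]|[<- _]]; [left; exact: svalP p.2|right; exists p.2].
  by move: cq => [[<- _]|[<- _]]; [left; exact: svalP q.2|right; exists q.2].
- move=> x y; rewrite !domE setUA => dx dy.
  have [[dx' dy']|nd] := pselect (dom F x /\ dom F y).
    by have [z Fz] := Ftot _ _ dx' dy'; exists z; left.
  have [p cp] := ctot _ dx; have [q cq] := ctot _ dy.
  by exists (sval (g (phi (phi p, phi q)))); right; split=> //; exists p, q.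
Qed.

(** * Counting terms and formulas *)

Lemma existT_inj (I : Type) (T : I -> Type) i (x y : T i) :
  existT T i x = existT T i y -> x = y.
Proof.
move=> e; have := projT2_eq e; rewrite /=.
by rewrite (Prop_irrelevance (projT1_eq e) erefl).
Qed.

Lemma famext (S : Type) (V W : S -> Type) (f g : fammap V W) :
  (forall s v, f s v = g s v) -> f = g.
Proof.
by move=> fg; apply: functional_extensionality_dep => s;
  apply: functional_extensionality_dep => v.
Qed.

Lemma bindP (S : Type) (V : S -> Type) (s : S) (v : bind V s s) :
  v = new \/ exists w, v = old w.
Proof.
suff H s' (u : bind V s s') :
    (exists e : s = s', u = eq_rect s (bind V s) new s' e) \/ exists w, u = old w.
  have [[e ->]|?] := H _ v; last by right.
  by left; rewrite (Prop_irrelevance e erefl).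
by case: u => [|s'' w]; [left; exists erefl|right; exists w].
Qed.

Section Counting.
Variables (K : Type) (natK : injects nat K).

Lemma injects_pair T U : injects T K -> injects U K -> injects (T * U) K.
Proof.
move=> [f fi] [g gi]; apply: injects_trans (injects_square natK).
by exists (fun p => (f p.1, g p.2)) => -[x y] [x' y'] /= [/fi -> /gi ->].
Qed.

Lemma injects_tag (I : Type) (T : I -> Type) :
  injects I K -> (forall i, injects (T i) K) -> injects {i : I & T i} K.
Proof.
move=> [f fi] H; apply: injects_trans (injects_square natK).
have H' : forall i, exists g : {i : I & T i} -> K,
    forall x y : T i, g (existT T i x) = g (existT T i y) -> x = y.
  move=> i; have [g gi] := H i.
  have [k _] := natK.
  exists (fun x => if pselect (tag x = i) is left e then
     g (eq_rect _ T (tagged x) _ e) else k 0%N) => x y /=.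
  case: pselect => // e; rewrite (Prop_irrelevance e erefl) /=.
  by move=> /gi ->.
have [g gi] := choice H'.
exists (fun x => (f (tag x), g (tag x) x)) => -[i x] [j y] /= [/fi ij].
by subst j; move=> /gi ->.
Qed.

Lemma injects_sum T U : injects T K -> injects U K -> injects (T + U) K.
Proof.
move=> tK uK; apply: (@injects_trans _ {b : bool & if b then T else U}).
  exists (fun x => match x with inl t => existT (fun b : bool => if b then T else U) true t
      | inr u => existT _ false u end).
  by move=> [t|u] [t'|u'] // e; rewrite (existT_inj e).
apply: injects_tag => [|[]] //.
by apply: injects_trans natK; exists nat_of_bool => -[] [].
Qed.

Lemma injects_seq T : injects T K -> injects (seq T) K.
Proof.
move=> [f fi]; have [j ji] := injects_square natK; have [k _] := natK.
pose cd := fix cd (s : seq T) := if s is x :: s' then j (f x, cd s') else k 0%N.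
apply: (injects_trans _ (injects_pair natK (injects_refl K))).
exists (fun s => (size s, cd s)) => s t [].
elim: s t => [|x s IH] [|y t] //= [/IH {}IH] /ji [/fi -> /IH ->] //.
Qed.

Lemma injects_tree T : injects T K -> injects (GenTree.tree T) K.
Proof.
move=> tK; apply: (@injects_trans _ (seq (nat + T))).
  exists (@GenTree.encode T); exact: pcan_inj (@GenTree.codeK T).
exact/injects_seq/injects_sum.
Qed.

Fixpoint args_seq (S : Type) (Gamma : seq S) (T : Type) :
    (forall s, var Gamma s -> T) -> seq T :=
  match Gamma with
  | [::] => fun=> [::]
  | s :: Delta => fun g => g s new :: args_seq (fun s' v => g s' (old v))
  end.

Lemma args_seq_inj (S : Type) (Gamma : seq S) (T : Type)
    (g g' : forall s, var Gamma s -> T) :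
  args_seq g = args_seq g' -> forall s v, g s v = g' s v.
Proof.
elim: Gamma g g' => [|s0 Gamma IH] g g' /= => [_ s []|[e /IH es] s v].
case: v => // s' w; exact: es.
Qed.

Variables (S : Type) (L : language S).
Variables (cS : S -> K) (cF : {Gamma : seq S & {s : S & func L Gamma s}} -> K)
  (cR : {Gamma : seq S & relsym L Gamma} -> K).
Hypotheses (cSi : injective cS) (cFi : injective cF) (cRi : injective cR).

Fixpoint enc_term (V : S -> Type) (c : forall s, V s -> K) s (t : term L V s) :
    GenTree.tree K :=
  match t with
  | Var _ v => GenTree.Leaf (c _ v)
  | App Gamma s f args => GenTree.Node 0
     (GenTree.Leaf (cF (existT _ Gamma (existT _ s f)))
      :: args_seq (fun s' v => enc_term c (args s' v)))
  end.

Lemma enc_term_inj (V : S -> Type) (c : forall s, V s -> K) :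
  (forall s, injective (c s)) -> forall s, injective (@enc_term V c s).
Proof.
move=> ci s; elim=> {s} [s v|Gamma s f args IH] u.
  by case: u v => [s' w|//] v /= [/ci ->].
case: u f => [//|Gamma' s' f' args'] f /= [/cFi e].
have eG := congr1 (@tag _ _) e; rewrite /= in eG; subst Gamma'.
have ef := existT_inj (existT_inj e); subst f'; move=> /args_seq_inj ea.
congr App; apply: functional_extensionality_dep => s0.
by apply: functional_extensionality_dep => v; exact: IH (ea _ _).
Qed.

Hypothesis kk : K * K -> K.
Hypothesis kki : injective kk.
Variable kn : nat -> K.
Hypothesis kni : injective kn.

(** The codes of the variables in scope are shifted when a quantifier is crossed. *)
Definition bind_code (V : S -> Type) (c : forall s, V s -> K) (s : S) :
    forall s', bind V s s' -> K :=
  fun s' v => match v with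
    | new => kk (kn 0, kn 0)
    | old s' w => kk (kn 1, c s' w)
  end.

Lemma bind_code_inj (V : S -> Type) (c : forall s, V s -> K) (s : S) :
  (forall s, injective (c s)) -> forall s', injective (@bind_code V c s s').
Proof.
move=> ci s' v; case: v => [|s'' v] w.
  have [->//|[u ->] /= /kki e] := bindP w.
  by have := kni (congr1 fst e).
case: w v => [|s1 w] v /= /kki e; first by have := kni (congr1 fst e).
by rewrite (ci _ _ _ (congr1 snd e)).
Qed.

Fixpoint enc_formula (V : S -> Type) (phi : formula L V) :
    (forall s, V s -> K) -> GenTree.tree K :=
  match phi with
  | Fal => fun=> GenTree.Node 0 [::]
  | Eq s t u => fun c =>
      GenTree.Node 1 [:: GenTree.Leaf (cS s); enc_term c t; enc_term c u]
  | Rel Gamma P args => fun c => GenTree.Node 2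
      (GenTree.Leaf (cR (existT _ Gamma P)) ::
       args_seq (fun s v => enc_term c (args s v)))
  | Imp phi1 phi2 => fun c =>
      GenTree.Node 3 [:: enc_formula phi1 c; enc_formula phi2 c]
  | All s phi1 => fun c =>
      GenTree.Node 4 [:: GenTree.Leaf (cS s); enc_formula phi1 (bind_code c (s := s))]
  end.

Lemma enc_formula_inj (V : S -> Type) (phi psi : formula L V) c :
  (forall s, injective (c s)) -> enc_formula phi c = enc_formula psi c ->
  phi = psi.
Proof.
elim: phi psi c => {V} [V|V s t u|V Gamma P args|V phi1 IH1 phi2 IH2|V s phi IH]
  [|s' t' u'|Gamma' P' args'|psi1 psi2|s' psi] c ci //=.
- by move=> [/cSi e]; subst s'; move=> /(enc_term_inj ci) -> /(enc_term_inj ci) ->.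
- move=> [/cRi e]; have eG := congr1 (@tag _ _) e; rewrite /= in eG; subst Gamma'.
  have eP := existT_inj e; subst P'; move=> /args_seq_inj ea.
  by congr Rel; apply: famext => s0 v; exact: enc_term_inj (ea _ _).
- by move=> [/(IH1 _ _ ci) -> /(IH2 _ _ ci) ->].
- move=> [/cSi e]; subst s'; move=> /(IH _ _ (@bind_code_inj _ _ _ ci)) -> //.
Qed.

End Counting.

(** Formulas are finite trees labelled by symbols and variables.  This is why sets
    of formulas, algebraic closures and Skolem hulls of small sets are small
    enough for saturation and homogeneity to apply to them. *)
Lemma injects_formula (S : Type) (L : language S) (V : S -> Type) K :
  injects nat K -> injects S K ->
  injects {Gamma : seq S & {s : S & func L Gamma s}} K ->
  injects {Gamma : seq S & relsym L Gamma} K ->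
  (forall s, injects (V s) K) -> injects (formula L V) K.
Proof.
move=> nK [cS cSi] [cF cFi] [cR cRi] vK.
have [kk kki] := injects_square nK; have [kn kni] := nK.
pose c s := sval (cid (vK s)).
have ci s : injective (c s) by exact: svalP (cid (vK s)).
apply: injects_trans (injects_tree nK (injects_refl K)).
exists (fun phi => enc_formula cS cF cR kk kn phi c) => phi psi.
exact: enc_formula_inj.
Qed.

Lemma injects_term (S : Type) (L : language S) (V : S -> Type) s K :
  injects nat K ->
  injects {Gamma : seq S & {s : S & func L Gamma s}} K ->
  (forall s, injects (V s) K) -> injects (term L V s) K.
Proof.
move=> nK [cF cFi] vK.
pose c s := sval (cid (vK s)).
have ci s' : injective (c s') by exact: svalP (cid (vK s')).
apply: injects_trans (injects_tree nK (injects_refl K)).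
by exists (@enc_term K S L cF V c s) => t u; exact: enc_term_inj.
Qed.

Section Symbols.
Variables (S : Type) (L : language S).
Let K := symbols L.

Lemma injects_nat : injects nat K.
Proof. by exists (fun n => inl (inl (inl n))) => m n [->]. Qed.

Lemma injects_sort : injects S K.
Proof. by exists (fun n => inl (inl (inr n))) => m n [->]. Qed.

Lemma injects_func : injects {Gamma : seq S & {s : S & func L Gamma s}} K.
Proof. by exists (fun n => inl (inr n)) => m n [->]. Qed.

Lemma injects_rel : injects {Gamma : seq S & relsym L Gamma} K.
Proof. by exists (fun n => inr n) => m n [->]. Qed.

End Symbols.

(** * Substitution and finite supports *)

Section Syntax.
Variables (S : Type) (L : language S).
Implicit Types (V W : S -> Type).

Lemma famcompA (U V W X : S -> Type) (f : fammap W X) (g : fammap V W)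
    (k : fammap U V) :
  famcomp f (famcomp g k) = famcomp (famcomp f g) k.
Proof. by []. Qed.

Lemma bindenv_bindmap V W (M : S -> Type) s (a : M s) (rho : fammap W M)
    (f : fammap V W) :
  famcomp (bindenv a rho) (bindmap f) = bindenv a (famcomp rho f) :> fammap (bind V s) M.
Proof. by apply: famext => s' []. Qed.

Lemma famcomp_bindenv V (M N : S -> Type) s (a : M s) (rho : fammap V M)
    (f : fammap M N) :
  famcomp f (bindenv a rho) = bindenv (f s a) (famcomp f rho).
Proof. by apply: famext => s' []. Qed.

Lemma famcomp_case V W (M N : S -> Type) (f : fammap M N) (x : fammap V M) (y : fammap W M) :
  famcomp f (famcase x y) = famcase (famcomp f x) (famcomp f y).
Proof. by apply: famext => s []. Qed.

Lemma tup_eta (M : S -> Type) s Gamma (x : tup M (s :: Gamma)) :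
  x = tcons (x s new) (fun s' v => x s' (old v)).
Proof. by apply: famext => s' []. Qed.

Lemma tup_nil (M : S -> Type) (x : tup M [::]) : x = @novar S M.
Proof. by apply: famext => s []. Qed.

Lemma tcons_inj (M : S -> Type) s Gamma (a b : M s) (x y : tup M Gamma) :
  tcons a x = tcons b y -> a = b /\ x = y.
Proof.
move=> e; split; first exact: (congr1 (fun z => z s new) e).
apply: famext => s' v; exact: (congr1 (fun z : tup M (s :: Gamma) => z s' (old v)) e).
Qed.

Lemma eval_trename (M : structure L) V W (f : fammap V W) (rho : fammap W M) s
    (t : term L V s) :
  eval rho (trename f t) = eval (famcomp rho f) t.
Proof.
elim: t => //= Gamma s' g args IH; congr func_in.
by apply: famext => s0 v; exact: IH.
Qed.

Lemma sat_rename (M : structure L) V W (f : fammap V W) (rho : fammap W M)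
    (phi : formula L V) :
  sat rho (rename f phi) = sat (famcomp rho f) phi.
Proof.
elim: phi W f rho => {V} [V|V s t u|V Gamma P args|V phi IH1 psi IH2|V s phi IH] W f rho //=.
- by rewrite !eval_trename.
- by congr rel_in; apply: famext => s v; rewrite eval_trename.
- by rewrite IH1 IH2.
- by apply/propext; split=> H a; have := H a; rewrite IH bindenv_bindmap.
Qed.

Lemma trename_comp U V W (f : fammap V W) (g : fammap U V) s (t : term L U s) :
  trename f (trename g t) = trename (famcomp f g) t.
Proof.
elim: t => //= Gamma s' h args IH; congr App.
by apply: famext => s0 v; exact: IH.
Qed.

Lemma rename_comp U V W (f : fammap V W) (g : fammap U V) (phi : formula L U) :
  rename f (rename g phi) = rename (famcomp f g) phi.
Proof.
elim: phi V W f g => {U} [U|U s t u|U Gamma P args|U phi IH1 psi IH2|U s phi IH] V W f g //=.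
- by rewrite !trename_comp.
- by congr Rel; apply: famext => s v; rewrite trename_comp.
- by rewrite IH1 IH2.
- by rewrite IH; congr All; congr rename; apply: famext => s' [].
Qed.

(** Contexts [var Gamma] may miss some sorts, so a formula cannot be restricted to
    the variables that occur in it by a retraction of [V].  A finite support is
    instead a formula over some [var Gamma] together with a renaming into [V], and
    supports are merged along the following factorizations. *)
Lemma support_merge V Gamma1 Gamma2 (g1 : fammap (var Gamma1) V)
    (g2 : fammap (var Gamma2) V) :
  exists Gamma (g : fammap (var Gamma) V) u1 u2,
    g1 = famcomp g u1 /\ g2 = famcomp g u2.
Proof.
elim: Gamma1 g1 => [|s Gamma1 IH] g1.
  exists Gamma2, g2, (fun s (v : void) => match v with end), (@famid _ _).
  by split=> //; apply: famext => s [].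
have [Gamma [g [u1 [u2 [e1 e2]]]]] := IH (fun s' v => g1 s' (old v)).
exists (s :: Gamma), (bindenv (g1 s new) g), (bindmap u1), (fun s' v => old (u2 s' v)).
split; last by rewrite e2.
apply: famext => s' [//|s'' v] /=.
exact: (congr1 (fun k : fammap (var Gamma1) V => k s'' v) e1).
Qed.

Lemma support_bind V Gamma s (g : fammap (var Gamma) (bind V s)) :
  exists Delta (k : fammap (var Delta) V) (u : fammap (var Gamma) (bind (var Delta) s)),
    g = famcomp (bindmap k) u.
Proof.
elim: Gamma g => [|s1 Gamma IH] g.
  exists [::], (fun s (v : void) => match v with end),
    (fun s (v : void) => match v with end).
  by apply: famext => s' [].
have [Delta [k [u e]]] := IH (fun s' v => g s' (old v)).
have e' s' v : g s' (old v) = bindmap k (u s' v).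
  exact: (congr1 (fun x : fammap (var Gamma) (bind V s) => x s' v) e).
have [w gw] : exists w, g s1 new = w by exists (g s1 new).
case: w g {IH e} e' gw => [|s2 w] g e' gnew.
  exists Delta, k, (bindenv new u); apply: famext => s' [|s'' v] /=; [exact: gnew|exact: e'].
exists (s2 :: Delta), (bindenv w k), (bindenv (old new) (fun s' v => bindmap (fun _ x =>
    old x) (u s' v))).
apply: famext => s' [|s'' v] /=; first exact: gnew.
rewrite e'; rewrite /famcomp /=; case: (u s'' v) => //.
Qed.

Lemma support_args V Gamma (args : fammap (var Gamma) (term L V)) :
  (forall s v, exists Delta (g : fammap (var Delta) V) t0, args s v = trename g t0) ->
  exists Delta (g : fammap (var Delta) V) (args0 : fammap (var Gamma) (term L (var Delta))),
    args = fun s v => trename g (args0 s v).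
Proof.
elim: Gamma args => [|s Gamma IH] args H.
  exists [::], (fun s (v : void) => match v with end), (fun s (v : void) => match v with end).
  by apply: famext => s [].
have [D1 [g1 [t0 e1]]] := H s new.
have [D2 [g2 [args0 e2]]] := IH (fun s' v => args s' (old v)) (fun s' v => H s' (old v)).
have [D [g [u1 [u2 [eg1 eg2]]]]] := support_merge g1 g2.
exists D, g, (bindenv (M := term L (var D)) (trename u1 t0) (fun s' v => trename u2 (args0
    s' v))).
apply: famext => s' [|s'' v] /=; rewrite trename_comp.
  by rewrite e1 eg1.
have := congr1 (fun k : fammap (var Gamma) (term L V) => k s'' v) e2.
by rewrite /= => ->; rewrite eg2.
Qed.

Lemma support_term V s (t : term L V s) :
  exists Gamma (g : fammap (var Gamma) V) t0, t = trename g t0.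
Proof.
elim: t => {s} [s v|Gamma s f args IH].
  by exists [:: s], (tup1 v), (Var L (new : var [:: s] s)).
have [D [g [args0 e]]] := support_args IH.
by exists D, g, (App f args0); rewrite e.
Qed.

Lemma support_formula V (phi : formula L V) :
  exists Gamma (g : fammap (var Gamma) V) phi0, phi = rename g phi0.
Proof.
elim: phi => {V} [V|V s t u|V Gamma P args|V phi [D1 [g1 [p1 ->]]] psi [D2 [g2 [p2 ->]]]|V
    s phi [D [g [p ->]]]].
- by exists [::], (fun s (v : void) => match v with end), Fal.
- have [D1 [g1 [t0 ->]]] := support_term t; have [D2 [g2 [u0 ->]]] := support_term u.
  have [D [g [u1 [u2 [-> ->]]]]] := support_merge g1 g2.
  by exists D, g, (Eq (trename u1 t0) (trename u2 u0)); rewrite /= !trename_comp.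
- have [D [g [args0 ->]]] := support_args (fun s v => support_term (args s v)).
  by exists D, g, (Rel P args0).
- have [D [g [u1 [u2 [-> ->]]]]] := support_merge g1 g2.
  by exists D, g, (Imp (rename u1 p1) (rename u2 p2)); rewrite /= !rename_comp.
- have [E [k [u ->]]] := support_bind g.
  by exists E, k, (All (rename u p)); rewrite /= rename_comp.
Qed.

Lemma support_formula_bind V s (phi : formula L (bind V s)) :
  exists Gamma (g : fammap (var Gamma) V) (phi0 : formula L (bind (var Gamma) s)),
    phi = rename (bindmap g) phi0.
Proof.
have [D [g [p ->]]] := support_formula phi.
have [E [k [u ->]]] := support_bind g.
by exists E, k, (rename u p); rewrite rename_comp.
Qed.

Lemma support_sum V W Gamma (k : fammap (var Gamma) (famsum V W)) :
  exists D1 (g : fammap (var D1) V) D2 (d : fammap (var D2) W)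
    (u : fammap (var Gamma) (famsum (var D1) (var D2))),
    k = famcomp (famcase (fun s v => inl (g s v)) (fun s w => inr (d s w))) u.
Proof.
elim: Gamma k => [|s Gamma IH] k.
  exists [::], (fun s (v : void) => match v with end),
    [::], (fun s (v : void) => match v with end), (fun s (v : void) => match v with end).
  by apply: famext => s [].
have [D1 [g [D2 [d [u e]]]]] := IH (fun s' v => k s' (old v)).
have e' s' v : k s' (old v) =
    famcase (fun s v => inl (g s v)) (fun s w => inr (d s w)) (u s' v).
  exact: (congr1 (fun x : fammap (var Gamma) _ => x s' v) e).
case knew : (k s new) => [v|w].
  exists (s :: D1), (bindenv v g), D2, d, (bindenv (M := famsum (var (s :: D1)) (var D2))
    (inl new) (fun s' x => match u s' x with inl y => inl (old y) | inr z => inr z end)).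
  apply: famext => s' [|s'' x] /=; first exact: knew.
  by rewrite e' /famcomp /=; case: (u s'' x).
exists D1, g, (s :: D2), (bindenv w d), (bindenv (M := famsum (var D1) (var (s :: D2)))
  (inr new) (fun s' x => match u s' x with inl y => inl y | inr z => inr (old z) end)).
apply: famext => s' [|s'' x] /=; first exact: knew.
by rewrite e' /famcomp /=; case: (u s'' x).
Qed.

Definition And V (phi psi : formula L V) := Neg (Imp phi (Neg psi)).
Definition Or V (phi psi : formula L V) := Imp (Neg phi) psi.

Lemma sat_Neg (M : structure L) V (rho : fammap V M) phi :
  sat rho (Neg phi) = ~ sat rho phi.
Proof. by []. Qed.

Lemma sat_And (M : structure L) V (rho : fammap V M) phi psi :
  sat rho (And phi psi) = (sat rho phi /\ sat rho psi).
Proof.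
rewrite /And !sat_Neg /=; apply/propext; split; last by move=> [a b] /(_ a).
by move=> H; apply: contrapT => H'; apply: H => a b; exact: H'.
Qed.

Lemma sat_Or (M : structure L) V (rho : fammap V M) phi psi :
  sat rho (Or phi psi) = (sat rho phi \/ sat rho psi).
Proof.
rewrite /Or /=; apply/propext; split; last by case.
by move=> H; have [?|?] := pselect (sat rho phi); [left|right; exact: H].
Qed.

Fixpoint AllT V (Gamma : seq S) :
    formula L (famsum V (var Gamma)) -> formula L V :=
  match Gamma with
  | [::] => fun phi => rename (famcase (@famid _ V) (fun s (v : void) => match v with end)) phi
  | s :: Delta => fun phi => All (@AllT (bind V s) Delta
      (rename (fun s' v => match v with
        | inl w => inl (old w)
        | inr u => match u in bind _ _ s' return famsum (bind V s) (var Delta) s' with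
           | new => inl new | old s' w => inr w end
        end) phi))
  end.

Lemma sat_AllT (M : structure L) V Gamma (rho : fammap V M)
    (phi : formula L (famsum V (var Gamma))) :
  sat rho (AllT phi) = forall x : tup M Gamma, sat (famcase rho x) phi.
Proof.
elim: Gamma V rho phi => [|s Delta IH] V rho phi /=.
  rewrite sat_rename; apply/propext; split=> H.
    move=> x; move: H; congr sat; by apply: famext => s' [v|[]].
  by move: (H (@novar S M)); congr sat; apply: famext => s' [v|[]].
apply/propext; split=> H.
  move=> x; have := H (x s new); rewrite IH => /(_ (fun s' v => x s' (old v))).
  rewrite sat_rename; congr sat; apply: famext => s' [v|v] //=.
  by case: v.
move=> a; rewrite IH => x; rewrite sat_rename.
by have := H (tcons a x); congr sat; apply: famext => s' [v|v] //; case: v.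
Qed.

End Syntax.

From Stdlib Require List.

(** * Definable predicates *)

Lemma finite_seq_ex T (F : set T) : finite_set F ->
  exists l : seq T, forall x, F x <-> List.In x l.
Proof.
move=> /finite_setP[n]; elim: n F => [|n IH] F.
  by rewrite II0 card_eq0 => /eqP ->; exists [::].
move=> /eq_cardSP[x Fx /IH[l lP]]; exists (x :: l) => y; split.
  move=> Fy; have [->|yx] := pselect (y = x); first by left.
  by right; apply/lP; split.
by move=> [<-//|/lP[]].
Qed.

Lemma eq_iff (P Q : Prop) : P = Q -> (P <-> Q).
Proof. by move=> ->. Qed.

Section Definable.
Variables (S : Type) (L : language S) (M : structure L).
Implicit Types (V W : S -> Type) (A B : set (elt M)) (Gamma Delta : seq S).

(** Definability with parameters in [A], where the elements of [A] are themselves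
    variables of the formula: no list of parameters has to be chosen, and the
    closure properties below let definability be read off from the shape of a
    predicate. *)
Definition dfn A V (P : set (fammap V M)) :=
  exists phi : formula L (famsum V (over A)),
  forall rho, P rho <-> sat (famcase rho (@overval _ _ A)) phi.

(** A value obtained from an assignment without applying function symbols: one of
    its coordinates, or an element of [A]. *)
Definition sube A W s (e : fammap W M -> M s) :=
  exists v : famsum W (over A) s, forall r, e r = famcase r (@overval _ _ A) v.

Definition subs A W V (g : fammap W M -> fammap V M) :=
  forall s v, sube A (fun r => g r s v).

Lemma sube_var A W s (v : W s) : sube A (fun r : fammap W M => r s v).
Proof. by exists (inl v). Qed.

Lemma sube_par A W s (a : M s) : A (Tagged M a) -> sube A (fun r : fammap W M => a).
Proof. by move=> Aa; exists (inr (exist _ a Aa)). Qed.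

Lemma subs_id A W : subs A (fun r : fammap W M => r).
Proof. by move=> s v; exact: sube_var. Qed.

Lemma subs_comp A W V U (g : fammap W M -> fammap V M) (f : fammap U V) :
  subs A g -> subs A (fun r => famcomp (g r) f).
Proof. by move=> H s v; exact: H. Qed.

Lemma subs_case A W V U (g : fammap W M -> fammap V M) (k : fammap W M -> fammap U M) :
  subs A g -> subs A k -> subs A (fun r => famcase (g r) (k r)).
Proof. by move=> H H' s [v|v]; [exact: H|exact: H']. Qed.

Lemma subs_bind A W V s (e : fammap W M -> M s) (g : fammap W M -> fammap V M) :
  sube A e -> subs A g -> subs A (fun r => bindenv (e r) (g r)).
Proof. by move=> H H' s' [|s'' v]; [exact: H|exact: H']. Qed.

Lemma subs_tcons A W Gamma s (e : fammap W M -> M s) (g : fammap W M -> tup M Gamma) :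
  sube A e -> subs A g -> subs A (fun r => tcons (e r) (g r)).
Proof. exact: subs_bind. Qed.

Lemma subs_nil A W (g : fammap W M -> tup M [::]) : subs A g.
Proof. by move=> s []. Qed.

Lemma subs_tup1 A W s (e : fammap W M -> M s) :
  sube A e -> subs A (fun r => tup1 (e r)).
Proof. by move=> H; apply: subs_bind => //; exact: subs_nil. Qed.

Lemma subs_par A W Gamma (b : tup M Gamma) : tup_elts b `<=` A ->
  subs A (fun r : fammap W M => b).
Proof. by move=> H s v; apply: sube_par; apply: H; exists v. Qed.

Lemma dfn_ext A V (P Q : set (fammap V M)) :
  (forall r, P r <-> Q r) -> dfn A P -> dfn A Q.
Proof. by move=> PQ [phi H]; exists phi => r; rewrite -PQ. Qed.

Lemma dfn_subst A V W (Q : set (fammap V M)) (g : fammap W M -> fammap V M) :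
  dfn A Q -> subs A g -> dfn A (fun r => Q (g r)).
Proof.
move=> [phi H] sg; pose f s v := sval (cid (sg s v)).
have fP s v r : g r s v = famcase r (@overval _ _ A) (f s v) by exact: (svalP (cid (sg s v)) r).
exists (rename (famcase f (fun s a => inr a)) phi) => r.
rewrite H sat_rename; suff -> : famcase (g r) (@overval _ _ A) =
  famcomp (famcase r (@overval _ _ A)) (famcase f (fun s a => inr a)) by [].
by apply: famext => s [v|a] //=; rewrite fP.
Qed.

Lemma dfn_sat A V W (phi : formula L V) (g : fammap W M -> fammap V M) :
  subs A g -> dfn A (fun r => sat (g r) phi).
Proof.
apply: (dfn_subst (Q := fun r => sat r phi)).
by exists (rename (fun s v => inl v) phi) => r; rewrite sat_rename.
Qed.

Lemma subs_trans A U V W (k : fammap V M -> fammap U M) (g : fammap W M -> fammap V M) :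
  subs A k -> subs A g -> subs A (fun r => k (g r)).
Proof.
move=> sk sg s u; have [[v|a] kE] := sk s u.
  by have [w gE] := sg s v; exists w => r; rewrite kE /= gE.
by exists (inr a) => r; rewrite kE.
Qed.

Lemma dfn_imp A V (P Q : set (fammap V M)) :
  dfn A P -> dfn A Q -> dfn A (fun r => P r -> Q r).
Proof. by move=> [phi H] [psi H']; exists (Imp phi psi) => r /=; rewrite H H'. Qed.

Lemma dfn_cst A V (C : Prop) : dfn A (fun _ : fammap V M => C).
Proof.
have [c|c] := pselect C.
  by exists (Imp Fal Fal) => r /=; split.
by exists Fal => r /=; split.
Qed.

Lemma dfn_not A V (P : set (fammap V M)) : dfn A P -> dfn A (fun r => ~ P r).
Proof. by move=> H; apply: dfn_imp => //; exact: dfn_cst. Qed.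

Lemma dfn_and A V (P Q : set (fammap V M)) :
  dfn A P -> dfn A Q -> dfn A (fun r => P r /\ Q r).
Proof.
by move=> [phi H] [psi H']; exists (And phi psi) => r; rewrite sat_And H H'.
Qed.

Lemma dfn_or A V (P Q : set (fammap V M)) :
  dfn A P -> dfn A Q -> dfn A (fun r => P r \/ Q r).
Proof.
by move=> [phi H] [psi H']; exists (Or phi psi) => r; rewrite sat_Or H H'.
Qed.

Lemma dfn_iff A V (P Q : set (fammap V M)) :
  dfn A P -> dfn A Q -> dfn A (fun r => P r <-> Q r).
Proof. by move=> H H'; apply: dfn_and; apply: dfn_imp. Qed.

Lemma dfn_allT A V Gamma (P : fammap V M -> tup M Gamma -> Prop) :
  dfn A (fun r : fammap (famsum V (var Gamma)) M =>
    P (fun s v => r s (inl v)) (fun s v => r s (inr v))) ->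
  dfn A (fun r => forall x, P r x).
Proof.
move=> [phi H].
exists (AllT (rename (fun s (v : famsum (famsum V (var Gamma)) (over A) s) => match v with
  | inl (inl w) => inl (inl w) | inl (inr x) => inr x
  | inr a => inl (inr a) end : famsum (famsum V (over A)) (var Gamma) s) phi)) => r.
rewrite sat_AllT; split=> H' x; have := H' x; rewrite sat_rename.
  have -> : P r x = P (fun s' v => famcase r x (inl v)) (fun s' v => famcase r x (inr v)) by [].
  by rewrite H; congr sat; apply: famext => s' [[]|].
move=> H''; apply: (H (famcase r x)).2.
by move: H''; congr sat; apply: famext => s' [[]|].
Qed.

Lemma dfn_exT A V Gamma (P : fammap V M -> tup M Gamma -> Prop) :
  dfn A (fun r : fammap (famsum V (var Gamma)) M =>
    P (fun s v => r s (inl v)) (fun s v => r s (inr v))) ->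
  dfn A (fun r => exists x, P r x).
Proof.
move=> H; apply: (@dfn_ext _ _ (fun r => ~ forall a, ~ P r a)).
  by move=> r; split; [move=> /existsNP[a /contrapT]; exists a|move=> [a ?] /(_ a)].
by apply: dfn_not; apply: dfn_allT; apply: dfn_not.
Qed.

Lemma dfn_eq A V s (e e' : fammap V M -> M s) :
  sube A e -> sube A e' -> dfn A (fun r => e r = e' r).
Proof.
move=> [v H] [v' H']; exists (Eq (Var L v) (Var L v')) => r /=.
by rewrite H H'.
Qed.

Lemma dfn_allvar A V Gamma (P : forall s, var Gamma s -> set (fammap V M)) :
  (forall s v, dfn A (P s v)) -> dfn A (fun r => forall s v, P s v r).
Proof.
elim: Gamma P => [|s Gamma IH] P H.
  by apply: (@dfn_ext _ _ (fun=> True)); [split=> // _ s []|exact: dfn_cst].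
apply: (@dfn_ext _ _ (fun r => P s new r /\ forall s' v, P s' (old v) r)).
  by move=> r; split=> [[H1 H2] s' [//|s'' v]|H1]; [exact: H2|split].
by apply: dfn_and => //; apply: IH.
Qed.

Lemma dfn_allvar1 A V Gamma s (P : var Gamma s -> set (fammap V M)) :
  (forall v, dfn A (P v)) -> dfn A (fun r => forall v, P v r).
Proof.
move=> H; apply: (@dfn_ext _ _ (fun r => forall s' (v : var Gamma s') (e : s' = s),
    P (eq_rect s' (var Gamma) v s e) r)).
  move=> r; split=> [H' v|H' s' v e]; last exact: H'.
  exact: (H' s v erefl).
apply: dfn_allvar => s' v; have [e|ne] := pselect (s' = s).
  subst s'; apply: (dfn_ext _ (H v)) => r; split=> [H' e|/(_ erefl)//].
  by rewrite (Prop_irrelevance e erefl).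
by apply: (dfn_ext _ (dfn_cst A V True)).
Qed.

Lemma dfn_eqT A V Gamma (e e' : fammap V M -> tup M Gamma) :
  subs A e -> subs A e' -> dfn A (fun r => e r = e' r).
Proof.
move=> H H'; apply: (@dfn_ext _ _ (fun r => forall s v, e r s v = e' r s v)).
  by move=> r; split=> [/famext//|->].
by apply: dfn_allvar => s v; exact: dfn_eq.
Qed.

Lemma dfn_mono A B V (P : set (fammap V M)) : A `<=` B -> dfn A P -> dfn B P.
Proof.
move=> AB [phi H]; exists (rename (famcase (fun s v => inl v)
  (fun s (a : over A s) => inr (exist _ (sval a) (AB _ (svalP a))))) phi) => r.
by rewrite H sat_rename; apply: eq_iff; congr sat; apply: famext => s [].
Qed.

Lemma dfn_support A V (P : set (fammap V M)) : dfn A P ->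
  exists Delta (a : tup M Delta) (phi : formula L (famsum V (var Delta))),
    tup_elts a `<=` A /\ forall rho, P rho <-> sat (famcase rho a) phi.
Proof.
move=> [phi H]; have [E [g [phi0 phiE]]] := support_formula phi.
have [D1 [k [D2 [d [u ge]]]]] := support_sum g.
exists D2, (famcomp (@overval _ _ A) d),
  (rename (famcase (fun s v => inl (k s v)) (fun s w => inr w)) (rename u phi0)); split.
  by move=> [s x] [v /= <-]; exact: svalP (d s v).
move=> r; rewrite H phiE ge !sat_rename; apply: eq_iff; congr sat.
by apply: famext => s v; rewrite /famcomp /=; case: (u s v).
Qed.

Lemma dfn_vars A V (P : set (fammap V M)) : dfn A P ->
  exists Gamma (g : fammap (var Gamma) V) (P' : set (tup M Gamma)),
    dfn A P' /\ forall r, P r <-> P' (famcomp r g).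
Proof.
move=> [phi H]; have [E [g [phi0 phiE]]] := support_formula phi.
have [D1 [k [D2 [d [u ge]]]]] := support_sum g.
pose psi : formula L (famsum (var D1) (over A)) :=
  rename (famcase (fun s v => inl v) (fun s w => inr (d s w))) (rename u phi0).
exists D1, k, (fun x => sat (famcase x (@overval _ _ A)) psi); split; first by exists psi.
move=> r; rewrite H phiE ge !sat_rename; apply: eq_iff; congr sat.
by apply: famext => s v; rewrite /famcomp /=; case: (u s v).
Qed.

Lemma dfn1_formula A s (T : set (M s)) :
  dfn A (fun r : tup M [:: s] => T (r s new)) <->
  exists phi : formula L (bind (over A) s),
    forall a, T a <-> sat (bindenv a (@overval _ _ A)) phi.
Proof.
split=> -[phi H].
  exists (rename (fun s' v => match v with
    | inl u => match u in bind _ _ s' return bind (over A) s s' with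
       | new => new | old _ w => match w : void with end end
    | inr x => old x end) phi) => a.
  rewrite (H (tup1 a)) sat_rename; apply: eq_iff; congr sat.
  by apply: famext => s' [[|? []]|].
exists (rename (fun s' v => match v in bind _ _ s' return famsum (var [:: s]) (over A) s' with
  | new => inl new | old _ w => inr w end) phi) => r.
by rewrite H sat_rename; apply: eq_iff; congr sat; apply: famext => s' [].
Qed.

Lemma definable_dfn A Gamma (X : set (tup M Gamma)) : definable A X <-> dfn A X.
Proof.
split=> [[Delta [phi [b [bA ->]]]]|/dfn_support[Delta [a [phi [aA H]]]]].
  apply: (@dfn_sat A _ _ phi (fun x => famcase x b)).
  by apply: subs_case; [exact: subs_id|exact: subs_par].
exists Delta, phi, a; split=> //; apply/seteqP.
by split=> x /H.
Qed.

Lemma dfn_split A Gamma (b : tup M Gamma) V (P : set (fammap V M)) :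
  dfn (A `|` tup_elts b) P ->
  exists2 Q : set (fammap (famsum V (var Gamma)) M), dfn A Q &
    forall r, P r <-> Q (famcase r b).
Proof.
move=> [phi H].
have H' (s : S) (a : over (A `|` tup_elts b) s) :
    exists v : famsum (famsum V (var Gamma)) (over A) s,
    forall r : fammap V M, famcase (famcase r b) (@overval _ _ A) v = sval a.
  case: a => a /= [Aa|[v e]]; first by exists (inr (exist _ a Aa)).
  by exists (inl (inr v)).
pose f s a := sval (cid (H' s a)).
have fP s a r : famcase (famcase r b) (@overval _ _ A) (f s a) = sval a.
  exact: (svalP (cid (H' s a)) r).
pose phi' := rename (famcase (fun s v => inl (inl v)) f) phi.
exists (fun r => sat (famcase r (@overval _ _ A)) phi'); first by exists phi'.
move=> r; rewrite H sat_rename; apply: eq_iff; congr sat.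
apply: famext => s [v|a] //; exact/esym/(fP s a r).
Qed.

Lemma dfn_tups A V (P : set (fammap V M)) : dfn A P ->
  exists Delta (a : tup M Delta) (Q : set (fammap (famsum V (var Delta)) M)),
  [/\ tup_elts a `<=` A, dfn set0 Q & forall r, P r <-> Q (famcase r a)].
Proof.
move=> /dfn_support[Delta [a [phi [aA H]]]].
exists Delta, a, (fun r => sat r phi); split=> //.
by apply: (@dfn_sat _ _ _ phi (fun r => r)); exact: subs_id.
Qed.

End Definable.

Lemma tup_of_seq (S : Type) (M : S -> Type) (l : seq (elt M)) :
  exists Gamma (b : tup M Gamma), forall e, tup_elts b e <-> List.In e l.
Proof.
elim: l => [|[s a] l [Gamma [b H]]].
  by exists [::], (@novar S M) => e; split=> [[[]]|].
exists (s :: Gamma), (tcons a b) => e; split.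
  case: e => s' x [/= v]; move: x.
  case: v => [|s'' w] x /= e; first by left; rewrite -e.
  by right; apply/H; exists w.
move=> [<-|/H[w /= e']]; first by exists new.
by exists (old w).
Qed.

(** * Automorphisms *)

Section Automorphisms.
Variables (S : Type) (L : language S) (M : structure L).
Implicit Types (sigma tau : fammap M M) (A B : set (elt M)).

Lemma embedding_eval (N : structure L) (h : fammap M N) (V : S -> Type)
    (rho : fammap V M) s (t : term L V s) :
  embedding h -> h s (eval rho t) = eval (famcomp h rho) t.
Proof.
move=> [_ hf _]; elim: t => //= Gamma s' g args IH; rewrite hf; congr func_in.
by apply: famext => s0 v; exact: IH.
Qed.

Lemma aut_sat sigma (V : S -> Type) (rho : fammap V M) (phi : formula L V) :
  automorphism sigma -> sat (famcomp sigma rho) phi = sat rho phi.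
Proof.
move=> [emb surj]; have [inj hf hr] := emb.
elim: phi rho => {V} [V|V s t u|V Gamma P args|V phi IH1 psi IH2|V s phi IH] rho //=.
- rewrite -!(embedding_eval _ _ emb); apply/propext; split=> [/inj//|-> //].
- apply/propext; rewrite (hr _ _ (fun s v => eval rho (args s v))); apply: eq_iff; congr rel_in.
  by apply: famext => s v; rewrite -(embedding_eval _ _ emb).
- by rewrite IH1 IH2.
- apply/propext; split=> H a.
    by rewrite -IH famcomp_bindenv; exact: H.
  by have [b <-] := surj s a; rewrite -famcomp_bindenv IH; exact: H.
Qed.

Lemma aut_id : automorphism (@famid S M).
Proof. by split; [split=> // s x y|move=> s y; exists y]. Qed.

Lemma aut_comp sigma tau : automorphism sigma -> automorphism tau ->
  automorphism (famcomp sigma tau).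
Proof.
move=> [[i f r] o] [[i' f' r'] o']; split; first split.
- by move=> s x y /i /i'.
- by move=> Gamma s g x; rewrite /famcomp f' f.
- by move=> Gamma P x; rewrite r' r.
- by move=> s y; have [x <-] := o s y; have [z <-] := o' s x; exists z.
Qed.

Lemma aut_inverse sigma : automorphism sigma -> exists tau,
  [/\ automorphism tau, famcomp tau sigma = @famid S M
    & famcomp sigma tau = @famid S M].
Proof.
move=> [[i f r] o]; pose tau s y := sval (cid (o s y)).
have tK s y : sigma s (tau s y) = y by exact: svalP (cid (o s y)).
have Kt s y : tau s (sigma s y) = y by apply: (i s); rewrite tK.
exists tau; split; try by apply: famext => s y; rewrite /famcomp ?tK ?Kt.
have famK (W : S -> Type) (x : fammap W M) : famcomp sigma (famcomp tau x) = x.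
  by apply: famext => s v; rewrite /famcomp tK.
split; last by move=> s y; exists (sigma s y).
split.
- by move=> s x y xy; rewrite -(tK s x) xy tK.
- by move=> Gamma s g x; apply: (i s); rewrite tK f famK.
- by move=> Gamma P x; rewrite (r _ _ (famcomp tau x)) famK.
Qed.

Lemma fixesE sigma s (a : M s) : fixes sigma (Tagged M a) <-> sigma s a = a.
Proof.
by split=> [e|e]; [exact: (existT_inj e)|rewrite /fixes /elt_map /= e].
Qed.

Lemma over_id A : automorphism_over A (@famid S M).
Proof. by split; [exact: aut_id|move=> [s x]]. Qed.

Lemma over_comp A sigma tau : automorphism_over A sigma ->
  automorphism_over A tau -> automorphism_over A (famcomp sigma tau).
Proof.
move=> [h f] [h' f']; split; first exact: aut_comp.
move=> [s x] Ax; have /fixesE e' := f' _ Ax; have /fixesE e := f _ Ax.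
by apply/fixesE; rewrite /famcomp e' e.
Qed.

Lemma over_inverse A sigma : automorphism_over A sigma -> exists tau,
  [/\ automorphism_over A tau, famcomp tau sigma = @famid S M
    & famcomp sigma tau = @famid S M].
Proof.
move=> [h f]; have [tau [t e e']] := aut_inverse h.
exists tau; split=> //; split=> // -[s x] Ax.
have /fixesE fx := f _ Ax; apply/fixesE.
by rewrite -{1}fx -[tau s _]/(famcomp tau sigma x) e.
Qed.

Lemma over_mono A B sigma : A `<=` B ->
  automorphism_over B sigma -> automorphism_over A sigma.
Proof. by move=> AB [h f]; split=> // e /AB; exact: f. Qed.

Lemma over_overval A sigma : automorphism_over A sigma ->
  famcomp sigma (@overval _ _ A) = @overval _ _ A.
Proof.
move=> [_ f]; apply: famext => s [a Aa]; rewrite /famcomp /=.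
by have /fixesE := f _ Aa.
Qed.

Lemma fixes_tup sigma Gamma (b : tup M Gamma) :
  (forall e, tup_elts b e -> fixes sigma e) <-> famcomp sigma b = b.
Proof.
split=> [H|H [s x] [v /= <-]]; last by apply/fixesE; rewrite -[in RHS]H.
by apply: famext => s v; apply/fixesE; apply: H; exists v.
Qed.

Lemma dfn_aut A sigma (V : S -> Type) (P : set (fammap V M)) rho :
  automorphism_over A sigma -> dfn A P -> P (famcomp sigma rho) <-> P rho.
Proof.
move=> os [phi H]; rewrite !H -{1}(over_overval os) -famcomp_case.
by rewrite aut_sat //; exact: os.1.
Qed.

Lemma dfn_image A sigma tau (V : S -> Type) (P : set (fammap V M)) :
  automorphism sigma -> automorphism tau -> famcomp sigma tau = @famid S M ->
  dfn A P -> dfn (elt_map sigma @` A) (fun r => P (famcomp tau r)).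
Proof.
move=> hs ht st [phi H].
exists (rename (famcase (fun s v => inl v) (fun s (a : over A s) =>
   inr (exist _ (sigma s (sval a)) (ex_intro2 _ _ (Tagged M (sval a)) (svalP a) erefl))))
       phi) => r.
rewrite H sat_rename -(aut_sat _ _ hs); apply: eq_iff; congr sat.
rewrite famcomp_case famcompA st; apply: famext => s [v|a] //=.
Qed.

(** For an automorphism this means that [X] is equal to its image; being stated
    pointwise, it composes without any manipulation of images. *)
Definition stab sigma (V : S -> Type) (X : set (fammap V M)) :=
  forall x, X (famcomp sigma x) <-> X x.

Lemma stab_image sigma (V : S -> Type) (X : set (fammap V M)) :
  automorphism sigma -> stab sigma X <-> famcomp sigma @` X = X.
Proof.
move=> hs; have [tau [ht ts st]] := aut_inverse hs; split=> [H|H x].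
  apply/seteqP; split=> [_ [x Xx <-]|x Xx]; first exact/H.
  exists (famcomp tau x); last by rewrite famcompA st.
  by apply/H; rewrite famcompA st.
split=> Xx; last by rewrite -H; exists x.
have famK (z : fammap V M) : famcomp tau (famcomp sigma z) = z by rewrite famcompA ts.
move: Xx; rewrite -{1}H => -[y Xy /(congr1 (famcomp tau))].
by rewrite (famK y) (famK x) => <-.
Qed.

End Automorphisms.

(** * Small sets *)

Section Small.
Variables (S : Type) (L : language S).
Let K := symbols L.

Lemma smallP T (A : set T) : A #<= [set: symbols L] <-> injects {x | A x} K.
Proof. by apply: injects_setP; exact: (inhabits (inl (inl (inl 0%N)))). Qed.

Lemma small_sub T (A B : set T) : A `<=` B ->
  B #<= [set: symbols L] -> A #<= [set: symbols L].
Proof. by move=> AB; exact/card_le_trans/subset_card_le. Qed.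

Lemma small_image T U (f : T -> U) (A : set T) :
  A #<= [set: symbols L] -> f @` A #<= [set: symbols L].
Proof. by apply: card_le_trans; exact: card_image_le. Qed.

Lemma small_range T U (f : T -> U) : injects T K -> range f #<= [set: symbols L].
Proof.
move=> tK; apply: small_image; apply/smallP; apply: injects_trans tK.
by exists sval => -[x ?] [y ?] /= xy; exact: eq_exist.
Qed.

Lemma smallU T (A B : set T) : A #<= [set: symbols L] ->
  B #<= [set: symbols L] -> A `|` B #<= [set: symbols L].
Proof.
move=> /smallP aK /smallP bK.
have sK := injects_sum (injects_nat L) aK bK.
apply: small_sub (small_range (fun x : {x | A x} + {x | B x} =>
  match x with inl a => sval a | inr b => sval b end) sK).
move=> x [Ax|Bx]; first by exists (inl (exist _ x Ax)).
by exists (inr (exist _ x Bx)).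
Qed.

Definition smallf (V : S -> Type) := injects {s : S & V s} K.

Lemma smallf_sort (V : S -> Type) :
  (forall s, injects (V s) K) <-> smallf V.
Proof.
split=> [H|vK s]; first exact: (injects_tag (injects_nat L) (injects_sort L)).
apply: injects_trans vK; exists (fun v => Tagged V v) => v w e.
exact: (existT_inj e).
Qed.

Lemma small_var (Gamma : seq S) : smallf (var Gamma).
Proof.
have [kk kki] := injects_square (injects_nat L).
have [kn kni] := injects_nat L.
apply/smallf_sort.
suff [c ci] : exists c : forall s, var Gamma s -> K, forall s, injective (c s).
  by move=> s; exists (c s).
elim: Gamma => [|s Gamma [c ci]]; first by exists (fun s (v : void) => match v with end) => s [].
by exists (bind_code kk kn c (s := s)) => s'; exact: bind_code_inj.
Qed.

Lemma small_tup (M : S -> Type) (Gamma : seq S) (b : tup M Gamma) :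
  tup_elts b #<= [set: symbols L].
Proof.
apply: small_sub (small_range (fun v : {s : S & var Gamma s} =>
  Tagged M (b _ (tagged v))) (small_var Gamma)).
by move=> [s x] [v /= <-]; exists (Tagged (var Gamma) v).
Qed.

Lemma small_In T (l : seq T) : [set x | List.In x l] #<= [set: symbols L].
Proof.
elim: l => [|x l IH]; first by apply: small_sub (card_ge0 _ _).
have sx : [set x] #<= [set: symbols L].
  apply: small_sub (small_range (fun _ : nat => x) (injects_nat L)).
  by move=> _ ->; exists 0%N.
apply: small_sub (smallU sx IH).
by move=> y [->|?]; [left|right].
Qed.

Lemma small1 T (x : T) : [set x] #<= [set: symbols L].
Proof. by apply: small_sub (small_In [:: x]) => _ ->; left. Qed.

Lemma small0 T : @set0 T #<= [set: symbols L].
Proof. exact: card_ge0. Qed.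

Lemma smallf_sum (V W : S -> Type) : smallf V -> smallf W -> smallf (famsum V W).
Proof.
move=> /smallf_sort vK /smallf_sort wK; apply/smallf_sort => s.
exact: (injects_sum (injects_nat L)).
Qed.

Lemma smallf_over (M : S -> Type) (A : set (elt M)) :
  A #<= [set: symbols L] -> smallf (over A).
Proof.
move=> /smallP aK; apply/smallf_sort => s; apply: injects_trans aK.
exists (fun a : over A s => exist _ (Tagged M (sval a)) (svalP a)) => -[a Aa] [b Ab] /= e.
by apply: eq_exist; exact: (existT_inj (congr1 sval e)).
Qed.

Lemma smallf_elts (M : S -> Type) (V : S -> Type) (x : fammap V M) : smallf V ->
  [set e | exists v : V (tag e), x _ v = tagged e] #<= [set: symbols L].
Proof.
move=> vK; apply: small_sub (small_range (fun v : {s : S & V s} =>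
  Tagged M (x _ (tagged v))) vK).
by move=> [s a] [v /= <-]; exists (Tagged V v).
Qed.

Lemma smallf_formula (V : S -> Type) : smallf V -> injects (formula L V) K.
Proof.
move=> /smallf_sort vK; apply: injects_formula => //.
- exact: injects_nat.
- exact: injects_sort.
- exact: injects_func.
- exact: injects_rel.
Qed.

End Small.

(** * Homogeneity and saturation in many variables *)

Section Saturated.
Variables (S : Type) (L : language S) (M : structure L).
Hypotheses (hsat : saturated M) (hhom : homogeneous M).
Implicit Types (V W : S -> Type) (A B : set (elt M)).

Local Notation small A := (A #<= [set: symbols L]).

Lemma homogeneous_fam V (rho rho' : fammap V M) : smallf L V ->
  (forall phi : formula L V, sat rho phi -> sat rho' phi) ->
  exists2 sigma : fammap M M, automorphism sigma & famcomp sigma rho = rho'.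
Proof.
move=> vK H.
have H' phi : sat rho phi <-> sat rho' phi.
  by split; [exact: H|apply: contraPP; exact: (H (Neg phi))].
pose A := [set e : elt M | exists v : V (tag e), rho _ v = tagged e].
have sA : small A by exact: smallf_elts.
pose f (s : S) (a : M s) : M s :=
  if pselect (exists v, rho s v = a) is left e then rho' s (sval (cid e)) else a.
have fE s v : f s (rho s v) = rho' s v.
  rewrite /f; case: pselect => [e|[]]; last by exists v.
  have := svalP (cid e); move: (sval (cid e)) => w.
  exact: (H' (Eq (Var L w) (Var L v))).1.
have [|sigma hs sE] := hhom sA (f := f).
  move=> Gamma phi x xA.
  have xE s (v : var Gamma s) : exists w : V s, rho s w = x s v.
    by have [|w] := xA (Tagged M (x s v)); [exists v|exists w].
  pose g s v := sval (cid (xE s v)).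
  have gE : x = famcomp rho g.
    by apply: famext => s v; rewrite /famcomp (svalP (cid (xE s v))).
  rewrite gE -(sat_rename g rho) H' sat_rename; apply: eq_iff; congr sat.
  by apply: famext => s v; rewrite /famcomp fE.
exists sigma => //; apply: famext => s v.
have := sE (Tagged M (rho s v)) (ex_intro _ v erefl).
by rewrite /elt_map /= fE => e; exact: (existT_inj e).
Qed.

(** The elements of [A] are added to the variables: a map that preserves all
    formulas over [A] is elementary on the points of [rho] together with [A]. *)
Lemma homogeneous_over A V (rho rho' : fammap V M) : small A -> smallf L V ->
  (forall P, dfn A P -> P rho -> P rho') ->
  exists2 sigma : fammap M M, automorphism_over A sigma & famcomp sigma rho = rho'.
Proof.
move=> sA vK H.
have [|phi|sigma hs e] := @homogeneous_fam (famsum V (over A))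
    (famcase rho (@overval _ _ A)) (famcase rho' (@overval _ _ A)).
- by apply: smallf_sum => //; exact: smallf_over.
- by apply: (H (fun r => sat (famcase r (@overval _ _ A)) phi)); exists phi.
exists sigma; last by apply: famext => s v;
  exact: (congr1 (fun x : fammap (famsum V (over A)) M => x s (inl v)) e).
split=> // -[s a] Aa; apply/fixesE.
exact: (congr1 (fun x : fammap (famsum V (over A)) M => x s (inr (exist _ a Aa))) e).
Qed.

Lemma extend_partial W Gamma (g : fammap (var Gamma) W) (J : forall s, W s -> Prop)
    (rho : fammap W M) (x : tup M Gamma) :
  (forall s (u u' : var Gamma s), g s u = g s u' -> x s u = x s u') ->
  (forall s (u : var Gamma s), J s (g s u) -> x s u = rho s (g s u)) ->
  exists rho' : fammap W M, famcomp rho' g = x /\ forall s w, J s w -> rho' s w = rho s w.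
Proof.
move=> H1 H2.
exists (fun s w => if pselect (exists u, g s u = w) is left e then x s (sval (cid e)) else
    rho s w).
split=> [|s w Jw].
  apply: famext => s u; rewrite /famcomp; case: pselect => [e|[]]; last by exists u.
  by apply: H1; exact: (svalP (cid e)).
case: pselect => // e; have ge := svalP (cid e).
by rewrite H2 ge.
Qed.

(** Saturation only realizes types in one variable.  A common point of a downward
    directed family of predicates in a small family of variables is built one
    variable at a time: Zorn's lemma applies to the partial assignments [(J, rho)]
    that leave every member of the family satisfiable. *)
Lemma compactness A W (PP : set (set (fammap W M))) : small A -> smallf L W ->
  (forall P, PP P -> dfn A P) -> PP !=set0 ->
  (forall P Q, PP P -> PP Q -> exists2 R, PP R & R `<=` P `&` Q) ->
  (forall P, PP P -> P !=set0) ->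
  exists rho, forall P, PP P -> P rho.
Proof.
move=> sA wK PPdfn [P0 PP0] PPdir PPne.
pose state := ((forall s, W s -> Prop) * fammap W M)%type.
pose ok (st : state) := forall P, PP P -> exists rho', P rho' /\ forall s w, st.1 s w ->
    rho' s w = st.2 s w.
pose le (x y : {st : state | ok st}) :=
  (forall s w, (sval x).1 s w -> (sval y).1 s w /\ (sval y).2 s w = (sval x).2 s w).
pose R x y := `[< le x y >].
have [rho0 _] := PPne _ PP0.
have ok0 : ok (fun _ _ => False, rho0).
  by move=> P /PPne[rho Pr]; exists rho.
(* Since only finitely many variables matter for one member [P] of the family, it
   is enough to find the values [x] of these variables. *)
have okE P (J : forall s, W s -> Prop) (rho : fammap W M) :
    PP P -> exists Gamma (g : fammap (var Gamma) W) (P' : set (tup M Gamma)),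
    [/\ dfn A P', forall r, P r <-> P' (famcomp r g) &
    forall x, P' x -> (forall s (u u' : var Gamma s), g s u = g s u' -> x s u = x s u') ->
     (forall s (u : var Gamma s), J s (g s u) -> x s u = rho s (g s u)) ->
     exists rho', P rho' /\ forall s w, J s w -> rho' s w = rho s w].
  move=> /PPdfn/dfn_vars[Gamma [g [P' [dP' PE]]]]; exists Gamma, g, P'; split=> // x Px H1 H2.
  have [rho' [e H]] := extend_partial H1 H2; exists rho'; split=> //.
  by rewrite PE e.
have Rxx t : R t t by apply/asboolP => s w.
have Rtrans r s t : R r s -> R s t -> R r t.
  move=> /asboolP rs /asboolP st; apply/asboolP => s' w /rs[sw e].
  by have [tw e'] := st _ _ sw; rewrite e' e.
have [C Ctot|[[J rho] okt] tmax] := ZL_preorder (exist _ _ ok0) Rxx Rtrans.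
  have [[c0 Cc0]|C0] := pselect (exists c, C c); last first.
    by exists (exist _ _ ok0) => s Cs; case: C0; exists s.
  pose J s (w : W s) := exists2 c, C c & (sval c).1 s w.
  pose rho : fammap W M := fun s w =>
    if pselect (exists c, C c /\ (sval c).1 s w) is left e then (sval (sval (cid e))).2 s w
    else rho0 s w.
  have rhoE c s w : C c -> (sval c).1 s w -> rho s w = (sval c).2 s w.
    move=> Cc cw; rewrite /rho; case: pselect => [e|[]]; last by exists c.
    have [Cd dw] := svalP (cid e); move: (sval (cid e)) Cd dw => d Cd dw.
    by have [/asboolP H|/asboolP H] := Ctot _ _ Cc Cd; have [_] := H _ _ ltac:(eassumption).
  have okJ : ok (J, rho).
    move=> P PPP; have [Gamma [g [P' [dP' PE ext]]]] := okE P J rho PPP.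
    have [c Cc cJ] : exists2 c, C c & forall s (u : var Gamma s), J s (g s u) -> (sval c).1
        s (g s u).
      move: (g); clear - Ctot Cc0; elim: Gamma => [|s Gamma IH] g.
        by exists c0 => // s [].
      have [c Cc H] := IH (fun s' v => g s' (old v)).
      have [[d Cd dg]|nJ] := pselect (J s (g s new)); last first.
        by exists c => // s' [|s'' v]; [|exact: H].
      have [/asboolP cd|/asboolP dc] := Ctot _ _ Cc Cd.
        by exists d => // s' [|s'' v] // /H /cd[].
      by exists c => // s' [|s'' v] //; [move=> _; have [] := dc _ _ dg|exact: H].
    have [rho' [Pr ag]] := svalP c P PPP.
    apply: (ext (famcomp rho' g)).
    - exact/PE.
    - by move=> s u u' e; rewrite /famcomp e.
    - by move=> s u /cJ cu; rewrite /famcomp ag // (rhoE c).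
  exists (exist _ _ okJ) => c Cc; apply/asboolP => s w cw /=; split; first by exists c.
  exact: rhoE.
have [Jfull|] := pselect (forall s w, J s w).
  exists rho => P /okt[rho' [Pr H]]; suff -> : rho = rho' by [].
  by apply: famext => s w; rewrite H.
move=> /existsNP[s /existsNP[w Jw]]; exfalso.
(* The parameters used so far, and what the family says about the value of the
   next variable [w]. *)
pose B : set (elt M) := A `|` [set e | exists v : W (tag e), rho _ v = tagged e].
have sB : small B by apply: smallU => //; exact: smallf_elts.
pose agree (rho' : fammap W M) := forall s w, J s w -> rho' s w = rho s w.
pose q : set (formula L (bind (over B) s)) := [set phi | exists2 P, PP P &
  forall rho', P rho' -> agree rho' -> sat (bindenv (rho' s w) (@overval _ _ B)) phi].
have [|a qa] := hsat sB (q := q).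
  move=> F /finite_seq_ex[l lF] Fq.
  have [P PPP HP] : exists2 P, PP P & forall phi, List.In phi l -> F phi ->
      forall rho', P rho' -> agree rho' -> sat (bindenv (rho' s w) (@overval _ _ B)) phi.
    clear lF; elim: l => [|phi l [P PPP HP]]; first by exists P0.
    have [/Fq[Q PPQ HQ]|nF] := pselect (F phi); last first.
      by exists P => // psi [<- //|]; exact: HP.
    have [R' PPR RPQ] := PPdir _ _ PPP PPQ.
    exists R' => // psi [<- _|/HP H /H H'] rho' /RPQ[? ?] ag; [exact: HQ|exact: H'].
  have [rho' [Pr ag]] := okt _ PPP.
  by exists (rho' s w) => phi Fphi; apply: HP => //; exact/lF.
pose J' s' (w' : W s') := J s' w' \/ Tagged W w' = Tagged W w.
pose cast s' (w' : W s') : Tagged W w' = Tagged W w -> M s' :=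
  fun e => eq_rect s M a s' (esym (congr1 (@tag _ _) e)).
pose rho1 : fammap W M := fun s' w' =>
  if pselect (Tagged W w' = Tagged W w) is left e then cast s' w' e else rho s' w'.
have rho1w : rho1 s w = a.
  rewrite /rho1 /cast; case: pselect => // e.
  by rewrite (Prop_irrelevance (esym _) erefl).
have rho1J s' w' : J s' w' -> rho1 s' w' = rho s' w'.
  move=> Jw'; rewrite /rho1; case: pselect => // e; case: Jw.
  by move: (congr1 (fun x : {s & W s} => J _ (tagged x)) e) => /= <-.
have ok1 : ok (J', rho1).
  move=> P PPP; have [Gamma [g [P' [dP' PE ext]]]] := okE P J' rho1 PPP.
  (* [T] is the first-order condition on the value of [w] that leaves [P]
     satisfiable; it belongs to the type [q]. *)
  pose T : set (M s) := fun b => exists x : tup M Gamma, [/\ P' x,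
    forall s' (u u' : var Gamma s'), g s' u = g s' u' -> x s' u = x s' u',
    forall s' (u : var Gamma s'), J s' (g s' u) -> x s' u = rho s' (g s' u) &
    forall u : var Gamma s, g s u = w -> x s u = b].
  have [phi phiP] : exists phi : formula L (bind (over B) s),
      forall b, T b <-> sat (bindenv b (@overval _ _ B)) phi.
    apply/dfn1_formula; apply: (@dfn_ext _ _ _ _ _ (fun r => exists x : tup M Gamma, P' x /\
      ((forall s' (u u' : var Gamma s'), g s' u = g s' u' -> x s' u = x s' u') /\
      ((forall s' (u : var Gamma s'), J s' (g s' u) -> x s' u = rho s' (g s' u)) /\
      forall u : var Gamma s, g s u = w -> x s u = r s new)))).
      by move=> r; split=> [[x [? [? [? ?]]]]|[x [? ? ? ?]]]; exists x; split.
    apply: dfn_exT; apply: dfn_and; last apply: dfn_and; last apply: dfn_and.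
    - apply: (dfn_subst (Q := P')); last by move=> s' v; exact: sube_var.
      by apply: dfn_mono dP' => e; left.
    - apply: dfn_allvar => s' u; apply: dfn_allvar1 => u'; apply: dfn_imp; first exact: dfn_cst.
      by apply: dfn_eq; exact: sube_var.
    - apply: dfn_allvar => s' u; apply: dfn_imp; first exact: dfn_cst.
      apply: dfn_eq; first exact: sube_var.
      by apply: sube_par; right; exists (g s' u).
    - apply: dfn_allvar1 => u; apply: dfn_imp; first exact: dfn_cst.
      by apply: dfn_eq; exact: sube_var.
  have [x [Px xg xJ xw]] : T a.
    apply/phiP; apply: qa; exists P => // rho' Pr ag; apply/phiP.
    exists (famcomp rho' g); split; first exact/PE.
    - by move=> s' u u' e; rewrite /famcomp e.
    - by move=> s' u /ag.
    - by move=> u <-.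
  apply: (ext x) => // s' u [Ju|e]; first by rewrite xJ // rho1J.
  have es := congr1 (@tag _ _) e; rewrite /= in es; subst s'.
  by rewrite (existT_inj e) rho1w xw // (existT_inj e).
have /asboolP : R (exist _ _ okt) (exist _ _ ok1).
  by apply/asboolP => s' w' /= J'w; split; [left|exact: rho1J].
move=> /asboolP/tmax/asboolP/(_ s w)/= [] //; by right.
Qed.
End Saturated.

(** * Orbits of groups of maps *)

Section Groups.
Variable T : Type.
Implicit Types (G : set (T -> T)) (g : T -> T).

Definition group_of_maps G := [/\ G id, forall g g', G g -> G g' -> G (g \o g')
  & forall g, G g -> exists2 g', G g' & cancel g g' /\ cancel g' g].

Definition orbit G (x : T) : set T := [set y | exists2 g, G g & g x = y].

Definition pointwise G (A : set T) := [set g | G g /\ forall x, A x -> g x = x].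

Lemma group_pointwise G A : group_of_maps G -> group_of_maps (pointwise G A).
Proof.
move=> [G1 GM GV]; split=> [|g g' [Gg gA] [Gg' gA']|g [Gg gA]].
- by split.
- by split=> [|x Ax /=]; [exact: GM|rewrite gA' ?gA].
- have [g' Gg' [gK Kg]] := GV _ Gg; exists g' => //; split=> // x Ax.
  by rewrite -{1}(gA x Ax) gK.
Qed.

Lemma orbit_pointwise G A x : orbit (pointwise G A) x `<=` orbit G x.
Proof. by move=> y [g [Gg _] <-]; exists g. Qed.

(** P. M. Neumann's separation lemma.  To move the last point [x] out of [D],
    note that each point of [D] in the orbit of [x] can be moved out of [D] by
    some element of the group; it is enough that [g] moves the other points out
    of the preimages of [D] under these finitely many elements. *)
Lemma separation G (l : seq T) (D : set T) : group_of_maps G -> finite_set D ->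
  (forall x, List.In x l -> infinite_set (orbit G x)) ->
  exists2 g, G g & forall x, List.In x l -> ~ D (g x).
Proof.
move=> GG; have [G1 GM GV] := GG; elim: l D => [|x l IH] D Dfin H.
  by exists id.
have out y : D y -> orbit G x y -> exists2 k, G k & ~ D (k y).
  move=> Dy [h Gh hx]; apply: contrapT => H'.
  apply: (H x); first by left.
  apply: sub_finite_set Dfin => _ [g Gg <-]; apply: contrapT => nD; apply: H'.
  have [h' Gh' [hK _]] := GV _ Gh.
  by exists (g \o h'); [exact: GM|rewrite -hx /= hK].
pose k (y : T) : T -> T :=
  if pselect (exists2 k, G k & ~ D (k y)) is left e then sval (cid2 e) else id.
have Gk y : G (k y).
  by rewrite /k; case: pselect => // e; case: (cid2 e).
have kD y : D y -> orbit G x y -> ~ D (k y y).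
  move=> Dy /(out _ Dy) e; rewrite /k; case: pselect => // e'.
  by case: (cid2 e').
pose D' := D `|` \bigcup_(y in D) [set z | D (k y z)].
have finD' : finite_set D'.
  rewrite /D' finite_setU; split=> //; apply: bigcup_finite => // y Dy.
  have [k' _ [kK Kk]] := GV _ (Gk y).
  apply: (@sub_finite_set _ _ (k' @` D)); last exact: finite_image.
  by move=> z Dz; exists (k y z).
have [g Gg gP] := IH _ finD' (fun y yl => H y (or_intror yl)).
have [Dgx|nDgx] := pselect (D (g x)); last first.
  by exists g => // y [<-//|/gP ngD] Dgy; apply: ngD; left.
exists (k (g x) \o g); first exact: GM.
move=> y [<-|/gP ngD] /=; first by apply: kD => //; exists g.
by move=> Dk; apply: ngD; right; exists (g x).
Qed.

(** An element [g] of the group is the product of a representative of its coset,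
    which depends only on the image of [x], and of an element of the stabilizer
    of [x]. *)
Lemma finite_orbit_stabilizer G x y : group_of_maps G -> finite_set (orbit G x) ->
  finite_set (orbit (pointwise G [set x]) y) -> finite_set (orbit G y).
Proof.
move=> GG finx finy; have [G1 GM GV] := GG.
pose k (t : T) : T -> T :=
  if pselect (exists2 g, G g & g x = t) is left e then sval (cid2 e) else id.
have kP t : orbit G x t -> G (k t) /\ k t x = t.
  by rewrite /k; case: pselect => // e _; case: (cid2 e).
apply: (@sub_finite_set _ _ (\bigcup_(t in orbit G x) (k t @` orbit (pointwise G [set x]) y))).
  move=> _ [g Gg <-]; have gx : orbit G x (g x) by exists g.
  have [Gk kx] := kP _ gx; exists (g x) => //.
  have [k' Gk' [kK Kk]] := GV _ Gk.
  exists (k' (g y)); last by rewrite Kk.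
  exists (k' \o g) => //; split; first exact: GM.
  by move=> _ -> /=; rewrite -{1}kx kK.
by apply: bigcup_finite => // t _; exact: finite_image.
Qed.

Lemma finite_orbit_pointwise G (l : seq T) y : group_of_maps G ->
  (forall x, List.In x l -> finite_set (orbit G x)) ->
  finite_set (orbit (pointwise G [set x | List.In x l]) y) -> finite_set (orbit G y).
Proof.
elim: l G => [|x l IH] G GG H.
  apply: sub_finite_set => _ [g Gg <-]; exists g => //; split=> //.
move=> fy; apply: (finite_orbit_stabilizer GG); first by apply: (H x); left.
apply: IH; first exact: group_pointwise.
  by move=> z zl; apply: sub_finite_set (H z (or_intror zl)); exact: orbit_pointwise.
apply: sub_finite_set fy => _ [g [[Gg gx] gl] <-]; exists g => //.
by split=> // z [<-|zl]; [exact: gx|exact: gl].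
Qed.

End Groups.

(** * Counting algebraic closures *)

Section AclCount.
Variables (S : Type) (L : language S) (N : structure L) (K : Type).

(** An algebraic element is determined by a formula with finitely many solutions
    and by its position among them. *)
Lemma acl_count (B : set (elt N)) : injects (symbols L) K -> injects {x | B x} K ->
  injects {e | acl B e} K.
Proof.
move=> LK BK; have nK := injects_trans (injects_nat L) LK.
have fK s : injects (formula L (bind (over B) s)) K.
  apply: injects_formula => //.
  - exact: injects_trans (injects_sort L) LK.
  - exact: injects_trans (injects_func L) LK.
  - exact: injects_trans (injects_rel L) LK.
  have [kk kki] := injects_square nK; have [kn kni] := nK.
  have cK s' : injects (over B s') K.
    apply: injects_trans BK.
    exists (fun a : over B s' => exist _ (Tagged N (sval a)) (svalP a)) => -[a Aa] [b Ab] /= e.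
    by apply: eq_exist; exact: (existT_inj (congr1 sval e)).
  pose c s' := sval (cid (cK s')).
  have ci s' : injective (c s') by exact: svalP (cid (cK s')).
  by move=> s'; exists (bind_code kk kn c (s := s) (s' := s')); exact: bind_code_inj.
pose fin s (phi : formula L (bind (over B) s)) :=
  finite_set [set a : N s | sat (bindenv a (@overval _ _ B)) phi].
have enumP s (phi : formula L (bind (over B) s)) : exists f : N s -> nat, fin s phi ->
    forall a b, sat (bindenv a (@overval _ _ B)) phi ->
                sat (bindenv b (@overval _ _ B)) phi -> f a = f b -> a = b.
  have [/finite_set_countable/countable_injP[f fi]|nf] := pselect (fin s phi).
    by exists f => _ a b pa pb; apply: fi; rewrite inE.
  by exists (fun=> 0%N) => /nf.
pose enum s phi := sval (cid (enumP s phi)).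
have H (e : {e | acl B e}) : exists phi : formula L (bind (over B) (tag (sval e))),
    fin _ phi /\ sat (bindenv (tagged (sval e)) (@overval _ _ B)) phi.
  case: e => -[s a] /= [X [/definable_dfn dX fX Xa]].
  have [phi phiP] : exists phi : formula L (bind (over B) s),
      forall b, X (tup1 b) <-> sat (bindenv b (@overval _ _ B)) phi.
    apply/(@dfn1_formula _ _ _ _ _ (fun b => X (tup1 b))).
    by apply: (dfn_subst (Q := X)) => //; apply: subs_tup1; exact: sube_var.
  exists phi; split; last exact/phiP.
  apply: (@sub_finite_set _ _ ((fun x : tup N [:: s] => x s new) @` X)).
    by move=> b /phiP Xb; exists (tup1 b).
  exact: finite_image.
pose phi e := sval (cid (H e)).
have phiP e : fin _ (phi e) /\ sat (bindenv (tagged (sval e)) (@overval _ _ B)) (phi e).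
  exact: svalP (cid (H e)).
have tK : injects {s : S & (formula L (bind (over B) s) * nat)%type} K.
  apply: injects_tag => // [|s]; first exact: injects_trans (injects_sort L) LK.
  exact: injects_pair.
apply: injects_trans tK.
exists (fun e => existT _ (tag (sval e)) (phi e, enum _ (phi e) (tagged (sval e)))).
move=> e e'; move: (phi e) (phiP e) (phi e') (phiP e').
case: e e' => -[s a] ae [[s' a'] ae'] /= p [pf pa] p' [pf' pa'] E.
have es := congr1 (@tag _ _) E; rewrite /= in es; subst s'.
have [ep en] : (p, enum s p a) = (p', enum s p' a') by exact: (existT_inj E).
subst p'; apply: eq_exist; congr existT.
exact: (svalP (cid (enumP s p)) pf).
Qed.

End AclCount.

(** * Invariance, definability and codes *)

Lemma finite_In T (l : seq T) : finite_set [set x | List.In x l].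
Proof.
elim: l => [|x l IH]; first by apply: (@sub_finite_set _ _ set0).
apply: (@sub_finite_set _ _ ([set x] `|` [set y | List.In y l])).
  by move=> y [->|?]; [left|right].
by rewrite finite_setU; split.
Qed.

Lemma finite_tup (S : Type) (M : S -> Type) (Gamma : seq S) (b : tup M Gamma) :
  finite_set (tup_elts b).
Proof.
elim: Gamma b => [|s Gamma IH] b.
  by apply: (@sub_finite_set _ _ set0) => // -[s x] [[]].
apply: (@sub_finite_set _ _ ([set Tagged M (b s new)] `|`
   tup_elts (fun s' v => b s' (old v) : M s') )).
  move=> [s' x] [/= v e]; rewrite -e {e}; case: v => [|s'' w]; [by left|right].
  by exists w.
by rewrite finite_setU; split.
Qed.

Section Invariance.
Variables (S : Type) (L : language S) (M : structure L).
Hypotheses (hsat : saturated M) (hhom : homogeneous M).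
Implicit Types (V W : S -> Type) (A B C : set (elt M)).
Local Notation small A := (A #<= [set: symbols L]).

Lemma dfn_small A V (P : set (fammap V M)) : dfn A P ->
  exists B, [/\ B `<=` A, small B, finite_set B & dfn B P].
Proof.
move=> /dfn_support[D [a [phi [aA H]]]]; exists (tup_elts a); split=> //.
- exact: small_tup.
- exact: finite_tup.
exists (rename (famcase (fun s v => inl v) (fun s v =>
  inr (exist _ (a s v) (ex_intro _ v erefl)))) phi) => r.
by rewrite H sat_rename; apply: eq_iff; congr sat; apply: famext => s [].
Qed.

(** Otherwise compactness gives a point outside [Z] with the same type over [C] as
    [x]; by homogeneity it is conjugate to [x] over [C]. *)
Lemma isolate C V (Z : set (fammap V M)) (x : fammap V M) : small C -> smallf L V ->
  dfn setT Z -> (forall sigma, automorphism_over C sigma -> Z (famcomp sigma x)) ->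
  exists Q, [/\ dfn C Q, Q x & Q `<=` Z].
Proof.
move=> sC sV dZ HZ; apply: contrapT => H.
have [B [_ sB _ dZB]] := dfn_small dZ.
pose PP : set (set (fammap V M)) :=
  [set P | exists2 Q, dfn C Q /\ Q x & P = fun y => Q y /\ ~ Z y].
have [|||P1 P2|P|y Hy] := compactness hsat (A := C `|` B) (PP := PP) _ sV.
- exact: smallU.
- move=> _ [Q [dQ _] ->]; apply: dfn_and; last apply: dfn_not.
    by apply: dfn_mono dQ => e; left.
  by apply: dfn_mono dZB => e; right.
- by exists (fun y => True /\ ~ Z y), (fun=> True); split=> //; exact: dfn_cst.
- move=> [Q1 [d1 x1] ->] [Q2 [d2 x2] ->].
  exists (fun y => (Q1 y /\ Q2 y) /\ ~ Z y); last by move=> y [[? ?] ?]; split.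
  by exists (fun y => Q1 y /\ Q2 y); split=> //; exact: dfn_and.
- move=> [Q [dQ Qx] ->]; apply: contrapT => nQ; apply: H; exists Q; split=> // y Qy.
  by apply: contrapT => nZ; apply: nQ; exists y.
have [P dP Px|sigma os sx] := homogeneous_over hhom (A := C) (rho := x) (rho' := y) sC sV.
  by have [] : P y /\ ~ Z y by apply: (Hy (fun y => P y /\ ~ Z y)); exists P.
have [_] : True /\ ~ Z y.
  by apply: (Hy (fun y => True /\ ~ Z y)); exists (fun=> True); split=> //; exact: dfn_cst.
by apply; rewrite -sx; exact: HZ.
Qed.

(** By [isolate] each point of [X] has a [C]-definable neighbourhood inside [X]; by
    compactness finitely many of them cover [X]. *)
Lemma invariant_dfn C V (X : set (fammap V M)) : small C -> smallf L V ->
  dfn setT X -> (forall sigma, automorphism_over C sigma -> stab sigma X) -> dfn C X.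
Proof.
move=> sC sV dX HX; apply: contrapT => H.
have [B [_ sB _ dXB]] := dfn_small dX.
pose PP : set (set (fammap V M)) :=
  [set P | exists2 Q, dfn C Q /\ Q `<=` X & P = fun y => X y /\ ~ Q y].
have [|||P1 P2|P|y Hy] := compactness hsat (A := C `|` B) (PP := PP) _ sV.
- exact: smallU.
- move=> _ [Q [dQ _] ->]; apply: dfn_and; last apply: dfn_not.
    by apply: dfn_mono dXB => e; right.
  by apply: dfn_mono dQ => e; left.
- by exists (fun y => X y /\ ~ False), (fun=> False); split=> //; exact: dfn_cst.
- move=> [Q1 [d1 x1] ->] [Q2 [d2 x2] ->].
  exists (fun y => X y /\ ~ (Q1 y \/ Q2 y)).
    exists (fun y => Q1 y \/ Q2 y) => //; split; first exact: dfn_or.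
    by move=> y [/x1|/x2].
  by move=> y [Xy nQ]; split; split=> // Qy; apply: nQ; [left|right].
- move=> [Q [dQ QX] ->]; apply: contrapT => nQ; apply: H.
  apply: (dfn_ext _ dQ) => y; split=> [/QX//|Xy].
  by apply: contrapT => nQy; apply: nQ; exists y.
have [Xy _] : X y /\ ~ False.
  by apply: (Hy (fun y => X y /\ ~ False)); exists (fun=> False); split=> //; exact: dfn_cst.
have [|Q [dQ Qy QX]] := @isolate C V X y sC sV dX.
  by move=> sigma /HX ->.
by have [] : X y /\ ~ Q y by apply: (Hy (fun y => X y /\ ~ Q y)); exists Q.
Qed.

(** Invariance makes [X] definable from [eta].  That [eta] is the only tuple giving
    [X] is then true among its conjugates over [C], and [theta] isolates a
    definable set where it remains true.  The set [U] restricts the tuples that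
    compete with [eta]; later it fixes the first coordinate. *)
Lemma code_formula C Xi Gamma (X : set (tup M Xi)) (eta : tup M Gamma)
    (U : set (tup M Gamma)) : small C -> dfn setT X -> dfn setT U ->
  (forall sigma, automorphism_over C sigma -> famcomp sigma eta = eta -> stab sigma X) ->
  (forall sigma, automorphism_over C sigma -> stab sigma X ->
      U (famcomp sigma eta) -> famcomp sigma eta = eta) ->
  exists (R : set (fammap (famsum (var Xi) (var Gamma)) M)) (theta : set (tup M Gamma)),
  [/\ dfn C R, dfn C theta, forall x, X x <-> R (famcase x eta), theta eta &
    forall y, U y -> theta y -> (forall x, X x <-> R (famcase x y)) -> y = eta].
Proof.
move=> sC dX dU eta_X X_eta.
have dX' : dfn (C `|` tup_elts eta) X.
  apply: invariant_dfn => //; [|exact: small_var|].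
    by apply: smallU => //; exact: small_tup.
  move=> sigma os; apply: eta_X.
    by apply: over_mono os => e; left.
  by apply/fixes_tup => e ee; apply: os.2; right.
have [R dR RX] := dfn_split dX'.
pose Z y := U y -> (forall x, X x <-> R (famcase x y)) -> y = eta.
have [|sigma os Us RU|theta [dtheta theta_eta thetaZ]] := @isolate C (var Gamma) Z eta sC
    (small_var L Gamma).
- apply: dfn_imp => //; apply: dfn_imp; last first.
    by apply: dfn_eqT; [exact: subs_id|exact: subs_par].
  apply: dfn_allT; apply: dfn_iff.
    by apply: (dfn_subst dX) => s v; exact: sube_var.
  apply: (dfn_subst (dfn_mono _ dR)) => // s [v|v]; exact: sube_var.
- apply: X_eta => // x; rewrite RU -famcomp_case RX.
  exact: dfn_aut os dR.
exists R, theta; split=> // y Uy ty; exact: thetaZ.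
Qed.

Lemma dfn0_formula V (P : set (fammap V M)) : dfn set0 P ->
  exists phi : formula L V, forall r, P r <-> sat r phi.
Proof.
move=> [phi H]; exists (rename (famcase (@famid S V)
  (fun s (a : over set0 s) => False_rect _ (svalP a))) phi) => r.
rewrite H sat_rename; apply: eq_iff; congr sat.
by apply: famext => s [v|[a []]].
Qed.

(** The formula [R] of [code_formula] becomes a code once it is conjoined with
    [theta], which makes it define the empty set for all tuples but those in
    [theta]; this is why the empty set is treated apart. *)
Lemma coded_of_stabilizer Xi Gamma (X : set (tup M Xi)) (eta : tup M Gamma) :
  dfn setT X ->
  (forall sigma, automorphism sigma -> stab sigma X <-> famcomp sigma eta = eta) ->
  coded X.
Proof.
move=> dX H; have [[x0 Xx0]|X0] := pselect (exists x, X x); last first.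
  exists [::], (@novar S M), Fal; split.
    by apply/seteqP; split=> x // Xx; case: X0; exists x.
  by move=> b' []; rewrite (tup_nil b').
have [|sigma [hs _]|sigma [hs _] st _|R [theta [dR dt RX teta uniq]]] :=
  @code_formula set0 _ _ X eta setT (small0 L _) dX.
- exact: dfn_cst.
- by move=> e; apply/(H _ hs).
- by apply/(H _ hs).
have [|phi phiP] := @dfn0_formula (famsum (var Xi) (var Gamma))
  (fun r => R r /\ theta (fun s v => r s (inr v))).
  by apply: dfn_and => //; apply: (dfn_subst dt) => s v; exact: sube_var.
have phiE x y : sat (famcase x y) phi <-> R (famcase x y) /\ theta y.
  by rewrite -phiP.
exists Gamma, eta, phi; split.
  by apply/seteqP; split=> x /=; rewrite /defset /= phiE -RX; [split|case].
move=> b' nb e; apply: nb; apply/esym.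
have Xb x : X x <-> R (famcase x b') /\ theta b'.
  rewrite -phiE -[sat _ _]/(defset phi b' x) -e /defset /= phiE -RX.
  by split=> [|[]].
have tb : theta b' by case: ((Xb x0).1 Xx0).
by apply: uniq => // x; rewrite Xb; split=> [[]|].
Qed.

End Invariance.

Lemma code_stab (S : Type) (L : language S) (N : structure L) Xi Gamma
    (X : set (tup N Xi)) (b : tup N Gamma) (sigma : fammap N N) :
  is_code X b -> automorphism sigma -> stab sigma X <-> famcomp sigma b = b.
Proof.
move=> [R [XR uniq]] hs; have [tau [ht ts st]] := aut_inverse hs.
have E x : defset R (famcomp sigma b) (famcomp sigma x) <-> defset R b x.
  by rewrite /defset /= -famcomp_case aut_sat.
split=> [H|sb x]; last by rewrite XR -{1}sb E.
apply: contrapT => nb; have /uniq : b <> famcomp sigma b by move=> e; apply: nb; rewrite -e.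
apply; apply/seteqP; split=> x.
  rewrite -XR => Xx; have -> : x = famcomp sigma (famcomp tau x) by rewrite famcompA st.
  by apply/E; rewrite -XR; apply/H; rewrite famcompA st.
have -> : x = famcomp sigma (famcomp tau x) by rewrite famcompA st.
by move=> /E; rewrite -XR => /H.
Qed.

(** * Skolem hulls *)

Lemma image_elt (S : Type) (M N : S -> Type) (h : fammap M N) (B : set (elt M)) s (y : N s) :
  (elt_map h @` B) (Tagged N y) <-> exists2 x : M s, B (Tagged M x) & h s x = y.
Proof.
split=> [[[s' x] Bx e]|[x Bx <-]]; last by exists (Tagged M x).
have es := congr1 (@tag _ _) e; rewrite /= in es; subst s'.
by exists x => //; exact: (existT_inj e).
Qed.

Section LowenheimSkolem.
Variables (S : Type) (L : language S) (M : structure L) (B0 : set (elt M)).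
Hypothesis sB0 : B0 #<= [set: symbols L].

(** The hull of [B0] is the set of values of terms over a language with one function
    symbol per formula, interpreted by a choice of witnesses; so the count of terms
    bounds its cardinality.  Sorts may be empty, and there is a symbol only for the
    inhabited ones, where a default value exists. *)
Definition skolem_language : language S := @Language S
  (fun Gamma s => {phi : formula L (bind (var Gamma) s) | exists a : M s, True})
  (fun _ => void).

Definition skolem_structure : structure skolem_language := @Structure S skolem_language M
  (fun Gamma s phi x =>
     if pselect (exists a, sat (bindenv a x) (sval phi)) is left e then sval (cid e)
     else sval (cid (svalP phi)))
  (fun _ (P : void) _ => match P with end).

Definition in_hull s (a : M s) := exists t : term skolem_language (over B0) s,
  eval (M := skolem_structure) (@overval _ _ B0) t = a.

Lemma hull_witness Gamma s (phi : formula L (bind (var Gamma) s)) (x : tup M Gamma) :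
  (forall s' v, in_hull (x s' v)) -> (exists a, sat (bindenv a x) phi) ->
  exists2 a, in_hull a & sat (bindenv a x) phi.
Proof.
move=> Hx ex; pose t s' v := sval (cid (Hx s' v)).
have tP s' v : eval (M := skolem_structure) (@overval _ _ B0) (t s' v) = x s' v.
  exact: svalP (cid (Hx s' v)).
have inh : exists a : M s, True by case: ex => a _; exists a.
pose f : func skolem_language Gamma s := exist _ phi inh.
exists (@func_in _ _ skolem_structure _ _ f x).
  exists (App f t) => /=; suff -> : x = (fun s' v =>
    eval (M := skolem_structure) (@overval _ _ B0) (t s' v)) by [].
  by apply: famext => s' v; rewrite tP.
by rewrite /=; case: pselect => // e; exact: svalP (cid e).
Qed.

Lemma hull_func Gamma s (f : func L Gamma s) (x : tup M Gamma) :
  (forall s' v, in_hull (x s' v)) -> in_hull (func_in f x).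
Proof.
move=> Hx.
have [|a Ha e] := @hull_witness Gamma s
  (Eq (Var L new) (App f (fun s' v => Var L (old v)))) x Hx.
  by exists (func_in f x).
by move: e => /= e; rewrite -/(func_in f _) -e.
Qed.

Definition hull : structure L := @Structure S L (fun s => {a : M s | in_hull a})
  (fun Gamma s f x => exist _ (func_in f (fun s' v => sval (x s' v)))
     (hull_func f (fun s' v => svalP (x s' v))))
  (fun Gamma P x => rel_in P (fun s' v => sval (x s' v))).

Definition hull_incl : fammap hull M := fun s a => sval a.

Lemma hull_embedding : embedding hull_incl.
Proof. by split=> // s [a Ha] [b Hb] /= ab; exact: eq_exist. Qed.

Lemma hull_sat V (rho : fammap V hull) (phi : formula L V) :
  sat rho phi <-> sat (famcomp hull_incl rho) phi.
Proof.
have [inj hf hr] := hull_embedding.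
elim: phi rho => {V} [V|V s t u|V Gamma P args|V phi IH1 psi IH2|V s phi IH] rho //=.
- by rewrite -!(embedding_eval _ _ hull_embedding); split=> [->//|]; exact: inj.
- apply: eq_iff; congr rel_in.
  by apply: famext => s v; rewrite -(embedding_eval _ _ hull_embedding).
- by rewrite IH1 IH2.
- split=> H a; last first.
    by apply/IH; rewrite famcomp_bindenv; exact: H.
  have [Gamma [g [phi0 phiE]]] := support_formula_bind phi.
  pose x := famcomp hull_incl (famcomp rho g).
  apply: contrapT => nsat.
  have [||b Hb nb] := @hull_witness Gamma s (Neg phi0) x.
  + by move=> s' v; exact: svalP (rho s' (g s' v)).
  + exists a; rewrite sat_Neg => sat0; apply: nsat.
    by rewrite phiE sat_rename bindenv_bindmap.
  apply: nb; have /IH := H (exist _ b Hb).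
  by rewrite famcomp_bindenv phiE sat_rename bindenv_bindmap.
Qed.

Lemma hull_base e : B0 e -> range (elt_map hull_incl) e.
Proof.
case: e => s a Ba.
have Ha : in_hull a by exists (Var skolem_language (exist _ a Ba : over B0 s)).
by exists (Tagged hull (exist _ a Ha : hull s)).
Qed.

Lemma hull_small : range (elt_map hull_incl) #<= [set: symbols L].
Proof.
have nK := injects_nat L.
have fK : injects {Gamma : seq S & {s : S & func skolem_language Gamma s}} (symbols L).
  apply: injects_tag => //; first exact: injects_seq (injects_sort L).
  move=> Gamma; apply: injects_tag => //; first exact: injects_sort.
  move=> s; apply: (@injects_trans _ (formula L (var (s :: Gamma)))).
    by exists sval => -[p ?] [q ?] /= pq; exact: eq_exist.
  by apply: smallf_formula; exact: small_var.
have tK : injects {s : S & term skolem_language (over B0) s} (symbols L).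
  apply: injects_tag => //; first exact: injects_sort.
  move=> s; apply: injects_term => //; apply/smallf_sort; exact: smallf_over.
apply: small_sub (small_range (fun t : {s : S & term skolem_language (over B0) s} =>
  Tagged M (eval (M := skolem_structure) (@overval _ _ B0) (tagged t))) tK).
by move=> _ [[s [a [t ta]]] _ <-]; exists (Tagged (term skolem_language (over B0)) t);
    rewrite //= ta.
Qed.

Lemma lowenheim_skolem : exists (M' : structure L) (j : fammap M' M),
  [/\ elementary_embedding j, B0 `<=` range (elt_map j)
    & range (elt_map j) #<= [set: symbols L]].
Proof.
exists hull, hull_incl; split; [|exact: hull_base|exact: hull_small].
by move=> Gamma phi x _; exact: hull_sat.
Qed.

End LowenheimSkolem.

(** * From the small language to the large one *)

Section Reduct.
Variables (S : Type) (Lt L : language S) (i : sublanguage Lt L).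

Fixpoint tlift V s (t : term Lt V s) : term L V s :=
  match t with
  | Var _ v => Var L v
  | App _ _ f args => App (sub_func i f) (fun s' v => tlift (args s' v))
  end.

Fixpoint lift V (phi : formula Lt V) : formula L V :=
  match phi with
  | Fal => Fal
  | Eq _ t u => Eq (tlift t) (tlift u)
  | Rel _ P args => Rel (sub_rel i P) (fun s v => tlift (args s v))
  | Imp phi1 phi2 => Imp (lift phi1) (lift phi2)
  | All s phi1 => All (lift phi1)
  end.

Lemma injects_symbols : injects (symbols Lt) (symbols L).
Proof.
exists (fun x : symbols Lt => match x with
  | inl (inl y) => inl (inl y)
  | inl (inr (existT Gamma (existT s f))) => inl (inr (existT _ Gamma (existT _ s (sub_func
      i f))))
  | inr (existT Gamma P) => inr (existT _ Gamma (sub_rel i P))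
  end : symbols L).
move=> [[x|[G [s f]]]|[G P]] [[y|[G' [s' f']]]|[G' P']] //; first by move=> [->].
  move=> /(congr1 (fun x : symbols L => if x is inl (inr y) then y
    else existT _ G (existT _ s (sub_func i f)))) /= e.
  have eG := congr1 (@tag _ _) e; rewrite /= in eG; subst G'.
  have {}e := existT_inj e.
  have es := congr1 (@tag _ _) e; rewrite /= in es; subst s'.
  by rewrite (sub_func_inj (existT_inj e)).
move=> /(congr1 (fun x : symbols L => if x is inr y then y
  else existT _ G (sub_rel i P))) /= e.
have eG := congr1 (@tag _ _) e; rewrite /= in eG; subst G'.
by rewrite (sub_rel_inj (existT_inj e)).
Qed.

Variable M : structure L.

Lemma eval_tlift V (rho : fammap V M) s (t : term Lt V s) :
  eval (M := M) rho (tlift t) = eval (M := reduct i M) rho t.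
Proof.
elim: t => //= Gamma s' g args IH; congr func_in.
by apply: famext => s0 v; exact: IH.
Qed.

Lemma sat_lift V (rho : fammap V M) (phi : formula Lt V) :
  sat (M := M) rho (lift phi) = sat (M := reduct i M) rho phi.
Proof.
elim: phi rho => {V} [V|V s t u|V Gamma P args|V phi IH1 psi IH2|V s phi IH] rho //=.
- by rewrite !eval_tlift.
- by congr rel_in; apply: famext => s v; rewrite eval_tlift.
- by rewrite IH1 IH2.
- by apply/propext; split=> H a; have := H a; rewrite IH.
Qed.

Lemma embedding_qf (M0 N : structure Lt) (h : fammap M0 N) V (rho : fammap V M0)
    (phi : formula Lt V) : embedding h -> quantifier_free phi ->
  sat (famcomp h rho) phi = sat rho phi.
Proof.
move=> emb; have [inj hf hr] := emb.
elim: phi rho => {V} [V|V s t u|V Gamma P args|V phi IH1 psi IH2|V s phi IH] rho //=.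
- by move=> _; rewrite -!(embedding_eval _ _ emb); apply/propext; split=> [/inj//|-> //].
- move=> _; apply/propext; rewrite (hr _ _ (fun s v => eval rho (args s v))).
  apply: eq_iff; congr rel_in.
  by apply: famext => s v; rewrite -(embedding_eval _ _ emb).
- by move=> /andP[q1 q2]; rewrite IH1 ?IH2.
Qed.

Variables (Tt : set (sentence Lt)) (hQE : eliminates_quantifiers Tt).
Variables (Mt : structure Lt) (hMt : models Mt Tt).
Variables (h : fammap M Mt) (hh : embedding (M := reduct i M) h).

(** A quantifier-free formula has the same meaning in [Mt] and in its substructure
    given by [M]. *)
Lemma dfn_reduct (B : set (elt M)) V (U : set (fammap V Mt)) :
  dfn (elt_map h @` B) U -> dfn B (fun rho : fammap V M => U (famcomp h rho)).
Proof.
move=> /dfn_support[Delta [a [phi [aB UE]]]].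
have [E [k [phi0 phiE]]] := support_formula phi.
have [psi qpsi psiE] := hQE phi0.
have H s (v : var Delta s) : exists2 x : M s, B (Tagged M x) & @h s x = a s v.
  by apply/image_elt; apply: aB; exists v.
pose a' s v := sval (cid2 (H s v)).
have a'B s v : B (Tagged M (a' s v)) by rewrite /a'; case: (cid2 _).
have a'E : a = famcomp h a' by apply: famext => s v; rewrite /famcomp /a'; case: (cid2 _).
apply: (@dfn_ext _ _ _ _ _ (fun r : fammap V M => sat (famcomp (famcase r a') k) (lift psi))).
  move=> r; rewrite UE phiE sat_rename (psiE _ hMt) sat_lift -(embedding_qf _ hh qpsi).
  by apply: eq_iff; congr sat; rewrite a'E famcompA famcomp_case.
apply: dfn_sat; apply: subs_comp; apply: subs_case; first exact: subs_id.
by move=> s v; exact: sube_par.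
Qed.

End Reduct.

(** * Bounded cardinality as a first-order condition *)

Section LeCard.
Variable T : Type.
Implicit Types Q R : set T.

(** The recursion removes an arbitrary element of [Q], so that the condition is
    first-order as soon as [Q] is. *)
Fixpoint le_card n Q := if n is n'.+1
  then forall y, Q y -> le_card n' (fun z => Q z /\ z <> y)
  else forall y, ~ Q y.

Lemma le_card_sub n Q R : R `<=` Q -> le_card n Q -> le_card n R.
Proof.
elim: n Q R => [|n IH] Q R RQ H y; first by move=> /RQ; exact: H.
by move=> Ry; apply: IH (H y (RQ _ Ry)) => z [Rz zy]; split=> //; exact: RQ.
Qed.

Lemma le_card_leq m n Q : (m <= n)%N -> le_card m Q -> le_card n Q.
Proof.
elim: m n Q => [|m IH] [|n] Q //= mn H y Qy; first by case: (H y).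
by apply: IH (H y Qy).
Qed.

Lemma le_card_proper n Q R : R `<=` Q -> ~ (Q `<=` R) -> le_card n Q ->
  exists2 m, (m < n)%N & le_card m R.
Proof.
move=> RQ nQR; have [y [Qy nRy]] : exists y, Q y /\ ~ R y.
  by apply: contrapT => H; apply: nQR => y Qy; apply: contrapT => nR; apply: H; exists y.
case: n => [|n] H; first by case: (H y).
exists n => //; apply: le_card_sub (H y Qy) => z Rz; split; first exact: RQ.
by move=> e; apply: nRy; rewrite -e.
Qed.

Lemma le_cardU m n Q R : le_card m Q -> le_card n R -> le_card (m + n) (Q `|` R).
Proof.
elim: m n Q R => [|m IH].
  by move=> n Q R Q0; apply: le_card_sub => y [/Q0|].
elim=> [|n IH'] Q R Qm Rn.
  by rewrite addn0; apply: le_card_sub Qm => y [//|/Rn].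
move=> y; rewrite addnS -/(le_card _ _) => Qy.
have [Qy'|nQ] := pselect (Q y).
  rewrite -addnS.
  apply: (@le_card_sub _ ((fun z => Q z /\ z <> y) `|` R)); last by apply: IH => //; exact: Qm.
  by move=> z [[Qz|Rz] zy]; [left|right].
have Ry : R y by case: Qy.
apply: (@le_card_sub _ (Q `|` (fun z => R z /\ z <> y))); last first.
  rewrite -addSn; apply: IH' => //; exact: Rn.
by move=> z [[Qz|Rz] zy]; [left|right].
Qed.

Lemma finite_le_card Q : finite_set Q <-> exists n, le_card n Q.
Proof.
split=> [/finite_seq_ex[l lQ']|[n]]; last first.
  elim: n Q => [|n IH] Q H.
    by apply: (@sub_finite_set _ _ set0) => // y /H.
  have [[y Qy]|nQ] := pselect (exists y, Q y); last first.
    by apply: (@sub_finite_set _ _ set0) => // y Qy; apply: nQ; exists y.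
  apply: (@sub_finite_set _ _ ([set y] `|` (fun z => Q z /\ z <> y))).
    by move=> z Qz; have [->|ne] := pselect (z = y); [left|right].
  by rewrite finite_setU; split=> //; apply: IH; exact: H.
have lQ x : Q x -> List.In x l by move=> /lQ'.
exists (size l); clear lQ'.
move: {-1}(size l) (leqnn (size l)) => n; elim: n l Q lQ => [|n IH] l Q lQ.
  by rewrite leqn0 => /nilP e; subst l.
move=> ln y Qy; have [l1 [l2 e]] := List.in_split _ _ (lQ _ Qy); subst l.
apply: (IH (l1 ++ l2)) => [z [Qz zy]|].
  by have [e|//] := List.in_elt_inv _ _ _ _ (lQ _ Qz); case: zy.
by move: ln; rewrite !size_cat /= addnS.
Qed.

Lemma le_card_distinct n Q (f : nat -> T) : le_card n Q ->
  (forall k, (k <= n)%N -> Q (f k)) ->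
  exists j k, [/\ (j < k)%N, (k <= n)%N & f j = f k].
Proof.
elim: n Q f => [|n IH] Q f Qn fQ; first by case: (Qn _ (fQ 0%N isT)).
apply: contrapT => H.
have [k kn|j [k [jk kn e]]] := IH _ f (Qn _ (fQ n.+1 (leqnn _))).
  split; first by apply: fQ; exact: leqW.
  by move=> e; apply: H; exists k, n.+1.
by apply: H; exists j, k; split=> //; exact: leqW.
Qed.

Lemma not_le_card n Q : ~ le_card n Q ->
  exists f : nat -> T, (forall k, (k <= n)%N -> Q (f k)) /\
    forall j k, (j < k)%N -> (k <= n)%N -> f j <> f k.
Proof.
elim: n Q => [|n IH] Q /=.
  move=> /existsNP[y /contrapT Qy]; exists (fun=> y); split=> // j k jk.
  by rewrite leqn0 => /eqP k0; rewrite k0 in jk.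
move=> /existsNP[y /not_implyP[Qy /IH[f [fQ finj]]]].
exists (fun k => if (k <= n)%N then f k else y); split=> [k _|j k jk kn].
  by case: ifP => // /fQ[].
have jn : (j <= n)%N by rewrite -ltnS; exact: leq_trans kn.
rewrite jn; case: ifP => [kn'|_]; first exact: finj.
by have [] := fQ _ jn.
Qed.

End LeCard.

Lemma finite_product (S : Type) (N : S -> Type) (Gamma : seq S)
    (X : forall s, var Gamma s -> set (N s)) :
  (forall s v, finite_set (X s v)) ->
  finite_set [set y : tup N Gamma | forall s v, X s v (y s v)].
Proof.
elim: Gamma X => [|s Gamma IH] X fX.
  apply: (@sub_finite_set _ _ [set @novar S N]) => // y _; exact: tup_nil.
have f1 := IH (fun s' v => X s' (old v)) (fun s' v => fX s' (old v)).
apply: (@sub_finite_set _ _ ((fun p : N s * tup N Gamma => tcons p.1 p.2) @`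
   (X s new `*` [set y : tup N Gamma | forall s' v, X s' (old v) (y s' v)]))).
  move=> y Xy; exists (y s new, (fun s' v => y s' (old v))); last by rewrite -tup_eta.
  by split=> [|s' v]; exact: Xy.
by apply: finite_image; apply: finite_setX.
Qed.

(** * The real algebraic closure of an imaginary *)

Lemma finite_fiber (S : Type) (M : S -> Type) (F : set (elt M)) s :
  finite_set F -> finite_set [set a : M s | F (Tagged M a)].
Proof.
move=> fF; have [[a0 _]|nM] := pselect (exists a : M s, True); last first.
  by apply: (@sub_finite_set _ _ set0) => // a _; apply: nM; exists a.
pose g (e : elt M) : M s :=
  if pselect (tag e = s) is left p then eq_rect _ M (tagged e) _ p else a0.
apply: (@sub_finite_set _ _ (g @` F)); last exact: finite_image.
move=> a Fa; exists (Tagged M a) => //; rewrite /g; case: pselect => // p.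
by rewrite (Prop_irrelevance p erefl).
Qed.

Lemma finite_dfn (S : Type) (L : language S) (M : structure L) (B : set (elt M)) Gamma
    (Z : set (tup M Gamma)) :
  finite_set Z -> (forall t, Z t -> tup_elts t `<=` B) -> dfn B Z.
Proof.
move=> /finite_seq_ex[l lZ] ZB.
apply: (@dfn_ext _ _ _ _ _ (fun t => List.In t l)); first by move=> t; rewrite lZ.
have {ZB} : forall t, List.In t l -> tup_elts t `<=` B by move=> t /lZ; exact: ZB.
elim: l {lZ} => [|x l IH] H; first exact: dfn_cst.
apply: dfn_or; last by apply: IH => t tl; apply: H; right.
apply: dfn_eqT; last exact: subs_id.
by apply: subs_par; apply: H; left.
Qed.

(** A finite orbit over [B] is definable, and it is invariant over [B]. *)
Lemma acl_of_finite_orbit (S : Type) (L : language S) (M : structure L)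
    (hsat : saturated M) (hhom : homogeneous M) (B : set (elt M)) s (a : M s) :
  B #<= [set: symbols L] ->
  finite_set [set b : M s | exists2 sigma, automorphism_over B sigma & sigma s a = b] ->
  acl B (Tagged M a).
Proof.
move=> sB fa.
pose O := [set t : tup M [:: s] | exists2 sigma, automorphism_over B sigma &
  sigma s a = t s new].
have fO : finite_set O.
  apply: (@sub_finite_set _ _ ((@tup1 _ M s) @`
    [set b : M s | exists2 sigma, automorphism_over B sigma & sigma s a = b])).
    move=> t [sigma os e]; exists (t s new); first by exists sigma.
    by rewrite [in RHS](tup_eta t); congr tcons; apply: famext => s' [].
  exact: finite_image.
exists O; split=> //; last by exists (@famid S M) => //; exact: over_id.
apply/definable_dfn; apply: (invariant_dfn hsat hhom) => //; first exact: small_var.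
  exact: finite_dfn.
move=> sigma os t; split=> -[tau ot e].
  have [sigma' [os' s's ss']] := over_inverse os.
  exists (famcomp sigma' tau); first exact: over_comp.
  rewrite /famcomp e -[sigma' s _]/(@famcomp _ _ _ _ (famcomp sigma' sigma) t s new).
  by rewrite s's.
by exists (famcomp sigma tau); [exact: over_comp|rewrite /famcomp e].
Qed.

Section Stabilizer.
Variables (S : Type) (L : language S) (M : structure L).
Hypotheses (hsat : saturated M) (hhom : homogeneous M).
Local Notation small A := (A #<= [set: symbols L]).
Variables (A0 : set (elt M)) (Xi : seq S) (X : set (tup M Xi)).
Hypotheses (sA0 : small A0) (dX : dfn setT X).

Definition stabilizer : set (elt M -> elt M) :=
  [set g | exists2 sigma, automorphism_over A0 sigma /\ stab sigma X & g = elt_map sigma].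

(** The elements of [M] that are algebraic over [A0] and the imaginary element
    represented by [X].  Finite orbits describe them without a structure of
    imaginaries. *)
Definition real_acl : set (elt M) := [set e | finite_set (orbit stabilizer e)].

Lemma elt_map_cancel (sigma tau : fammap M M) :
  famcomp tau sigma = @famid S M -> cancel (elt_map sigma) (elt_map tau).
Proof.
move=> e [s x]; rewrite /elt_map /=.
by rewrite -[tau s _]/(famcomp tau sigma x) e.
Qed.

Lemma group_stabilizer : group_of_maps stabilizer.
Proof.
split.
- exists (@famid S M); first by split; [exact: over_id|].
  by apply: functional_extensionality_dep => -[s x].
- move=> _ _ [sigma [os ss] ->] [tau [ot st] ->]; exists (famcomp sigma tau) => //.
  split; first exact: over_comp.
  by move=> x; rewrite -famcompA ss st.
- move=> _ [sigma [os ss] ->]; have [tau [ot ts st]] := over_inverse os.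
  exists (elt_map tau); last by split; exact: elt_map_cancel.
  exists tau => //; split=> // x.
  by rewrite -ss famcompA st.
Qed.

Lemma real_acl_base : A0 `<=` real_acl.
Proof.
move=> e Ae; apply: (@sub_finite_set _ _ [set e]) => //.
by move=> _ [_ [sigma [[_ os] _] ->] <-]; exact: os.
Qed.

Lemma real_acl_small : small real_acl.
Proof.
have [B [_ sB _ dB]] := dfn_small dX.
have sAB : small (A0 `|` B) by exact: smallU.
apply/smallP; apply: injects_trans (acl_count (injects_refl _) ((smallP L _).1 sAB)).
apply: injects_sig => -[s a] fa; apply: acl_of_finite_orbit => //.
apply: (@sub_finite_set _ _ [set b : M s | orbit stabilizer (Tagged M a) (Tagged M b)]).
  move=> b [sigma os e]; exists (elt_map sigma); last by rewrite /elt_map /= e.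
  exists sigma => //; split; first by apply: over_mono os => x; left.
  by move=> x; apply: dfn_aut dB; apply: over_mono os => y; right.
exact: finite_fiber.
Qed.

Lemma real_acl_closed : real_acl = acl real_acl.
Proof.
apply/seteqP; split=> [[s a] Aa|[s a] [Z [/definable_dfn dZ fZ Za]]].
  exists [set tup1 a]; split=> //.
  apply/definable_dfn; apply: dfn_eqT; first exact: subs_id.
  by apply: subs_tup1; exact: sube_par.
have [B [BA _ fB dB]] := dfn_small dZ.
have [l lB] := finite_seq_ex fB.
apply: (@finite_orbit_pointwise _ stabilizer l); first exact: group_stabilizer.
  by move=> x /lB/BA.
apply: (@sub_finite_set _ _ ((fun t : tup M [:: s] => Tagged M (t s new)) @` Z)).
  move=> _ [_ [[sigma [os ss] ->] fl] <-]; exists (famcomp sigma (tup1 a)) => //.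
  suff ob : automorphism_over B sigma by apply/(dfn_aut _ ob dB).
  by split=> [|e Be]; [exact: os.1|apply: fl; apply/lB].
exact: finite_image.
Qed.

(** By [separation], finitely many points with infinite orbits can be moved at once
    while fixing finitely many points with finite orbits; compactness and
    homogeneity extend this to small sets.  The variables of the compactness
    argument are the images of the points of [H] and of parameters [b] that define
    [X]. *)
Lemma move_outside (H : set (elt M)) : small H -> (forall e, H e -> ~ real_acl e) ->
  exists sigma, [/\ automorphism_over real_acl sigma, stab sigma X
    & forall e, H e -> ~ fixes sigma e].
Proof.
move=> sH HA; have [D [b [Q [_ dQ XQ]]]] := dfn_tups dX.
pose W := famsum (var D) (over H).
pose rho0 : fammap W M := famcase b (@overval _ _ H).
pose good (r : fammap W M) := forall x, X x <-> Q (famcase x (fun s v => r s (inl v))).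
pose moved (l : seq {s & over H s}) (r : fammap W M) :=
  forall w, List.In w l -> r _ (inr (tagged w)) <> sval (tagged w).
pose PP : set (set (fammap W M)) := [set P | exists P0 l,
  [/\ dfn real_acl P0, P0 rho0 & P = fun r => P0 r /\ (good r /\ moved l r)]].
have sW : smallf L W by apply: smallf_sum; [exact: small_var|exact: smallf_over].
have dgood B : tup_elts b `<=` B -> dfn B good.
  move=> bB; apply: dfn_allT; apply: dfn_iff.
    apply: (dfn_ext (P := fun r : fammap (famsum W (var Xi)) M => Q (famcase (fun s v => r
        s (inr v)) b))).
      by move=> r; rewrite XQ.
    apply: (dfn_subst (dfn_mono _ dQ)) => // s [v|v]; first exact: sube_var.
    by apply: sube_par; apply: bB; exists v.
  by apply: (dfn_subst (dfn_mono _ dQ)) => // s [v|v]; exact: sube_var.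
have dmoved B l : H `<=` B -> dfn B (moved l).
  move=> HB; elim: l => [|w l IH].
    by apply: (dfn_ext _ (dfn_cst _ _ True)) => r; split=> // _ w [].
  apply: (dfn_ext (P := fun r : fammap W M => r _ (inr (tagged w)) <> sval (tagged w) /\
      moved l r)).
    move=> r; split=> [[rw rl] w' [<-//|]|rl]; first exact: rl.
    by split=> [|w' w'l]; apply: rl; [left|right].
  apply: dfn_and => //; apply: dfn_not; apply: dfn_eq; first exact: sube_var.
  by apply: sube_par; apply: HB; exact: svalP (tagged w).
have [|||P1 P2|P|r Hr] := compactness hsat (A := real_acl `|` (tup_elts b `|` H)) (PP := PP) _ sW.
- apply: smallU; first exact: real_acl_small.
  by apply: smallU => //; exact: small_tup.
- move=> _ [P0 [l [dP _ ->]]]; apply: dfn_and; first by apply: dfn_mono dP => e; left.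
  by apply: dfn_and; [apply: dgood|apply: dmoved] => e; right; [left|right].
- by exists (fun r => True /\ (good r /\ moved [::] r)), (fun=> True), [::]; split=> //;
    exact: dfn_cst.
- move=> [P0 [l [dP P0r ->]]] [P0' [l' [dP' P0r' ->]]].
  exists (fun r => (P0 r /\ P0' r) /\ (good r /\ moved (l ++ l') r)).
    by exists (fun r => P0 r /\ P0' r), (l ++ l'); split=> //; exact: dfn_and.
  move=> r [[? ?] [? m]]; split; split=> //; split=> // w wl; apply: m; apply/List.in_or_app;
    by [left|right].
- move=> [P0 [l [dP P0r ->]]]; have [B [BA _ fB dB]] := dfn_small dP.
  have [lB lBE] := finite_seq_ex fB.
  pose hs := [seq Tagged M (sval (tagged w)) | w <- l].
  have hsP e : List.In e hs -> H e.
    rewrite /hs; elim: (l) => //= w l' IH [<-|//]; exact: svalP (tagged w).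
  have inhs w : List.In w l -> List.In (Tagged M (sval (tagged w))) hs.
    by rewrite /hs; elim: (l) => //= w' l1 IH [->|/IH]; [left|right].
  have [|||g [[sigma [os ss] gE] gB] gm] := @separation _
      (pointwise stabilizer [set x | List.In x lB]) hs [set x | List.In x hs].
  + by apply: group_pointwise; exact: group_stabilizer.
  + exact: finite_In.
  + move=> e /hsP He fe; apply: (HA _ He).
    apply: finite_orbit_pointwise fe; first exact: group_stabilizer.
    by move=> x /lBE/BA.
  exists (famcomp sigma rho0); split; last split.
  + apply/(dfn_aut (A := B)) => //; split; first exact: os.1.
    by move=> e Be; have := gB e; rewrite gE; apply; apply/lBE.
  + move=> x; have [tau [ot ts st]] := over_inverse os.
    have -> : x = famcomp sigma (famcomp tau x) by rewrite famcompA st.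
    rewrite ss XQ -[fun s v => _]/(famcomp sigma b) -famcomp_case.
    by rewrite (dfn_aut (A := set0)) //; apply: over_mono os.
  + move=> w wl e; apply: (gm (Tagged M (sval (tagged w)))).
      exact: inhs.
    rewrite gE; have /fixesE -> : sigma _ (sval (tagged w)) = sval (tagged w) by exact: e.
    exact: inhs.
have [P0 dP P0r|sigma os sE] := homogeneous_over hhom (rho := rho0) (rho' := r) real_acl_small sW.
  have [] // : P0 r /\ (good r /\ moved [::] r).
  by apply: (Hr (fun r => P0 r /\ (good r /\ moved [::] r))); exists P0, [::]; split.
have rH l : good r /\ moved l r.
  have [] // : True /\ (good r /\ moved l r).
  apply: (Hr (fun r => True /\ (good r /\ moved l r))); exists (fun=> True), l.
  by split=> //; exact: dfn_cst.
exists sigma; split=> //.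
  move=> x; rewrite ((rH [::]).1 (famcomp sigma x)) -sE.
  rewrite -[fun s v => _]/(famcomp sigma b) -famcomp_case XQ.
  by rewrite (dfn_aut (A := set0)) //; apply: over_mono os.
move=> [s a] Ha /fixesE sa.
have [_ /(_ (Tagged (over H) (exist _ a Ha : over H s)))] := rH [:: Tagged (over H) (exist
    _ a Ha : over H s)].
by move=> /(_ (or_introl erefl)); apply; rewrite -sE.
Qed.

(** The automorphisms that fix [X] and [real_acl] cannot move the code of [Y], so by
    [move_outside] the code consists of elements of [real_acl]. *)
Lemma coded_dfn_real_acl Gamma (Y : set (tup M Gamma)) : coded Y ->
  (forall sigma, automorphism_over real_acl sigma -> stab sigma X -> stab sigma Y) ->
  dfn real_acl Y.
Proof.
move=> [Delta [d dY]] HY.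
suff dA : tup_elts d `<=` real_acl.
  have [R [-> _]] := dY.
  apply: dfn_sat; apply: subs_case; [exact: subs_id|exact: subs_par].
move=> e de; apply: contrapT => nA.
have [_ ->|sigma [os ss sH]] := @move_outside [set e] (small1 L _) _; first exact: nA.
apply: (sH e) => //; have /fixes_tup : famcomp sigma d = d; last by apply.
by apply/(code_stab dY os.1); exact: HY.
Qed.

End Stabilizer.

(** * Complete types *)

Section CompleteType.
Variables (S : Type) (L : language S) (N : structure L) (s : S).
Variable p : set (formula L (bind N s)).
Hypothesis pc : complete_type p.
Implicit Types Q : set (N s).

Definition dfn1 (A : set (elt N)) Q := dfn A (fun r : tup N [:: s] => Q (r s new)).

Lemma dfn1P Q : dfn1 setT Q <-> exists phi : formula L (bind N s), Q = [set a | sat_at a phi].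
Proof.
split=> [/dfn1_formula[phi phiP]|[phi ->]].
  exists (rename (bindmap (@overval _ _ setT)) phi).
  apply/seteqP; split=> a; rewrite /= /sat_at sat_rename bindenv_bindmap; last by move=> /phiP.
  by move=> /phiP.
apply/dfn1_formula; exists (rename (bindmap (fun s a => exist _ a I : over setT s)) phi) => a.
by rewrite /= /sat_at sat_rename bindenv_bindmap.
Qed.

Lemma type_incl phi psi : p phi -> (forall a, sat_at a phi -> sat_at a psi) -> p psi.
Proof.
move=> pphi H; have [//|npsi] := pc.2 psi.
have [||a Fa] := pc.1 [set phi; Neg psi].
- exact: finite_set2.
- by move=> _ [->|->].
have := Fa (Neg psi) (or_intror erefl); rewrite /sat_at /= => nsat.
by case: nsat; apply: H; apply: Fa; left.
Qed.

Lemma in_type_dfn Q : in_type p Q -> dfn1 setT Q.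
Proof. by move=> [phi _ ->]; apply/dfn1P; exists phi. Qed.

Lemma in_type_mono Q Q' : in_type p Q -> Q `<=` Q' -> dfn1 setT Q' -> in_type p Q'.
Proof.
move=> [phi pphi ->] QQ /dfn1P[psi Qpsi]; exists psi => //.
by apply: (type_incl pphi) => a /QQ; rewrite Qpsi.
Qed.

Lemma in_typeN Q : dfn1 setT Q -> in_type p Q \/ in_type p (fun a => ~ Q a).
Proof.
move=> /dfn1P[phi ->]; have [pphi|pphi] := pc.2 phi; first by left; exists phi.
by right; exists (Neg phi).
Qed.

Lemma in_type_ex Q : in_type p Q -> exists a, Q a.
Proof.
move=> [phi pphi ->]; have [||a Fa] := pc.1 [set phi]; first exact: finite_set1.
  by move=> _ ->.
by exists a; exact: Fa.
Qed.

Lemma in_typeI Q Q' : in_type p Q -> in_type p Q' -> in_type p (fun a => Q a /\ Q' a).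
Proof.
move=> iQ iQ'; have dI : dfn1 setT (fun a => Q a /\ Q' a).
  by apply: dfn_and; exact: in_type_dfn.
have [//|n] := in_typeN dI; exfalso.
move: iQ iQ' n => [phi pphi Qphi] [psi ppsi Qpsi] [chi pchi Qchi].
have [||a Fa] := pc.1 [set phi; psi; chi]; first exact: finite_set3.
  by move=> _ [[->|->]|->].
have : [set a | sat_at a chi] a by apply: Fa; right.
rewrite -Qchi; apply; rewrite Qphi Qpsi; split; apply: Fa; left; by [left|right].
Qed.

Lemma in_type_cst (C : Prop) : C -> in_type p (fun=> C).
Proof.
move=> HC; have dC : dfn1 setT (fun _ : N s => C) by exact: dfn_cst.
by have [//|/in_type_ex[]] := in_typeN dC.
Qed.

Lemma in_type_aut (B : set (elt N)) (tau tau' : fammap N N) Q : invariant_type B p ->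
  automorphism_over B tau -> famcomp tau' tau = @famid S N ->
  famcomp tau tau' = @famid S N ->
  in_type p Q -> in_type p (fun a => Q (tau' s a)).
Proof.
move=> inv ot tt' tt [phi pphi ->]; exists (rename (bindmap tau) phi); first exact: (inv _
    ot phi).1.
apply/funext => a; rewrite /= /sat_at sat_rename bindenv_bindmap.
rewrite -(aut_sat (bindenv (tau' s a) _) _ ot.1) famcomp_bindenv.
have -> : tau s (tau' s a) = a by rewrite -[LHS]/(@famcomp _ _ _ _ tau tau' s a) tt.
by [].
Qed.

End CompleteType.

Lemma dfn1_subst (S : Type) (L : language S) (N : structure L) A s (Q : set (N s)) V
    (e : fammap V N -> N s) : dfn1 A Q -> sube A e -> dfn A (fun r => Q (e r)).
Proof.
move=> dQ se; refine (dfn_subst (g := fun r => tup1 (e r)) dQ _); exact: subs_tup1.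
Qed.

Section DfnCard.
Variables (S : Type) (L : language S) (N : structure L).

Lemma dfn_le_card (A : set (elt N)) V Gamma (Q : fammap V N -> tup N Gamma -> Prop) n :
  dfn A (fun r : fammap (famsum V (var Gamma)) N =>
    Q (fun s v => r s (inl v)) (fun s v => r s (inr v))) ->
  dfn A (fun r => le_card n (Q r)).
Proof.
elim: n V Q => [|n IH] V Q dQ /=; apply: dfn_allT.
  by apply: dfn_not.
apply: dfn_imp => //; apply: (IH _ (fun r z => Q (fun s v => r s (inl v)) z /\
  z <> (fun s v => r s (inr v)))).
apply: dfn_and.
  refine (dfn_subst (g := fun r : fammap (famsum (famsum V (var Gamma)) (var Gamma)) N =>
    famcase (fun s v => r s (inl (inl v))) (fun s v => r s (inr v))) dQ _).
  by move=> s [v|v]; exact: sube_var.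
by apply: dfn_not; apply: dfn_eqT => s v; exact: sube_var.
Qed.

Lemma le_card_inj T U n (Q : set T) (R : set U) (g : U -> T) : injective g ->
  (forall y, R y -> Q (g y)) -> le_card n Q -> le_card n R.
Proof.
move=> gi; elim: n Q R => [|n IH] Q R RQ H y; first by move=> /RQ; exact: H.
move=> Ry; apply: IH (H _ (RQ _ Ry)) => z [Rz zy]; split; first exact: RQ.
by move=> /gi.
Qed.

End DfnCard.

(** * Germs of families of finite sets *)

Lemma famcomp_tcons (S : Type) (M N : S -> Type) (f : fammap M N) s Gamma (a : M s)
    (x : tup M Gamma) : famcomp f (tcons a x) = tcons (f s a) (famcomp f x).
Proof. exact: famcomp_bindenv. Qed.

Section Generic.
Variables (S : Type) (Lt L : language S) (i : sublanguage Lt L).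
Variables (Tt : set (sentence Lt)) (hQE : eliminates_quantifiers Tt).
Variables (M : structure L) (hsat : saturated M).
Variables (Mt : structure Lt) (hMt : models Mt Tt).
Variables (h : fammap M Mt) (hh : embedding (M := reduct i M) h).
Variables (A : set (elt M)) (s : S) (c : M s) (p : set (formula Lt (bind Mt s))).
Hypotheses (sA : A #<= [set: symbols L]) (pc : complete_type p).
Hypothesis pcons : consistent_with_tp h p A c.
Local Notation img B := (elt_map h @` B).

Lemma generic_pair U W : dfn1 (range (elt_map h)) U -> in_type p U ->
  dfn1 A W -> W c -> exists d : M s, U (@h s d) /\ W d.
Proof.
move=> /dfn1_formula[phi phiP] pU /dfn1_formula[psi psiP] Wc.
have H s' (a : over (range (elt_map h)) s') : exists x : M s', @h s' x = sval a.
  by have [x _ e] := (image_elt h setT (sval a)).1 (svalP a); exists x.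
pose g s' a := sval (cid (H s' a)).
have gP s' (a : over (range (elt_map h)) s') : @h s' (g s' a) = sval a by exact: svalP (cid
    (H s' a)).
pose phi' : formula Lt (bind M s) := rename (bindmap g) phi.
have phi'P a : sat_at a (rename (bindmap h) phi') <-> U a.
  rewrite phiP /phi' rename_comp /sat_at sat_rename; apply: eq_iff; congr sat.
  by apply: famext => s' [//|s'' v]; rewrite /famcomp /= gP.
have pphi' : p (rename (bindmap h) phi').
  have [chi pchi Uchi] := pU; apply: (type_incl pc pchi) => a chia.
  by apply/phi'P; rewrite Uchi.
have [|_ -> //||_ ->|d [dF dG]] := pcons (F := [set phi']) (G := [set psi]).
- exact: finite_set1.
- exact: finite_set1.
- exact/psiP.
exists d; split; first by apply/phi'P; exact: dF.
by apply/psiP; apply: dG.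
Qed.

(** Over a small set of parameters, [p] and the type of [c] over [A] have a common
    realization in [M]: by quantifier elimination the formulas of [p] can be read
    in [M], which is saturated. *)
Lemma generic_point B : B #<= [set: symbols L] -> exists d : M s,
  (forall U, dfn1 (img B) U -> in_type p U -> U (@h s d)) /\
  (forall W, dfn1 A W -> W c -> W d).
Proof.
move=> sB; pose PP : set (set (tup M [:: s])) := [set P | exists U W,
  [/\ dfn1 (img B) U, in_type p U, dfn1 A W, W c & P = fun r => U (@h s (r s new)) /\ W (r
      s new)]].
have imgs : img B `<=` range (elt_map h) by move=> _ [e _ <-]; exists e.
have [|||P1 P2|P|r Hr] := compactness hsat (A := A `|` B) (PP := PP) _ (small_var L [:: s]).
- exact: smallU.
- move=> _ [U [W [dU _ dW _ ->]]]; apply: dfn_and; last by apply: dfn_mono dW => e; left.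
  by apply: dfn_mono (dfn_reduct hQE hMt hh dU) => e; right.
- exists (fun r => True /\ True), (fun=> True), (fun=> True).
  by split=> //; [exact: dfn_cst|exact: in_type_cst|exact: dfn_cst].
- move=> [U [W [dU pU dW Wc ->]]] [U' [W' [dU' pU' dW' Wc' ->]]].
  exists (fun r => (U (@h s (r s new)) /\ U' (@h s (r s new))) /\ (W (r s new) /\ W' (r s new))).
    exists (fun a => U a /\ U' a), (fun a => W a /\ W' a); split=> //.
    + exact: dfn_and.
    + exact: in_typeI.
    + exact: dfn_and.
  by move=> r [[? ?] [? ?]]; split; split.
- move=> [U [W [dU pU dW Wc ->]]].
  have [d [Ud Wd]] := generic_pair (dfn_mono imgs dU) pU dW Wc.
  by exists (tup1 d).
exists (r s new); split=> [U dU pU|W dW Wc].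
  have [] // : U (@h s (r s new)) /\ True.
  apply: (Hr (fun r => U (@h s (r s new)) /\ True)); exists U, (fun=> True); split=> //.
  exact: dfn_cst.
have [] // : True /\ W (r s new).
apply: (Hr (fun r => True /\ W (r s new))); exists (fun=> True), W; split=> //.
  exact: dfn_cst.
exact: in_type_cst.
Qed.

Variables (Lambda : seq S) (f : set (tup M (s :: Lambda))).
Hypotheses (df : dfn setT f).
Hypothesis ff : forall a y y', f (tcons a y) -> f (tcons a y') -> y = y'.
Variable W0 : set (M s).
Hypotheses (dW0 : dfn1 A W0) (W0c : W0 c).
Hypothesis W0f : forall a, W0 a -> exists y, f (tcons a y).

(** The values of the partial function [f] at the points realizing both [p] and the
    type of [c] over [A] belong to the fibres of [E]. *)
Definition good (E : set (tup Mt (s :: Lambda))) :=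
  dfn (range (elt_map h)) E /\ exists U W,
  [/\ dfn1 (range (elt_map h)) U, in_type p U, dfn1 A W, W c &
   forall t : tup M (s :: Lambda), U (@h s (t s new)) -> W (t s new) -> f t -> E (famcomp h t)].

Definition fibre (N : S -> Type) (E : set (tup N (s :: Lambda))) (a : N s) : set (tup N Lambda) :=
  [set y | E (tcons a y)].

Lemma dfn1_le_card (B : set (elt Mt)) (E : set (tup Mt (s :: Lambda))) n :
  dfn B E -> dfn1 B (fun a => le_card n (fibre E a)).
Proof.
move=> dE; apply: dfn_le_card; apply: (dfn_subst dE).
by apply: subs_tcons => [|s' v]; exact: sube_var.
Qed.

Hypothesis bounded : forall (c' : M s) (M' : structure L) (j : fammap M' M),
  elementary_embedding j ->
  img (dcl (range (elt_map j) `|` [set Tagged M c'])) `<=`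
  acl (img (range (elt_map j) `|` [set Tagged M c'])).

(** Let [B] be a small elementary submodel over which [f] is defined.  At every point
    [x] realizing both types over [B], the coordinates of [f x] belong to finite
    sets definable over [B] and [x].  By compactness finitely many families of such
    sets are enough, and the union of these families is good. *)
Lemma good_exists : exists E n, good E /\ in_type p (fun a => le_card n (fibre E a)).
Proof.
have [B0 [_ sB0 _ dB0]] := dfn_small df.
have [M' [j [hj B0j sj]]] := lowenheim_skolem sB0.
set B := range (elt_map j) in sj B0j.
have imgs : img B `<=` range (elt_map h) by move=> _ [e _ <-]; exists e.
have dfB : dfn B f by exact: dfn_mono dB0.
(* The families over [B] of uniformly bounded finite sets. *)
pose EE E := dfn (img B) E /\ exists n, forall a, le_card n (fibre E a).
pose PP : set (set (tup M (s :: Lambda))) := [set P | exists U W E,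
  [/\ dfn1 (img B) U /\ in_type p U, dfn1 A W, W c, EE E &
   P = fun t => (U (@h s (t s new)) /\ W (t s new)) /\ (f t /\ ~ E (famcomp h t))]].
apply: contrapT => nE.
have [|||P1 P2|P|t Ht] := compactness hsat (A := A `|` B) (PP := PP) _ (small_var L (s ::
    Lambda)).
- exact: smallU.
- move=> _ [U [W [E [[dU _] dW _ [dE _] ->]]]]; apply: dfn_and; apply: dfn_and.
  + apply: (dfn1_subst (Q := fun a => U (@h s a))); last exact: sube_var.
    by apply: dfn_mono (dfn_reduct hQE hMt hh dU) => e; right.
  + apply: dfn1_subst; last exact: sube_var.
    by apply: dfn_mono dW => e; left.
  + by apply: dfn_mono dfB => e; right.
  + apply: dfn_not; by apply: dfn_mono (dfn_reduct hQE hMt hh dE) => e; right.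
- eexists; exists (fun=> True), (fun=> True), (fun=> False); split=> //.
  + by split; [exact: dfn_cst|exact: in_type_cst].
  + exact: dfn_cst.
  + split; first exact: dfn_cst.
    by exists 0%N => a y.
- move=> [U [W [E [[dU pU] dW Wc [dE [n En]] ->]]]] [U' [W' [E' [[dU' pU'] dW' Wc' [dE' [n'
    En']] ->]]]].
  eexists; first exists (fun a => U a /\ U' a), (fun a => W a /\ W' a), (fun t => E t \/ E' t).
    split=> //.
    + by split; [exact: dfn_and|exact: in_typeI].
    + exact: dfn_and.
    + split; first exact: dfn_or.
      by exists (n + n')%N => a; exact: le_cardU (En a) (En' a).
  by move=> r [[[? ?] [? ?]] [? nEE]]; split; split; split=> // Er; apply: nEE; [left|right].
- move=> [U [W [E [[dU pU] dW Wc [dE [n En]] ->]]]]; apply: contrapT => nP.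
  apply: nE; exists E, n; split.
    split; first exact: dfn_mono dE.
    exists U, W; split=> //; first exact: dfn_mono dU.
    move=> t Ut Wt ft; apply: contrapT => nEt; apply: nP; exists t; split=> //.
  have dl : dfn1 setT (fun a => le_card n (fibre E a)).
    by apply: dfn_mono (dfn1_le_card n dE).
  have [//|/(in_type_ex pc)[a na]] := in_typeN pc dl.
  by case: na; exact: En.
pose c' := t s new; pose y : tup M Lambda := fun s' v => t s' (old v).
have tE : t = tcons c' y by exact: tup_eta.
have HE E : EE E -> f t /\ ~ E (famcomp h t).
  move=> EEE; have [] // : (True /\ True) /\ (f t /\ ~ E (famcomp h t)).
  apply: (Ht (fun t => (True /\ True) /\ (f t /\ ~ E (famcomp h t)))).
  exists (fun=> True), (fun=> True), E; split=> //.
  + by split; [exact: dfn_cst|exact: in_type_cst].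
  + exact: dfn_cst.
have [ft _] : f t /\ ~ False.
  by apply: (HE (fun=> False)); split; [exact: dfn_cst|exists 0%N => a z].
have coord s' (v : var Lambda s') :
    exists Q : set (fammap (famsum (var [:: s']) (var [:: s])) Mt),
    [/\ dfn (img B) Q, Q (famcase (tup1 (@h s' (y s' v))) (tup1 (@h s c'))) &
      finite_set [set b | Q (famcase (tup1 b) (tup1 (@h s c')))]].
  have [X [/definable_dfn dX fX Xy]] : acl (img (B `|` [set Tagged M c'])) (Tagged Mt (@h
      s' (y s' v))).
    apply: (bounded hj); exists (Tagged M (y s' v)) => //.
    apply/definable_dfn; apply: (dfn_ext (P := fun x : tup M [:: s'] =>
        exists y', f (tcons c' y') /\ x s' new = y' s' v)).
      move=> x; split=> [[y' [fy' xy]]|->]; last by exists y; rewrite -tE.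
      rewrite /= -(ff fy' (y' := y)) -?tE // -xy.
      by rewrite [LHS]tup_eta; congr tcons; apply: famext => s0 [].
    apply: dfn_exT; apply: dfn_and; last by apply: dfn_eq; exact: sube_var.
    apply: (dfn_subst (dfn_mono _ dfB)); first by move=> e; left.
    apply: subs_tcons; last by move=> s0 v0; exact: sube_var.
    by apply: sube_par; right.
  have [|Q dQ XQ] := @dfn_split _ _ _ (img B) _ (tup1 (@h s c')) _ X.
    apply: dfn_mono dX => _ [e [Be|->] <-]; first by left; exists e.
    by right; exists new.
  exists Q; split=> //; first exact/XQ.
  apply: (@sub_finite_set _ _ ((fun x : tup Mt [:: s'] => x s' new) @` X)); last exact:
      finite_image.
  by move=> b /XQ Xb; exists (tup1 b).
pose Q s' v := sval (cid (coord s' v)).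
have QP s' v : [/\ dfn (img B) (Q s' v), Q s' v (famcase (tup1 (@h s' (y s' v))) (tup1 (@h
    s c'))) &
      finite_set [set b | Q s' v (famcase (tup1 b) (tup1 (@h s c')))]] by exact: svalP (cid
          (coord s' v)).
pose E0 (u : tup Mt (s :: Lambda)) := forall s' v, Q s' v (famcase (tup1 (u s' (old v)))
    (tup1 (u s new))).
have dE0 : dfn (img B) E0.
  apply: dfn_allvar => s' v; have [dQ _ _] := QP s' v.
  apply: (dfn_subst dQ); apply: subs_case; apply: subs_tup1; exact: sube_var.
have [n En] : exists n, le_card n (fibre E0 (@h s c')).
  apply/finite_le_card; apply: (finite_product (X := fun s' v => [set b | Q s' v (famcase
      (tup1 b) (tup1 (@h s c')))])).
  by move=> s' v; have [] := QP s' v.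
pose E (u : tup Mt (s :: Lambda)) := E0 u /\ le_card n (fibre E0 (u s new)).
have EEE : EE E.
  split.
    apply: dfn_and => //; apply: (dfn1_subst (Q := fun a => le_card n (fibre E0 a))); last
        exact: sube_var.
    exact: dfn1_le_card.
  exists n => a; have [Ha|nHa] := pselect (le_card n (fibre E0 a)).
    by apply: le_card_sub Ha => z [].
  by apply: (@le_card_leq _ 0) => // z [].
have [_] := HE E EEE; apply; split=> //.
by move=> s' v; have [] := QP s' v.
Qed.

Lemma good_inter E E' : good E -> good E' -> good (fun t => E t /\ E' t).
Proof.
move=> [dE [U [W [dU pU dW Wc H]]]] [dE' [U' [W' [dU' pU' dW' Wc' H']]]].
split; first exact: dfn_and.
exists (fun a => U a /\ U' a), (fun a => W a /\ W' a); split=> //.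
- exact: dfn_and.
- exact: in_typeI.
- exact: dfn_and.
- by move=> t [? ?] [? ?] ft; split; [exact: H|exact: H'].
Qed.

Lemma dfn1_fibre (B : set (elt Mt)) (E E' : set (tup Mt (s :: Lambda))) : dfn B E -> dfn B E' ->
  dfn1 B (fun a => fibre E a `<=` fibre E' a).
Proof.
move=> dE dE'; apply: dfn_allT; apply: dfn_imp.
  by apply: (dfn_subst dE); apply: subs_tcons => [|s' v]; exact: sube_var.
by apply: (dfn_subst dE'); apply: subs_tcons => [|s' v]; exact: sube_var.
Qed.

(** Take [E] of least generic cardinality.  Its intersection with another good
    family is good, and would be generically smaller if it were not generically
    equal to [E]. *)
Lemma minimal_good : exists E n, [/\ good E, in_type p (fun a => le_card n (fibre E a)) &
  forall E', good E' -> in_type p (fun a => fibre E a `<=` fibre E' a) /\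
    (in_type p (fun a => le_card n (fibre E' a)) -> in_type p (fun a => fibre E' a `<=`
        fibre E a))].
Proof.
pose P n := `[< exists E, good E /\ in_type p (fun a => le_card n (fibre E a)) >].
have exP : exists n, P n.
  by have [E [n H]] := good_exists; exists n; apply/asboolP; exists E.
case: (ex_minnP exP) => n /asboolP[E [gE En]] nmin.
have key E1 E2 : good E1 -> good E2 -> in_type p (fun a => le_card n (fibre E1 a)) ->
    in_type p (fun a => fibre E1 a `<=` fibre E2 a).
  move=> g1 g2 E1n; have d12 : dfn1 setT (fun a => fibre E1 a `<=` fibre E2 a).
    by apply: (@dfn_mono _ _ _ (range (elt_map h))) => //; apply: dfn1_fibre; [exact:
        g1.1|exact: g2.1].
  have [//|nsub] := in_typeN pc d12; exfalso.
  have gI := good_inter g1 g2.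
  have both := in_typeI pc nsub E1n.
  have drop a : ~ (fibre E1 a `<=` fibre E2 a) /\ le_card n (fibre E1 a) ->
      exists2 m, (m < n)%N & le_card m (fibre (fun t => E1 t /\ E2 t) a).
    move=> [ns Ha]; apply: le_card_proper Ha; first by move=> z [].
    by move=> sub; apply: ns => z /sub[].
  case: (n) nmin both drop => [|n'] nmin both drop.
    by have [a /drop[m]] := in_type_ex pc both.
  have : (n'.+1 <= n')%N; last by rewrite ltnn.
  apply: nmin; apply/asboolP; exists (fun t => E1 t /\ E2 t); split=> //.
  apply: (in_type_mono pc both).
    by move=> a /drop[m mn]; exact: le_card_leq.
  by apply: (dfn_mono (A := range (elt_map h))) => //; apply: dfn1_le_card; exact: gI.1.
exists E, n; split=> // E' gE'; split; first exact: key.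
exact: key.
Qed.

Hypothesis inv : invariant_type (img A) p.

Definition extends (sigma : fammap M M) (tau : fammap Mt Mt) := famcomp tau h = famcomp h sigma.

Lemma extends_inverse sigma sigma' tau tau' : extends sigma tau ->
  famcomp sigma sigma' = @famid S M -> famcomp tau' tau = @famid S Mt ->
  extends sigma' tau'.
Proof.
move=> e ss tt; rewrite /extends.
apply: famext => s' x.
have E : tau s' (@h s' (sigma' s' x)) = @h s' x.
  rewrite -[LHS]/(@famcomp _ _ _ _ tau h s' (sigma' s' x)) e; congr (@h s' _).
  exact: (congr1 (fun k : fammap M M => k s' x) ss).
rewrite /famcomp -E; exact: (congr1 (fun k : fammap Mt Mt => k s' _) tt).
Qed.

Lemma extends_over B sigma tau : automorphism tau -> extends sigma tau ->
  automorphism_over B sigma -> automorphism_over (img B) tau.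
Proof.
move=> ht e [hs os]; split=> // _ [[s' x] Bx <-]; apply/fixesE.
have /fixesE sx := os _ Bx.
by rewrite -[tau s' _]/(@famcomp _ _ _ _ tau h s' x) e /famcomp sx.
Qed.

Lemma extends_range sigma tau : automorphism sigma -> extends sigma tau ->
  elt_map tau @` range (elt_map h) = range (elt_map h).
Proof.
move=> hs e; have E s' (x : M s') : tau s' (@h s' x) = @h s' (sigma s' x).
  exact: (congr1 (fun k : fammap M Mt => k s' x) e).
apply/seteqP; split=> [_ [_ [[s' x] _ <-] <-]|_ [[s' x] _ <-]].
  by exists (Tagged M (sigma s' x)) => //; rewrite /elt_map /= E.
have [y <-] := hs.2 s' x; exists (elt_map h (Tagged M y)); first by exists (Tagged M y).
by rewrite /elt_map /= E.
Qed.

(** All the ingredients of the definition of a good family are invariant under the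
    automorphisms over [A] that fix [f]. *)
Lemma good_aut E n sigma tau tau' : automorphism_over A sigma -> stab sigma f ->
  automorphism tau -> extends sigma tau ->
  famcomp tau' tau = @famid S Mt -> famcomp tau tau' = @famid S Mt -> automorphism tau' ->
  good E -> in_type p (fun a => le_card n (fibre E a)) ->
  good (fun t => E (famcomp tau' t)) /\
  in_type p (fun a => le_card n (fibre (fun t => E (famcomp tau' t)) a)).
Proof.
move=> os sf ht e tt' tt ht' [dE [U [W [dU pU dW Wc H]]]] En.
have oht := extends_over ht e os.
have [sigma' [os' s's ss']] := over_inverse os.
have e' := extends_inverse e ss' tt'.
have sub : elt_map tau @` range (elt_map h) `<=` range (elt_map h).
  by rewrite (extends_range os.1 e).
split; last first.
  apply: (in_type_mono pc (in_type_aut inv oht tt' tt En)) => [a|].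
    apply: (le_card_inj (g := fun y => famcomp tau' y)).
      move=> y z /(congr1 (famcomp tau)) yz.
      by have : famcomp (famcomp tau tau') y = famcomp (famcomp tau tau') z := yz; rewrite tt.
    by move=> y; rewrite /fibre /= famcomp_tcons.
  apply: (dfn_mono (A := elt_map tau @` range (elt_map h))) => //.
  by apply: dfn1_le_card; exact: dfn_image tt dE.
split; first exact: dfn_mono sub (dfn_image ht ht' tt dE).
exists (fun a => U (tau' s a)), W; split=> //.
- exact: dfn_mono sub (dfn_image ht ht' tt dU).
- exact: in_type_aut inv oht tt' tt pU.
move=> t Ut Wt ft.
have hE (V : S -> Type) (r : fammap V M) : famcomp tau' (famcomp h r) = famcomp h (famcomp
    sigma' r).
  by rewrite famcompA e'.
have hEs s' (x : M s') : tau' s' (@h s' x) = @h s' (sigma' s' x).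
  exact: (congr1 (fun k : fammap M Mt => k s' x) e').
rewrite hE; apply: H.
- by rewrite /famcomp -hEs.
- by apply/(dfn_aut (P := fun r : tup M [:: s] => W (r s new)) (tup1 (t s new)) os' dW).
- by apply/sf; rewrite famcompA ss'.
Qed.


Hypothesis hEI : eliminates_imaginaries Tt.
Hypothesis hext : forall sigma, automorphism sigma ->
  exists2 tau : fammap Mt Mt, automorphism tau & extends sigma tau.
Hypothesis internal : forall eps : elt Mt, dcl (range (elt_map h)) eps ->
  exists (Gamma : seq S) (eta : tup M Gamma),
  forall tau : fammap Mt Mt, automorphism tau ->
  elt_map tau @` range (elt_map h) = range (elt_map h) ->
  (fixes tau eps <-> famcomp tau (famcomp h eta) = famcomp h eta).
Hypothesis germs : forall (Gamma : seq S) (r : set (tup Mt (s :: Gamma))),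
  definable_function r -> in_type p (domain r) ->
  forall (Delta : seq S) (b : tup Mt Delta), is_code r b ->
  exists (I : Type) (le : I -> I -> Prop) (eps : I -> elt Mt),
  [/\ directed_order le, forall k, dcl (img A `|` tup_elts b) (eps k)
    & forall sigma, automorphism_over (img A) sigma ->
      (fixes_germ p r sigma <-> exists k0, forall k, le k0 k -> fixes sigma (eps k))].
Hypothesis movable : forall H : set (elt M), H #<= [set: symbols L] ->
  (forall e, H e -> ~ A e) -> exists sigma,
  [/\ automorphism_over A sigma, stab sigma f & forall e, H e -> ~ fixes sigma e].

Definition same_fibre (E : set (tup Mt (s :: Lambda))) (tau' : fammap Mt Mt) : set (Mt s) :=
  fun a => forall y, E (tcons a y) <-> E (famcomp tau' (tcons a y)).

Definition codes Delta (R : formula Lt (famsum (var Lambda) (var Delta)))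
    (E : set (tup Mt (s :: Lambda))) (a : Mt s) (z : tup Mt Delta) :=
  (forall y, E (tcons a y) <-> sat (famcase y z) R) /\
  (forall z', (forall y, sat (famcase y z) R <-> sat (famcase y z') R) -> z = z').

Lemma same_fibre_codes Delta (R : formula Lt (famsum (var Lambda) (var Delta))) E tau tau' a
    (z : tup Mt Delta) :
  automorphism tau -> automorphism tau' -> famcomp tau' tau = @famid S Mt ->
  famcomp tau tau' = @famid S Mt -> codes R E a z ->
  codes R E (tau' s a) (famcomp tau' z) <-> same_fibre E tau' a.
Proof.
move=> ht ht' tt' tt [Ez uz].
have satR (y : tup Mt Lambda) (w : tup Mt Delta) :
    sat (famcase (famcomp tau' y) (famcomp tau' w)) R = sat (famcase y w) R.
  by rewrite -famcomp_case aut_sat.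
have Kt (V : S -> Type) (y : fammap V Mt) : famcomp tau' (famcomp tau y) = y by rewrite
    famcompA tt'.
have tK (V : S -> Type) (y : fammap V Mt) : famcomp tau (famcomp tau' y) = y by rewrite
    famcompA tt.
split=> [[E' _] y|H].
  by rewrite Ez -satR -E' famcomp_tcons.
split=> [y|z' Hz'].
  rewrite -(Kt _ y) satR -Ez H famcomp_tcons; exact: iff_refl.
suff -> : z = famcomp tau z' by rewrite Kt.
apply: uz => y; rewrite -satR Hz' -(satR _ (famcomp tau z')) Kt; exact: iff_refl.
Qed.

Lemma range_img (B : set (elt Mt)) : finite_set B -> B `<=` range (elt_map h) ->
  exists B1 : set (elt M), B1 #<= [set: symbols L] /\ B `<=` img B1.
Proof.
move=> fB Bh; have [l lB] := finite_seq_ex fB.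
have lh e : List.In e l -> range (elt_map h) e by move=> /lB/Bh.
suff [l1 H] : exists l1, forall e, List.In e l -> img [set x | List.In x l1] e.
  exists [set x | List.In x l1]; split; first exact: small_In.
  by move=> e /lB/H.
elim: l lh {lB} => [|e l IH] lh; first by exists [::].
have [l1 H] := IH (fun e' e'l => lh e' (or_intror e'l)).
have [x _ hx] := lh e (or_introl erefl).
exists (x :: l1) => e' [<-|/H[y y1 <-]]; first by exists x => //; left.
by exists y => //; right.
Qed.

(** Take [E] of least generic cardinality.  An automorphism over [A] that fixes [f]
    maps [E] to another good family, hence preserves its germ; equivalently, it
    preserves the germ of the function [r] that sends a point [a] to the code of
    the fibre of [E] at [a], and therefore fixes almost all the elements [eps k]
    attached to this germ.  Each [eps k] is interdefinable with a tuple of [M].  If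
    cofinally many of these tuples were not contained in [A], one automorphism over
    [A] fixing [f] would move them all ([movable]).  So almost all of them are in
    [A], and the germ is preserved by all automorphisms over [A].

    The formula [R] that codes the fibres is found at one point [c0] of [M]; as [p]
    is complete and [c0] realizes it over the parameters of [E], the same formula
    codes the generic fibre. *)
Lemma canonical_good : exists E n, [/\ good E, in_type p (fun a => le_card n (fibre E a)) &
  forall sigma tau tau', automorphism_over A sigma -> automorphism tau -> extends sigma tau ->
    automorphism tau' -> famcomp tau' tau = @famid S Mt -> famcomp tau tau' = @famid S Mt ->
    in_type p (same_fibre E tau')].
Proof.
have [E [n [gE En Emin]]] := minimal_good; exists E, n; split=> //.
have dE := gE.1.
have dcodes Delta (R : formula Lt (famsum (var Lambda) (var Delta))) B W e
   (g : fammap W Mt -> tup Mt Delta) : dfn B E -> sube B e -> subs B g ->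
   dfn B (fun r : fammap W Mt => codes R E (e r) (g r)).
  move=> dE' se sg.
  have se1 U (k : fammap U Mt -> fammap W Mt) : subs B k -> sube B (fun q => e (k q)).
    move=> sk; have sk1 := subs_trans (k := fun r => tup1 (e r)) (subs_tup1 se) sk.
    exact: (sk1 s new).
  have sg1 U (k : fammap U Mt -> fammap W Mt) : subs B k -> subs B (fun q => g (k q)).
    exact: subs_trans.
  apply: dfn_and; apply: dfn_allT.
    apply: dfn_iff.
      apply: (dfn_subst dE'); apply: subs_tcons; last by move=> s' v; exact: sube_var.
      by apply: se1 => s' v; exact: sube_var.
    apply: dfn_sat; apply: subs_case; first by move=> s' v; exact: sube_var.
    by apply: sg1 => s' v; exact: sube_var.
  apply: dfn_imp.
    apply: dfn_allT; apply: dfn_iff; apply: dfn_sat; apply: subs_case;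
      try by move=> s' v; exact: sube_var.
    by apply: sg1 => s' v; exact: sube_var.
  apply: dfn_eqT; last by move=> s' v; exact: sube_var.
  by apply: sg1 => s' v; exact: sube_var.
have dsame E' : dfn setT E' -> dfn1 setT (fun a => forall y, E (tcons a y) <-> E' (tcons a y)).
  move=> dE'; apply: dfn_allT; apply: dfn_iff.
    apply: (dfn_subst (dfn_mono _ dE)) => //; apply: subs_tcons => [|s' v]; exact: sube_var.
  by apply: (dfn_subst dE'); apply: subs_tcons => [|s' v]; exact: sube_var.
have [B [Bh sB fB dB]] := dfn_small dE.
have [B1 [sB1 BB1]] := range_img fB Bh.
have [c0 [c0U _]] := generic_point sB1.
have [Delta [b [R [Rb ub]]]] : coded (fibre E (@h s c0)).
  apply: (hEI hMt); apply/definable_dfn.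
  apply: (dfn_subst (dfn_mono _ dE)) => //; apply: subs_tcons; first exact: sube_par.
  by move=> s' v; exact: sube_var.
have codes_b : codes R E (@h s c0) b.
  split=> [y|z' Hz]; first by rewrite -[E _]/(fibre E (@h s c0) y) Rb.
  apply: contrapT => /ub; apply; apply/seteqP; split=> y; by rewrite /defset /= Hz.
pose r : set (tup Mt (s :: Delta)) := fun t => codes R E (t s new) (fun s' v => t s' (old v)).
have rE a z : r (tcons a z) = codes R E a z by [].
have dr B' : dfn B' E -> dfn B' r.
  by move=> dE'; apply: dcodes => // [|s' v]; exact: sube_var.
have rfun : definable_function r.
  split; first by apply/definable_dfn; apply: dr; exact: dfn_mono dE.
  by move=> a z z'; rewrite !rE => -[H1 H2] [H1' _]; apply: H2 => y; rewrite -H1 H1'.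
have ddom B' : dfn B' E -> dfn1 B' (domain r).
  move=> dE'; apply: dfn_exT; apply: (dfn_subst (dr _ dE')).
  by apply: subs_tcons => [|s' v]; exact: sube_var.
have rdom : in_type p (domain r).
  have [//|n'] := in_typeN pc (ddom _ (dfn_mono (@subsetT _ _) dE)).
  have : ~ domain r (@h s c0); last by case; exists b.
  apply: (c0U (fun a => ~ domain r a)) => //; apply: dfn_not.
  apply: ddom; exact: dfn_mono dB.
have [Delta' [b' code_b']] : coded r by apply: (hEI hMt); exact: rfun.1.
have [I [le [eps [_ epsd epsP]]]] := germs rfun rdom code_b'.
have germE sigma tau tau' : automorphism_over A sigma -> automorphism tau -> extends sigma tau ->
    automorphism tau' -> famcomp tau' tau = @famid S Mt -> famcomp tau tau' = @famid S Mt ->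
    fixes_germ p r tau <-> in_type p (same_fibre E tau').
  move=> os ht e ht' tt' tt.
  have dsf : dfn1 setT (same_fibre E tau').
    apply: (dsame (fun t => E (famcomp tau' t))).
    by apply: (dfn_mono _ (dfn_image ht ht' tt dE)).
  have imr a y : (famcomp tau @` r) (tcons a y) <-> codes R E (tau' s a) (famcomp tau' y).
    rewrite -rE; split=> [[t rt te]|H].
      have -> : tcons (tau' s a) (famcomp tau' y) = famcomp tau' (tcons a y) by rewrite
          famcomp_tcons.
      by rewrite -te famcompA tt'.
    exists (famcomp tau' (tcons a y)); last by rewrite famcompA tt.
    by rewrite famcomp_tcons.
  split=> [H|H].
    apply: (in_type_mono pc H) => // a [y [ry /imr ry']].
    by apply/(same_fibre_codes ht ht' tt' tt ry).
  apply: (in_type_mono pc (in_typeI pc rdom H)) => [a [[y ry] sf]|].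
    exists y; split=> //; apply/imr; exact/(same_fibre_codes ht ht' tt' tt ry).
  apply: dfn_exT; apply: dfn_and.
    apply: (dfn_subst (dr setT (dfn_mono _ dE))) => //.
    by apply: subs_tcons => [|s' v]; exact: sube_var.
  apply: (dfn_ext (P := fun q => (fun t => r (famcomp tau' t)) (tcons (q s (inl new)) (fun
      s' v => q s' (inr v))))).
    move=> q; rewrite imr -rE famcomp_tcons; exact: iff_refl.
  apply: (dfn_subst (Q := fun t => r (famcomp tau' t))).
    by apply: (dfn_mono _ (dfn_image ht ht' tt (dr _ dE))).
  by apply: subs_tcons => [|s' v]; exact: sube_var.
(* The elements [eps k], whose index set is arbitrary, range over the small set
   [De]; the tuples of [M] attached to them are thus collected in a small set. *)
pose De := dcl (img A `|` tup_elts b').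
have imgA : img A `<=` range (elt_map h) by move=> _ [x _ <-]; exists x.
have De_dcl e : De e -> dcl (range (elt_map h)) e.
  move=> /definable_dfn/dfn_split[Q dQ eQ].
  have [R' [rR' uR']] := code_b'.
  apply/definable_dfn; apply: (dfn_ext (P := fun x : tup Mt [:: tag e] => exists z : tup Mt
      Delta',
      (forall t, r t <-> sat (famcase t z) R') /\ Q (famcase x z))).
    move=> x; split=> [[z [rz Qz]]|xe].
      suff zb : b' = z by apply/eQ; rewrite zb.
      apply: contrapT => /uR'; apply; rewrite -rR'; apply/seteqP; by split=> t /rz.
    by exists b'; split; [move=> t; rewrite {1}rR'|apply/eQ].
  apply: dfn_exT; apply: dfn_and.
    apply: dfn_allT; apply: dfn_iff.
      by apply: (dfn_subst (dr _ dE)) => s' v; exact: sube_var.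
    by apply: dfn_sat; apply: subs_case => s' v; exact: sube_var.
  by apply: (dfn_subst (dfn_mono imgA dQ)); apply: subs_case => s' v; exact: sube_var.
have etaP (e : {e | De e}) : exists eta : {Gamma : seq S & tup M Gamma},
    forall tau : fammap Mt Mt, automorphism tau ->
    elt_map tau @` range (elt_map h) = range (elt_map h) ->
    (fixes tau (sval e) <-> famcomp tau (famcomp h (tagged eta)) = famcomp h (tagged eta)).
  have [Gamma [eta H]] := internal (De_dcl _ (svalP e)).
  by exists (existT (fun Gamma => tup M Gamma) Gamma eta).
pose eta e := sval (cid (etaP e)).
have h_inj : forall s', injective (@h s') by case: hh.
have fix_eps (e : {e | De e}) sigma tau : automorphism sigma -> automorphism tau ->
    extends sigma tau -> fixes tau (sval e) <-> forall x, tup_elts (tagged (eta e)) x ->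
        fixes sigma x.
  move=> hs ht ex; rewrite (svalP (cid (etaP e)) tau ht (extends_range hs ex)) fixes_tup
      -/(eta e).
  have -> : famcomp tau (famcomp h (tagged (eta e))) = famcomp h (famcomp sigma (tagged (eta e))).
    by rewrite famcompA ex.
  split=> [H|-> //]; apply: famext => s' v; apply: h_inj.
  exact: (congr1 (fun k : tup Mt (tag (eta e)) => k s' v) H).
pose HH := [set x | exists e, tup_elts (tagged (eta e)) x].
have sHH : HH #<= [set: symbols L].
  have nK := injects_nat L.
  have DeK : injects {e | De e} (symbols L).
    apply: (@injects_trans _ {e | acl (img A `|` tup_elts b') e}).
      apply: injects_sig => e dcle; exists [set tup1 (tagged e)]; split=> //.
    apply: acl_count; first exact: injects_symbols i.
    by apply/smallP; apply: smallU; [exact: small_image|exact: small_tup].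
  have tK : injects {e : {e | De e} & {s : S & var (tag (eta e)) s}} (symbols L).
    by apply: injects_tag => // e; exact: small_var.
  apply: small_sub (small_range (fun x : {e : {e | De e} & {s : S & var (tag (eta e)) s}} =>
    Tagged M (tagged (eta (tag x)) _ (tagged (tagged x)))) tK).
  move=> [s' x] [e [/= v <-]].
  by exists (existT _ e (Tagged (var (tag (eta e))) v)).
have epsDe k : De (eps k) by exact: epsd.
pose et k := eta (exist _ (eps k) (epsDe k)).
have [k0 k0P] : exists k0, forall k, le k0 k -> tup_elts (tagged (et k)) `<=` A.
  apply: contrapT => nk.
  have [||sigma [os sf mv]] := @movable (HH `\` A).
  - by apply: small_sub sHH => x [].
  - by move=> x [].
  have [tau ht ex] := hext os.1.
  have [tau' [ht' tt' tt]] := aut_inverse ht.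
  have [gE' n'E'] := good_aut os sf ht ex tt' tt ht' gE En.
  have [EE1 /(_ n'E') EE2] := Emin _ gE'.
  have /(germE _ _ _ os ht ex ht' tt' tt)/(epsP _ (extends_over ht ex os))[k0 k0P] :
      in_type p (same_fibre E tau').
    apply: (in_type_mono pc (in_typeI pc EE1 EE2)) => [a [s1 s2] y|]; first by split;
        [exact: s1|exact: s2].
    by apply: (dsame (fun t => E (famcomp tau' t))); apply: (dfn_mono _ (dfn_image ht ht' tt dE)).
  apply: nk; exists k0 => k /k0P /(fix_eps (exist _ _ (epsDe k)) _ _ os.1 ht ex) fk x xk.
  apply: contrapT => nA; apply: (mv x); last exact: fk.
  by split=> //; exists (exist _ _ (epsDe k)).
move=> sigma tau tau' os ht ex ht' tt' tt.
apply/(germE _ _ _ os ht ex ht' tt' tt)/(epsP _ (extends_over ht ex os)).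
exists k0 => k /k0P kA; apply/(fix_eps (exist _ _ (epsDe k)) _ _ os.1 ht ex) => x xk.
by apply: os.2; exact: kA.
Qed.

(** At a generic point, all the conjugates of [f] over [A] take their values in the
    same fibre of [E], which has at most [n] elements.  The conjugate of [f] by
    [sigma k] is written by means of the inverse [tau k] of [sigma k]. *)
Lemma conjugates_meet : exists n, forall sigma tau : nat -> fammap M M,
  (forall k, automorphism_over A (sigma k)) ->
  (forall k, famcomp (sigma k) (tau k) = @famid S M) ->
  exists j k t, [/\ (j < k)%N, (k <= n)%N, f (famcomp (tau j) t) & f (famcomp (tau k) t)].
Proof.
have [E [n [[dE [U [W [dU pU dW Wc HE]]]] En canon]]] := canonical_good.
exists n => sigma tau os st.
have ts k : famcomp (tau k) (sigma k) = @famid S M.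
  have [[inj _ _] _] := (os k).1; apply: famext => s' x; apply: inj.
  exact: (congr1 (fun q : fammap M M => q s' (sigma k s' x)) (st k)).
have lift_k k : exists rho rho' : fammap Mt Mt, [/\ automorphism rho, automorphism rho',
    extends (sigma k) rho, extends (tau k) rho' & famcomp rho' rho = @famid S Mt /\ famcomp
        rho rho' = @famid S Mt].
  have [rho hr ex] := hext (os k).1; have [rho' [hr' rr' rr]] := aut_inverse hr.
  exists rho, rho'; split=> //; exact: extends_inverse ex (st k) rr'.
pose rho k := sval (cid (lift_k k)).
pose rho' k := sval (cid (svalP (cid (lift_k k)))).
have rhoP k : [/\ automorphism (rho k), automorphism (rho' k),
    extends (sigma k) (rho k), extends (tau k) (rho' k) &
    famcomp (rho' k) (rho k) = @famid S Mt /\ famcomp (rho k) (rho' k) = @famid S Mt].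
  exact: svalP (cid (svalP (cid (lift_k k)))).
have to_range k B V (P : set (fammap V Mt)) : B `<=` range (elt_map h) -> dfn B P ->
    dfn (range (elt_map h)) (fun r => P (famcomp (rho' k) r)).
  have [hr hr' ex ex' [rr' rr]] := rhoP k.
  move=> Bh dP; apply: dfn_mono (dfn_image hr hr' rr dP).
  by move=> _ [x /Bh Bx <-]; rewrite -(extends_range (os k).1 ex); exists x.
pose V k a := U (rho' k s a) /\ same_fibre E (rho' k) a.
have dV k : dfn1 (range (elt_map h)) (V k) /\ in_type p (V k).
  have [hr hr' ex ex' [rr' rr]] := rhoP k; split.
    apply: dfn_and; first exact: (to_range k _ _ _ (@subset_refl _ _) dU).
    apply: dfn_allT; apply: dfn_iff.
      by apply: (dfn_subst dE); apply: subs_tcons => [|s' v]; exact: sube_var.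
    apply: (dfn_subst (to_range k _ _ _ (@subset_refl _ _) dE)).
    by apply: subs_tcons => [|s' v]; exact: sube_var.
  apply: in_typeI => //; first exact: in_type_aut inv (extends_over hr ex (os k)) rr' rr pU.
  exact: canon (os k) hr ex hr' rr' rr.
have [dVm pVm] : dfn1 (range (elt_map h)) (fun a => forall k, (k <= n)%N -> V k a) /\
    in_type p (fun a => forall k, (k <= n)%N -> V k a).
  elim: (n) => [|m [dm pm]].
    have E0 : V 0%N = (fun a => forall k, (k <= 0)%N -> V k a).
      apply/funext => a; apply/propext; split=> [H k|]; last exact.
      by rewrite leqn0 => /eqP ->.
    by rewrite -E0; exact: dV.
  have Em : (fun a => (forall k, (k <= m)%N -> V k a) /\ V m.+1 a) =
      (fun a => forall k, (k <= m.+1)%N -> V k a).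
    apply/funext => a; apply/propext; split=> [[H H'] k|H].
      by rewrite leq_eqVlt => /orP[/eqP -> //|]; exact: H.
    by split=> [k km|]; apply: H => //; exact: leqW.
  have [dk pk] := dV m.+1.
  by rewrite -Em; split; [exact: dfn_and|exact: in_typeI].
have [d [[Hn HV] [Wd W0d]]] := generic_pair (dfn_and (dfn1_le_card n dE) dVm)
   (in_typeI pc En pVm) (W := fun a => W a /\ W0 a) (dfn_and dW dW0) (conj Wc W0c).
have moveW k (P : set (M s)) : dfn1 A P -> P d -> P (tau k s d).
  move=> dP Pd; apply/(dfn_aut (P := fun r : tup M [:: s] => P (r s new)) (tup1 (tau k s
      d)) (os k) dP).
  rewrite /famcomp /= -[sigma k s _]/(@famcomp _ _ _ _ (sigma k) (tau k) s d).
  by rewrite st.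
have Hy k : exists y, f (tcons (tau k s d) y) by apply: W0f; exact: moveW.
pose y k := sval (cid (Hy k)).
have fy k : f (tcons (tau k s d) (y k)) by exact: svalP (cid (Hy k)).
pose t k := tcons d (famcomp (sigma k) (y k)).
have tt k : famcomp (tau k) (t k) = tcons (tau k s d) (y k).
  by rewrite /t famcomp_tcons famcompA ts.
have Et k : (k <= n)%N -> E (famcomp h (t k)).
  move=> kn; have [hr hr' ex ex' _] := rhoP k; have [Uk sk] := HV k kn.
  have exE V0 (r : fammap V0 M) : famcomp (rho' k) (famcomp h r) = famcomp h (famcomp (tau k) r).
    by rewrite famcompA ex'.
  rewrite /t famcomp_tcons; apply/sk.
  rewrite -famcomp_tcons exE -/(t k) tt; apply: HE.
  - have e : rho' k s (@h s d) = @h s (tau k s d).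
      exact: (congr1 (fun q : fammap M Mt => q s d) ex').
    by move: Uk; rewrite e.
  - exact: moveW.
  - exact: fy.
have [k kn|j [k [jk kn e]]] := le_card_distinct (f := fun k => famcomp h (famcomp (sigma k)
    (y k))) Hn.
  by have := Et k kn; rewrite /t famcomp_tcons.
exists j, k, (t j); split=> //; first by rewrite tt.
have -> : t j = t k.
  congr tcons; apply: famext => s' v.
  have [h_inj _ _] := hh; apply: (h_inj s').
  exact: (congr1 (fun q : tup Mt Lambda => q s' v) e).
by rewrite tt.
Qed.

End Generic.

(** * Codes in M *)

Lemma finite_bigvar T (S : Type) (Gamma : seq S) (F : forall s, var Gamma s -> set T) :
  (forall s v, finite_set (F s v)) -> finite_set [set x | exists s v, F s v x].
Proof.
elim: Gamma F => [|s Gamma IH] F fF.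
  by apply: (@sub_finite_set _ _ set0) => // x [s []].
apply: (@sub_finite_set _ _ (F s new `|` [set x | exists s' v, F s' (old v) x])).
  move=> x [s' [v]]; case: v => [|s'' v] Fx; first by left.
  by right; exists s'', v.
by rewrite finite_setU; split=> //; apply: (IH (fun s' v => F s' (old v))).
Qed.

Lemma dcl_fixed (S : Type) (L : language S) (M : structure L) (B : set (elt M)) e sigma :
  automorphism_over B sigma -> dcl B e -> fixes sigma e.
Proof.
case: e => s a os /definable_dfn dB; apply/fixesE.
have : famcomp sigma (tup1 a) = tup1 a by apply/(dfn_aut (tup1 a) os dB).
by move=> /(congr1 (fun t : tup M [:: s] => t s new)).
Qed.

(** The image of [O] in [Mt] has a code there.  Its coordinates belong to the
    definable closure of the image of [M], so the automorphisms coming from [M] act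
    on them as on tuples of [M]. *)
Lemma finite_coded (S : Type) (Lt L : language S) (i : sublanguage Lt L)
  (Tt : set (sentence Lt)) (hEI : eliminates_imaginaries Tt)
  (M : structure L) (Mt : structure Lt) (hMt : models Mt Tt)
  (h : fammap M Mt) (hh : embedding (M := reduct i M) h)
  (hext : forall sigma, automorphism sigma ->
    exists2 tau : fammap Mt Mt, automorphism tau & extends h sigma tau)
  (internal : forall eps : elt Mt, dcl (range (elt_map h)) eps ->
    exists (Gamma : seq S) (eta : tup M Gamma),
    forall tau : fammap Mt Mt, automorphism tau ->
    elt_map tau @` range (elt_map h) = range (elt_map h) ->
    (fixes tau eps <-> famcomp tau (famcomp h eta) = famcomp h eta))
  Gamma (O : set (tup M Gamma)) : finite_set O ->
  exists H : set (elt M), finite_set H /\ forall sigma : fammap M M, automorphism sigma ->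
    stab sigma O <-> forall e, H e -> fixes sigma e.
Proof.
move=> fO; have [h_inj _ _] := hh.
pose hO : set (tup Mt Gamma) := (fun t => famcomp h t) @` O.
have dhO : dfn (range (elt_map h)) hO.
  apply: finite_dfn; first exact: finite_image.
  by move=> _ [t Ot <-] [s x] [v /= <-]; exists (Tagged M (t s v)).
have [Delta [b code_b]] : coded hO.
  by apply: (hEI _ hMt); apply/definable_dfn; exact: dfn_mono dhO.
have bdcl s (v : var Delta s) : dcl (range (elt_map h)) (Tagged Mt (b s v)).
  have [R [hOR uR]] := code_b; apply/definable_dfn.
  apply: (dfn_ext (P := fun x : tup Mt [:: s] => exists z : tup Mt Delta,
      (forall t, hO t <-> sat (famcase t z) R) /\ x s new = z s v)).
    move=> x; split=> [[z [Hz xz]]|->]; last first.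
      by exists b; split=> // t; rewrite {1}hOR.
    have zb : z = b.
      apply: contrapT => nz; apply: (uR z); first by move=> e; apply: nz.
      by rewrite -hOR; apply/seteqP; split=> t /Hz.
    rewrite /= [LHS]tup_eta xz zb; congr tcons.
    by apply: famext => s' [].
  apply: dfn_exT; apply: dfn_and; last by apply: dfn_eq; exact: sube_var.
  apply: dfn_allT; apply: dfn_iff.
    by apply: (dfn_subst dhO) => s' w; exact: sube_var.
  by apply: dfn_sat; apply: subs_case => s' w; exact: sube_var.
have etaP s (v : var Delta s) : exists eta : {Gamma : seq S & tup M Gamma},
    forall tau : fammap Mt Mt, automorphism tau ->
    elt_map tau @` range (elt_map h) = range (elt_map h) ->
    (fixes tau (Tagged Mt (b s v)) <-> famcomp tau (famcomp h (tagged eta)) = famcomp h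
        (tagged eta)).
  have [Gamma' [eta H]] := internal _ (bdcl s v).
  by exists (existT (fun Gamma => tup M Gamma) Gamma' eta).
pose eta s v := sval (cid (etaP s v)).
exists [set x | exists s v, tup_elts (tagged (eta s v)) x]; split.
  by apply: finite_bigvar => s v; exact: finite_tup.
move=> sigma hs; have [tau ht ex] := hext _ hs.
have hE (V : S -> Type) (x : fammap V M) : famcomp tau (famcomp h x) = famcomp h (famcomp
    sigma x).
  by rewrite famcompA ex.
have hI (V : S -> Type) (x y : fammap V M) : famcomp h x = famcomp h y -> x = y.
  move=> e; apply: famext => s v; apply: (h_inj s).
  exact: (congr1 (fun k : fammap V Mt => k s v) e).
have imE : stab sigma O <-> stab tau hO.
  rewrite (stab_image _ hs) (stab_image _ ht); split=> [e|e].
    rewrite /hO -{2}e; apply/seteqP; split=> [_ [_ [t Ot <-] <-]|_ [_ [t Ot <-] <-]].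
      by rewrite hE; exists (famcomp sigma t) => //; exists t.
    by rewrite -hE; exists (famcomp h t) => //; exists t.
  apply/seteqP; split=> [_ [t Ot <-]|t Ot].
    have : hO (famcomp tau (famcomp h t)) by rewrite -e; exists (famcomp h t) => //; exists t.
    by rewrite hE => -[t' Ot' /hI <-].
  have : hO (famcomp h t) by exists t.
  by rewrite -{1}e => -[_ [t' Ot' <-]]; rewrite hE => /hI <-; exists t'.
rewrite imE (code_stab code_b ht) -fixes_tup.
have fixE s (v : var Delta s) : fixes tau (Tagged Mt (b s v)) <->
    forall x, tup_elts (tagged (eta s v)) x -> fixes sigma x.
  rewrite (svalP (cid (etaP s v)) tau ht (extends_range hs ex)) fixes_tup -/(eta s v).
  by rewrite hE; split=> [/hI//|->].
split=> [H x [s [v xv]]|H [s x] [v /= <-]].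
  by have /fixE := H (Tagged Mt (b s v)) (ex_intro _ v erefl); apply.
by apply/fixE => x' xv; apply: H; exists s, v.
Qed.

Section Main.
Variables (S : Type) (Lt L : language S) (i : sublanguage Lt L).
Variables (Tt : set (sentence Lt)) (D : set S).
Hypotheses (hQE : eliminates_quantifiers Tt) (hEI : eliminates_imaginaries Tt).
Variables (M : structure L) (hsat : saturated M) (hhom : homogeneous M).
Variables (Mt : structure Lt) (hMt : models Mt Tt).
Variables (h : fammap M Mt) (hh : embedding (M := reduct i M) h).
Hypothesis hext : forall sigma, automorphism sigma ->
  exists2 tau : fammap Mt Mt, automorphism tau & extends h sigma tau.
Hypothesis h1 : forall (s : S) (c : M s), D s ->
  forall (M' : structure L) (j : fammap M' M), elementary_embedding j ->
  elt_map h @` dcl (range (elt_map j) `|` [set Tagged M c]) `<=`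
  acl (elt_map h @` (range (elt_map j) `|` [set Tagged M c])).
Hypothesis h2 : forall eps : elt Mt, dcl (range (elt_map h)) eps ->
  exists (Gamma : seq S) (eta : tup M Gamma),
  forall tau : fammap Mt Mt, automorphism tau ->
  elt_map tau @` range (elt_map h) = range (elt_map h) ->
  (fixes tau eps <-> famcomp tau (famcomp h eta) = famcomp h eta).
Hypothesis h3 : forall (s : S), D s ->
  forall X : set (tup M [:: s]), definable setT X -> coded X.
Hypothesis h4 : forall A : set (elt M), A = acl A -> forall (s : S) (c : M s), D s ->
  exists p : set (formula Lt (bind Mt s)),
  [/\ complete_type p, invariant_type (elt_map h @` A) p, consistent_with_tp h p A c
    & forall (Gamma : seq S) (r : set (tup Mt (s :: Gamma))),
      definable_function r -> in_type p (domain r) ->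
      forall (Delta : seq S) (b : tup Mt Delta), is_code r b ->
      exists (I : Type) (le : I -> I -> Prop) (eps : I -> elt Mt),
      [/\ directed_order le,
          forall k, dcl (elt_map h @` A `|` tup_elts b) (eps k)
        & forall sigma, automorphism_over (elt_map h @` A) sigma ->
          (fixes_germ p r sigma <->
           exists k0, forall k, le k0 k -> fixes sigma (eps k))]].
Hypothesis h5 : forall A : set (elt M), A = acl A -> forall (s : S) (c : M s), D s ->
  acl (A `|` [set Tagged M c]) `<=` dcl (A `|` [set Tagged M c]).

Local Notation small A := (A #<= [set: symbols L]).

(** The induction moves the parameters of [X] one by one into the set [A0] of
    constants.  For the first parameter [c], induction provides a tuple [eta] that
    codes [X] over [A0] and [c], and [f] is the function that sends [c] to [eta]: two
    conjugates of [f] that agree at one point come from the same conjugate of [X].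
    So [conjugates_meet] bounds the number of conjugates of [eta] over [A] and [c],
    where [A] is the real algebraic closure of [X] over [A0].  Weak rigidity then
    makes [X] definable over [A] and [c], and [coded_dfn_real_acl], applied to the
    set of points that define [X] in the way [c] does, makes it definable over [A].
    It only remains to code the finite set of conjugates of the parameters. *)
Lemma coded_over Gamma : (forall s, var Gamma s -> D s) ->
  forall (A0 : set (elt M)), small A0 -> forall (b : tup M Gamma)
    Xi (X : set (tup M Xi)), dfn (A0 `|` tup_elts b) X ->
  exists H : set (elt M), finite_set H /\
    forall sigma, automorphism_over A0 sigma ->
      stab sigma X <-> forall e, H e -> fixes sigma e.
Proof.
elim: Gamma => [|s Gamma IH] GD A0 sA0 b Xi X dX.
  exists set0; split=> // sigma os; split=> // _ x; apply: dfn_aut os _.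
  by apply: dfn_mono dX => e [//|[[]]].
have Ds : D s by apply: GD; exact: new.
have dXT : dfn setT X by exact: dfn_mono dX.
pose c := b s new; pose b' : tup M Gamma := fun s' v => b s' (old v).
pose A1 := A0 `|` [set Tagged M c].
have sA1 : small A1 by apply: smallU => //; exact: small1.
have [||H1 [fH1 H1X]] := IH _ A1 sA1 b' Xi X.
- by move=> s' v; apply: GD; exact: old.
- apply: dfn_mono dX => -[s' x] [A0x|[/= v vx]]; first by left; left.
  rewrite -vx; case: v {vx} => [|s'' v]; first by left; right.
  by right; exists v.
have [l lH1] := finite_seq_ex fH1; have [Lambda [eta etal]] := tup_of_seq l.
have etaX sigma : automorphism_over A1 sigma -> stab sigma X <-> famcomp sigma eta = eta.
  move=> os; rewrite (H1X _ os) -fixes_tup.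
  by split=> H e He; apply: H; [apply/lH1/etal|apply/etal/lH1].
pose zeta : tup M (s :: Lambda) := tcons c eta.
have over1 sigma : automorphism_over A0 sigma -> sigma s c = c -> automorphism_over A1 sigma.
  move=> [hs os] sc; split=> // e [/os//|->]; exact/fixesE.
have [|sigma os sz|sigma os sX /= sc|R [theta [dR dtheta XR tz zuniq]]] :=
  @code_formula _ _ _ hsat hhom A0 _ _ X zeta (fun z => z s new = c) sA0 dXT.
- by apply: dfn_eq; [exact: sube_var|exact: sube_par].
- rewrite /zeta famcomp_tcons in sz; have [sc se] := tcons_inj sz.
  by apply/etaX => //; exact: over1.
- rewrite /zeta famcomp_tcons; have se : famcomp sigma eta = eta.
    by apply/etaX => //; exact: over1.
  by congr tcons => //; exact: sc.
(* [f] maps [x] to the tuple that codes [X] together with [x], when there is exactly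
   one. *)
pose Phi (t : tup M (s :: Lambda)) := theta t /\ forall x, X x <-> R (famcase x t).
pose f (t : tup M (s :: Lambda)) := Phi t /\
  forall y, Phi (tcons (t s new) y) -> (fun s' v => t s' (old v)) = y.
have dPhi : dfn setT Phi.
  apply: dfn_and; first exact: dfn_mono dtheta.
  apply: dfn_allT; apply: dfn_iff.
    by apply: (dfn_subst dXT) => s' v; exact: sube_var.
  by apply: (dfn_subst (dfn_mono _ dR)) => //; apply: subs_case => s' v; exact: sube_var.
have df : dfn setT f.
  apply: dfn_and => //; apply: dfn_allT; apply: dfn_imp.
    by apply: (dfn_subst dPhi); apply: subs_tcons => [|s' v]; exact: sube_var.
  by apply: dfn_eqT => s' v; exact: sube_var.
have ff a y y' : f (tcons a y) -> f (tcons a y') -> y = y'.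
  by move=> [_ H] [Py' _]; exact: (H y').
have fz : f zeta.
  split=> [|y [ty Xy]]; first by split.
  by have [_ ->] := tcons_inj (zuniq (tcons c y) erefl ty Xy).
have PhiS sigma t : automorphism_over A0 sigma -> stab sigma X -> Phi (famcomp sigma t) <-> Phi t.
  move=> os sX; have [sigma' [os' s's ss']] := over_inverse os.
  have E x : R (famcase (famcomp sigma x) (famcomp sigma t)) <-> R (famcase x t).
    by rewrite -famcomp_case; exact: dfn_aut os dR.
  have Et := dfn_aut t os dtheta.
  split=> -[tt Xt].
    by split=> [|x]; [exact/Et|rewrite -sX Xt E].
  split=> [|x]; first exact/Et.
  have -> : x = famcomp sigma (famcomp sigma' x) by rewrite famcompA ss'.
  by rewrite sX Xt E.
have fS sigma : automorphism_over A0 sigma -> stab sigma X -> stab sigma f.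
  move=> os sX t; have [sigma' [os' s's ss']] := over_inverse os.
  have PS := PhiS _ _ os sX.
  have sK y : famcomp sigma (famcomp sigma' y) = y :> tup M Lambda by rewrite famcompA ss'.
  have Ks y : famcomp sigma' (famcomp sigma y) = y :> tup M Lambda by rewrite famcompA s's.
  split=> -[Pt Ut]; split; try exact/PS.
    move=> y Py; have e : famcomp sigma (fun s' v => t s' (old v)) = famcomp sigma y.
      by apply: Ut; have /PS := Py; rewrite famcomp_tcons.
    by have := congr1 (famcomp sigma') e; rewrite !Ks.
  move=> y Py; have e : (fun s' v => t s' (old v)) = famcomp sigma' y.
    by apply: Ut; apply/PS; rewrite famcomp_tcons sK.
  by rewrite -(sK y) -e.
pose A := real_acl A0 X.
have sA : small A by exact: real_acl_small.
have aclA : A = acl A by exact: real_acl_closed.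
have A0A : A0 `<=` A by exact: real_acl_base.
have A0over sigma : automorphism_over A sigma -> automorphism_over A0 sigma by exact: over_mono.
have unary (Y : set (tup M [:: s])) : dfn setT Y ->
    (forall sigma, automorphism_over A sigma -> stab sigma X -> stab sigma Y) -> dfn A Y.
  move=> dY HY; apply: coded_dfn_real_acl => //.
  by apply: h3 => //; exact/definable_dfn.
have [p [pc pinv pcons germs]] := h4 aclA c Ds.
pose W0 a := exists y, f (tcons a y).
have dW0 : dfn1 A W0.
  apply: unary.
    apply: dfn_exT; apply: (dfn_subst df); apply: subs_tcons => [|s' v]; exact: sube_var.
  move=> sigma os sX r; have sf := fS _ (A0over _ os) sX.
  have [sigma' [os' s's ss']] := over_inverse os.
  split=> -[y fy].
    exists (famcomp sigma' y); apply/sf; rewrite famcomp_tcons.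
    by rewrite famcompA ss'.
  by exists (famcomp sigma y); have /sf := fy; rewrite famcomp_tcons.
have movable (H : set (elt M)) : small H -> (forall e, H e -> ~ A e) -> exists sigma,
    [/\ automorphism_over A sigma, stab sigma f & forall e, H e -> ~ fixes sigma e].
  move=> sH HA; have [sigma [os sX mv]] := move_outside hsat hhom sA0 dXT sH HA.
  by exists sigma; split=> //; apply: fS => //; exact: A0over.
have W0c : W0 c by exists eta.
have [n meet] := conjugates_meet hQE hsat hMt hh sA pc pcons df ff dW0 W0c (fun a H => H)
  (fun c' => @h1 s c' Ds) pinv hEI hext h2 germs movable.
have over_c B sigma : B `<=` A -> automorphism_over (A `|` [set Tagged M c]) sigma ->
    automorphism_over (B `|` [set Tagged M c]) sigma.
  by move=> BA; apply: over_mono => e [/BA|]; [left|right].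
have sAc : small (A `|` [set Tagged M c]) by apply: smallU => //; exact: small1.
(* [eta] has finitely many conjugates over [A] and [c], hence is fixed. *)
have eta_fixed sigma : automorphism_over (A `|` [set Tagged M c]) sigma ->
    famcomp sigma eta = eta.
  move=> os; apply: famext => s' v; apply/fixesE; apply: (dcl_fixed os).
  apply: h5 => //; apply: (acl_of_finite_orbit hsat hhom) => //.
  set O := [set _ | _]; apply/finite_le_card; exists n; apply: contrapT.
  move=> /not_le_card[g [gO ginj]].
  have Hk k : exists rho, automorphism_over (A `|` [set Tagged M c]) rho /\
      ((k <= n)%N -> rho s' (eta s' v) = g k).
    case: (leqP k n) => kn; last by exists (@famid S M); split=> //; exact: over_id.
    by have [rho orho e] := gO k kn; exists rho.
  pose rho k := sval (cid (Hk k)).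
  have rhoP k : automorphism_over (A `|` [set Tagged M c]) (rho k) /\
      ((k <= n)%N -> rho k s' (eta s' v) = g k) by exact: svalP (cid (Hk k)).
  pose rho' k := sval (cid (over_inverse (rhoP k).1)).
  have rho'P k : [/\ automorphism_over (A `|` [set Tagged M c]) (rho' k),
     famcomp (rho' k) (rho k) = @famid S M & famcomp (rho k) (rho' k) = @famid S M].
    exact: svalP (cid (over_inverse (rhoP k).1)).
  have rA k : automorphism_over A (rho k) by apply: over_mono (rhoP k).1 => e; left.
  have [j [k [t [jk kn fj fk]]]] := meet rho rho' rA (fun k => let: And3 _ _ e := rho'P k in e).
  apply: (ginj j k jk kn).
  have RE m x : f (famcomp (rho' m) t) -> X (famcomp (rho' m) x) <-> R (famcase x t).
    move=> [[_ ->] _]; rewrite -famcomp_case; apply: dfn_aut dR.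
    by have [om _ _] := rho'P m; apply: A0over; apply: over_mono om => e; left.
  have ojk : automorphism_over (A `|` [set Tagged M c]) (famcomp (rho' j) (rho k)).
    by apply: over_comp; [have [] := rho'P j|exact: (rhoP k).1].
  have stX : stab (famcomp (rho' j) (rho k)) X.
    move=> x; have [_ rr _] := rho'P k.
    by rewrite -famcompA (RE j) // -(RE k) // famcompA rr.
  have /(etaX _ (over_c _ _ A0A ojk)) := stX.
  move=> /(congr1 (famcomp (rho j))); have [_ _ rj] := rho'P j.
  rewrite -famcompA famcompA rj => /(congr1 (fun q : tup M Lambda => q s' v)).
  rewrite /famcomp /famid (rhoP k).2 // (rhoP j).2 //.
  exact: leq_trans (ltnW jk) kn.
have XAc : dfn (A `|` tup_elts (tup1 c)) X.
  apply: (@dfn_mono _ _ _ (A `|` [set Tagged M c])).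
    by move=> e [Ae|->]; [left|right; exists new].
  apply: (invariant_dfn hsat hhom) => //; first exact: small_var.
  by move=> sigma os; apply/(etaX _ (over_c _ _ A0A os)); exact: eta_fixed.
have [psi dpsi Xpsi] := dfn_split XAc.
have dY : dfn A (fun r : tup M [:: s] => forall x, X x <-> psi (famcase x r)).
  apply: unary.
    apply: dfn_allT; apply: dfn_iff.
      by apply: (dfn_subst dXT) => s' v; exact: sube_var.
    by apply: (dfn_subst (dfn_mono _ dpsi)) => //; apply: subs_case => s' v; exact: sube_var.
  move=> sigma os sX r; have [sigma' [os' s's ss']] := over_inverse os.
  have E x : psi (famcase (famcomp sigma x) (famcomp sigma r)) <-> psi (famcase x r).
    by rewrite -famcomp_case; exact: dfn_aut os dpsi.
  split=> H x; first by rewrite -sX H E.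
  have -> : x = famcomp sigma (famcomp sigma' x) by rewrite famcompA ss'.
  by rewrite sX H E.
have XA : dfn A X.
  apply: (invariant_dfn hsat hhom) => //; first exact: small_var.
  move=> sigma os x.
  have /(dfn_aut (tup1 c) os dY) -> : forall x, X x <-> psi (famcase x (tup1 c)) by exact: Xpsi.
  by rewrite Xpsi -famcomp_case; exact: dfn_aut os dpsi.
(* A code of the finite set of conjugates of a tuple of [A] defining [X]. *)
have [Delta [a [Q [aA dQ XQ]]]] := dfn_tups XA.
have QE (sigma : fammap M M) x y : automorphism sigma ->
    Q (famcase (famcomp sigma x) (famcomp sigma y)) <-> Q (famcase x y).
  by move=> hs; rewrite -famcomp_case; apply: dfn_aut dQ; split.
pose O : set (tup M Delta) := [set t | exists sigma,
  [/\ automorphism_over A0 sigma, stab sigma X & famcomp sigma a = t]].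
have fO : finite_set O.
  apply: (@sub_finite_set _ _ [set t : tup M Delta | forall s' v,
      orbit (stabilizer A0 X) (Tagged M (a s' v)) (Tagged M (t s' v))]).
    move=> t [sigma [os sX <-]] s' v; exists (elt_map sigma) => //.
    by exists sigma.
  apply: (finite_product (X := fun s' v => [set x | orbit (stabilizer A0 X) (Tagged M (a s'
      v)) (Tagged M x)])).
  move=> s' v; apply: finite_fiber; apply: aA.
  by exists v.
have [H [fH HO]] := finite_coded hEI hMt hh hext h2 fO.
exists H; split=> // sigma os; rewrite -(HO _ os.1).
have [sigma' [os' s's ss']] := over_inverse os.
have sK (V : S -> Type) (x : fammap V M) : famcomp sigma (famcomp sigma' x) = x by rewrite
    famcompA ss'.
have Ks (V : S -> Type) (x : fammap V M) : famcomp sigma' (famcomp sigma x) = x by rewrite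
    famcompA s's.
split=> [sX t|sO x].
  have sX' : stab sigma' X by move=> x; rewrite -sX sK.
  split=> -[rho [orho rX e]].
    exists (famcomp sigma' rho); split; first exact: over_comp.
      by move=> x; rewrite -famcompA sX' rX.
    by rewrite -famcompA e Ks.
  exists (famcomp sigma rho); split; first exact: over_comp.
    by move=> x; rewrite -famcompA sX rX.
  by rewrite -famcompA e.
have [rho [orho rX e]] : O (famcomp sigma a).
  by apply/sO; exists (@famid S M); split=> //; exact: over_id.
have [rho' [orho' r'r rr']] := over_inverse orho.
have rK (y : tup M Xi) : famcomp rho (famcomp rho' y) = y by rewrite famcompA rr'.
rewrite (XQ x) -(QE _ _ _ os.1) -e -{1}(rK (famcomp sigma x)) rX XQ -(QE _ _ _ orho.1) rK.
exact: iff_refl.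
Qed.
End Main.

(** * From dominant sorts to all sorts, and from M to all models *)

(** The tuples of dominant elements that dominate the coordinates of [b] are put
    together by [support_merge], applied to the family of dominant elements. *)
Lemma dominant_tuple (S : Type) (L : language S) (T : set (sentence L)) (D : set S)
    (M : structure L) : dominant T D -> models M T ->
  forall Delta (b : tup M Delta), exists Gamma (x : tup M Gamma),
    (forall s, var Gamma s -> D s) /\ forall sigma : fammap M M, automorphism sigma ->
      famcomp sigma x = x -> famcomp sigma b = b.
Proof.
move=> hD hM; pose DM s := {a : M s | D s}.
suff H Delta (b : tup M Delta) : exists Gamma (g : fammap (var Gamma) DM),
    forall sigma : fammap M M, automorphism sigma ->
    famcomp sigma (fun s v => sval (g s v)) = (fun s v => sval (g s v)) -> famcomp sigma b = b.
  move=> Delta b; have [Gamma [g Hg]] := H Delta b.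
  exists Gamma, (fun s v => sval (g s v)); split=> // s v; exact: svalP (g s v).
elim: Delta b => [|s Delta IH] b.
  exists [::], (fun s (v : void) => match v with end) => sigma _ _.
  by apply: famext => s [].
have [G2 [g2 H2]] := IH (fun s' v => b s' (old v)).
have [G1 G1D [phi phiP]] := hD s; have [fun_phi surj] := phiP M hM.
have [x1 satx1] := surj (b s new).
pose g1 : fammap (var G1) DM := fun s' v => exist _ (x1 s' v) (G1D s' v).
have [G [g [u1 [u2 [e1 e2]]]]] := support_merge g1 g2.
exists G, g => sigma hs fg.
have fix1 : famcomp sigma x1 = x1.
  apply: famext => s' v; rewrite /famcomp.
  have -> : x1 s' v = sval (g s' (u1 s' v)).
    by rewrite -[g s' _]/(@famcomp _ _ _ _ g u1 s' v) -e1.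
  exact: (congr1 (fun k : tup M G => k s' (u1 s' v)) fg).
have fix2 : famcomp sigma (fun s' v => b s' (old v)) = (fun s' v => b s' (old v)).
  apply: H2 => //; rewrite e2; apply: famext => s' v.
  exact: (congr1 (fun k : tup M G => k s' (u2 s' v)) fg).
apply: famext => s' [|s'' v].
  apply: (fun_phi x1) => //; by rewrite /famcomp -fix1 -famcomp_bindenv aut_sat.
exact: (congr1 (fun k : tup M Delta => k s'' v) fix2).
Qed.

Section Transfer.
Variables (S : Type) (L : language S).

Lemma eqT_formula V Gamma (f g : fammap (var Gamma) V) : exists chi : formula L V,
  forall (M : structure L) (rho : fammap V M),
    sat rho chi <-> famcomp rho f = famcomp rho g.
Proof.
elim: Gamma f g => [|s Gamma IH] f g.
  by exists (Imp Fal Fal) => M rho /=; split=> // _; apply: famext => s [].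
have [chi chiP] := IH (fun s' v => f s' (old v)) (fun s' v => g s' (old v)).
exists (And (Eq (Var L (f s new)) (Var L (g s new))) chi) => M rho.
rewrite sat_And chiP /=; split=> [[e1 e2]|e].
  apply: famext => s' [//|s'' v].
  exact: (congr1 (fun k : tup M Gamma => k s'' v) e2).
split; first exact: (congr1 (fun k : tup M (s :: Gamma) => k s new) e).
apply: famext => s' v.
exact: (congr1 (fun k : tup M (s :: Gamma) => k s' (old v)) e).
Qed.

Definition coded_by Xi Delta Lambda (phi : formula L (famsum (var Xi) (var Delta)))
    (R : formula L (famsum (var Xi) (var Lambda))) (M : structure L) (b : tup M Delta) :=
  exists z : tup M Lambda, (forall x, sat (famcase x b) phi <-> sat (famcase x z) R) /\
    forall z', (forall x, sat (famcase x z) R <-> sat (famcase x z') R) -> z = z'.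

Definition Iff V (phi psi : formula L V) := And (Imp phi psi) (Imp psi phi).

Lemma sat_Iff (M : structure L) V (rho : fammap V M) phi psi :
  sat rho (Iff phi psi) = (sat rho phi <-> sat rho psi).
Proof. by rewrite /Iff sat_And. Qed.

Lemma coded_by_formula Xi Delta Lambda (phi : formula L (famsum (var Xi) (var Delta)))
    (R : formula L (famsum (var Xi) (var Lambda))) :
  exists chi : formula L (var Delta), forall (M : structure L) (b : tup M Delta),
    sat b chi <-> coded_by phi R b.
Proof.
have [eqz eqzP] := eqT_formula (V := famsum (famsum (var Delta) (var Lambda)) (var Lambda))
  (fun s v => inl (inr v)) (fun s v => inr v).
pose r1 : formula L (famsum (famsum (var Delta) (var Lambda)) (var Xi)) :=
  rename (famcase (fun s x => inr x) (fun s b => inl (inl b))) phi.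
pose r2 : formula L (famsum (famsum (var Delta) (var Lambda)) (var Xi)) :=
  rename (famcase (fun s x => inr x) (fun s b => inl (inr b))) R.
pose r3 : formula L (famsum (famsum (famsum (var Delta) (var Lambda)) (var Lambda)) (var Xi)) :=
  rename (famcase (fun s x => inr x) (fun s b => inl (inl (inr b)))) R.
pose r4 : formula L (famsum (famsum (famsum (var Delta) (var Lambda)) (var Lambda)) (var Xi)) :=
  rename (famcase (fun s x => inr x) (fun s b => inl (inr b))) R.
pose body := And (AllT (Iff r1 r2)) (AllT (Imp (AllT (Iff r3 r4)) eqz)).
exists (Neg (AllT (Neg body))) => M b.
have bodyP z : sat (famcase b z) body <->
    (forall x, sat (famcase x b) phi <-> sat (famcase x z) R) /\
    forall z', (forall x, sat (famcase x z) R <-> sat (famcase x z') R) -> z = z'.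
  rewrite sat_And !sat_AllT.
  have E1 x : sat (famcase (famcase b z) x) (Iff r1 r2) = (sat (famcase x b) phi <-> sat
      (famcase x z) R).
    rewrite sat_Iff !sat_rename; by congr iff; congr sat; apply: famext => s [].
  have E2 z' : sat (famcase (famcase b z) z') (Imp (AllT (Iff r3 r4)) eqz) =
      ((forall x, sat (famcase x z) R <-> sat (famcase x z') R) -> z = z').
    have E3 x : sat (famcase (famcase (famcase b z) z') x) (Iff r3 r4) =
       (sat (famcase x z) R <-> sat (famcase x z') R).
      by rewrite sat_Iff !sat_rename; congr iff; congr sat; apply: famext => s [].
    apply/propext; rewrite /= sat_AllT eqzP.
    by split=> H Hx; apply: H => x; [rewrite E3|rewrite -E3].
  split=> -[H1 H2]; split=> [x|z'].
  - by rewrite -E1.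
  - by rewrite -E2.
  - by rewrite E1.
  - by rewrite E2; exact: H2.
rewrite sat_Neg sat_AllT; split=> [/existsNP[z /contrapT/bodyP Hz]|[z Hz] /(_ z)].
  by exists z.
by apply; apply/bodyP.
Qed.

(** By compactness, finitely many formulas [R] suffice to code all the sets defined
    by [phi] in [M], and this is expressed by a sentence. *)
Lemma eliminates_imaginaries_transfer (T : set (sentence L)) (M : structure L) :
  complete_theory T -> models M T -> saturated M ->
  (forall Gamma (X : set (tup M Gamma)), definable setT X -> coded X) ->
  eliminates_imaginaries T.
Proof.
move=> hT hM hsat Mcoded N hN Xi X [Delta [phi [b [_ ->]]]].
pose form := {Lambda : seq S & formula L (famsum (var Xi) (var Lambda))}.
pose chi (R : form) := sval (cid (coded_by_formula phi (tagged R))).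
have chiP (R : form) (M' : structure L) (b' : tup M' Delta) : sat b' (chi R) <-> coded_by
    phi (tagged R) b'.
  exact: svalP (cid (coded_by_formula phi (tagged R))) M' b'.
have coded_byP (M' : structure L) (b' : tup M' Delta) : coded (defset phi b') <->
    exists R : form, coded_by phi (tagged R) b'.
  split=> [[Lambda [z [R [e u]]]]|[[Lambda R] [z [/= H1 H2]]]].
    exists (existT (fun Lambda => formula L (famsum (var Xi) (var Lambda))) Lambda R), z;
        split=> [x|z' Hz'] /=.
      by rewrite -[sat _ phi]/(defset phi b' x) e.
    by apply: contrapT => /u; apply; apply/seteqP; split=> x /Hz'.
  exists Lambda, z, R; split; first by apply/seteqP; split=> x /H1.
  by move=> z' nz e; apply: nz; apply: H2 => x; rewrite -[sat _ R]/(defset R z x) e.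
have [l lP] : exists l : seq form, forall b' : tup M Delta, exists R, List.In R l /\
    coded_by phi (tagged R) b'.
  apply: contrapT => nl.
  pose PP : set (set (tup M Delta)) := [set P | exists l : seq form,
    P = fun b' => forall R, List.In R l -> ~ sat b' (chi R)].
  have [P [l ->]|||P [l ->]|b' Hb'] := compactness hsat (A := set0) (PP := PP)
      (small0 L _) (small_var L Delta).
  - elim: l => [|R l IH]; first by apply: (dfn_ext _ (dfn_cst _ _ True)) => r; split=> // _ R [].
    apply: (dfn_ext (P := fun r => ~ sat r (chi R) /\ forall R, List.In R l -> ~ sat r (chi R))).
      move=> r; split=> [[nR H] R' [<-//|]|H]; first exact: H.
      by split=> [|R' R'l]; apply: H; [left|right].
    apply: dfn_and => //; apply: dfn_not; apply: dfn_sat; exact: subs_id.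
  - by exists (fun b' => forall R, List.In R [::] -> ~ sat b' (chi R)), [::].
  - move=> _ _ [l ->] [l' ->].
    exists (fun b' => forall R, List.In R (l ++ l') -> ~ sat b' (chi R)); first by exists
        (l ++ l').
    by move=> r H; split=> R Rl; apply: H; apply/List.in_or_app; [left|right].
  - apply: contrapT => nP; apply: nl; exists l => b'; apply: contrapT => nR.
    by apply: nP; exists b' => R Rl /chiP HR; apply: nR; exists R.
  have [|R HR] := (coded_byP M b').1.
    apply: Mcoded; exists Delta, phi, b'; split=> //.
  have nR : forall R', List.In R' [:: R] -> ~ sat b' (chi R').
    by apply: (Hb' (fun b' => forall R', List.In R' [:: R] -> ~ sat b' (chi R'))); exists [:: R].
  by apply: (nR R); [left|exact/chiP].
pose disj : formula L (var Delta) := foldr (fun R psi => Or (chi R) psi) Fal l.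
have disjP (M' : structure L) (b' : tup M' Delta) : sat b' disj <-> exists R, List.In R l
    /\ coded_by phi (tagged R) b'.
  rewrite /disj; elim: (l) => [|R l' IH]; first by split=> //= -[R []].
  rewrite -[foldr _ _ _]/(Or (chi R) (foldr (fun R psi => Or (chi R) psi) Fal l')).
  rewrite sat_Or chiP IH; split=> [[HR|[R' [R'l H]]]|[R' [[<-|R'l] H]]].
  - by exists R; split=> //; left.
  - by exists R'; split=> //; right.
  - by left.
  - by right; exists R'.
pose sen : sentence L := AllT (rename (fun s v => inr v) disj : formula L (famsum (var
    [::]) (var Delta))).
have senP (M' : structure L) : holds M' sen <-> forall b' : tup M' Delta, sat b' disj.
  rewrite /holds /sen sat_AllT; split=> H b'; have := H b'; by rewrite sat_rename.
apply/coded_byP; have [R [_ HR]] : exists R, List.In R l /\ coded_by phi (tagged R) b; last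
    by exists R.
apply/disjP; move: b; apply/senP.
have [/(_ N hN)//|/(_ M hM)] := hT.2 sen.
by case; apply/senP => b'; exact/disjP.
Qed.

End Transfer.

Theorem corollary2p17 (S : Type) (Lt L : language S) (i : sublanguage Lt L)
  (Tt : set (sentence Lt)) (T : set (sentence L)) (D : set S)
  (hTt : complete_theory Tt)
  (hQE : eliminates_quantifiers Tt)
  (hEI : eliminates_imaginaries Tt)
  (hT : complete_theory T)
  (hD : dominant T D)
  (hTtT : contains_universal_part i Tt T)
  (M : structure L) (hM : models M T)
  (hsat : saturated M) (hhom : homogeneous M)
  (Mt : structure Lt) (hMt : models Mt Tt)
  (h : fammap M Mt) (hh : embedding (M := reduct i M) h)
  (hext : forall sigma : fammap M M, automorphism sigma ->
     exists2 tau : fammap Mt Mt, automorphism tau &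
     forall s (x : M s), tau s (h s x) = h s (sigma s x))
  (* (i) Relative algebraic boundedness *)
  (h1 : forall (s : S) (c : M s), D s ->
     forall (M' : structure L) (j : fammap M' M), elementary_embedding j ->
     let B := range (elt_map j) `|` [set Tagged M c] in
     elt_map h @` dcl B `<=` acl (elt_map h @` B))
  (* (ii) Internalizing codes *)
  (h2 : forall eps : elt Mt, dcl (range (elt_map h)) eps ->
     exists (Gamma : seq S) (eta : tup M Gamma),
     forall tau : fammap Mt Mt, automorphism tau ->
     elt_map tau @` range (elt_map h) = range (elt_map h) ->
     (fixes tau eps <-> famcomp tau (famcomp h eta) = famcomp h eta))
  (* (iii) Unary elimination of imaginaries *)
  (h3 : forall (s : S), D s ->
     forall X : set (tup M [:: s]), definable setT X -> coded X)
  (* (iv) Invariant types *)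
  (h4 : forall A : set (elt M), A = acl A -> forall (s : S) (c : M s), D s ->
     let At := elt_map h @` A in
     exists p : set (formula Lt (bind Mt s)),
     [/\ complete_type p, invariant_type At p, consistent_with_tp h p A c
       & forall (Gamma : seq S) (r : set (tup Mt (s :: Gamma))),
         definable_function r -> in_type p (domain r) ->
         forall (Delta : seq S) (b : tup Mt Delta), is_code r b ->
         exists (I : Type) (le : I -> I -> Prop) (eps : I -> elt Mt),
         [/\ directed_order le,
             forall k, dcl (At `|` tup_elts b) (eps k)
           & forall sigma, automorphism_over At sigma ->
             (fixes_germ p r sigma <->
              exists k0, forall k, le k0 k -> fixes sigma (eps k))]])
  (* (v) Weak rigidity *)
  (h5 : forall A : set (elt M), A = acl A -> forall (s : S) (c : M s), D s ->
     acl (A `|` [set Tagged M c]) `<=` dcl (A `|` [set Tagged M c])) :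
  eliminates_imaginaries T.
Proof.
have hext' sigma : automorphism sigma ->
    exists2 tau : fammap Mt Mt, automorphism tau & extends h sigma tau.
  by move=> /hext[tau ht e]; exists tau => //; apply: famext.
apply: (eliminates_imaginaries_transfer hT hM hsat) => Xi X /definable_dfn dX.
have [Delta [b [phi [_ Xphi]]]] := dfn_support dX.
have [Gamma [x [GD fix_x]]] := dominant_tuple hD hM b.
have dXx : dfn (set0 `|` tup_elts x) X.
  rewrite set0U; apply: (invariant_dfn hsat hhom) => //.
  - exact: small_tup.
  - exact: small_var.
  move=> sigma [hs fx] t; have sb := fix_x _ hs ((fixes_tup _ _).1 fx).
  by rewrite !Xphi -{1}sb -famcomp_case aut_sat.
have [H [fH HX]] := coded_over hQE hEI hsat hhom hMt hh hext' h1 h2 h3 h4 h5 GD (small0 L _) dXx.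
have [l lH] := finite_seq_ex fH; have [Lambda [eta etal]] := tup_of_seq l.
apply: (coded_of_stabilizer hsat hhom (eta := eta)) => // sigma hs.
have os : automorphism_over set0 sigma by split.
rewrite (HX _ os) -fixes_tup.
by split=> fH' e He; apply: fH'; [apply/lH/etal|apply/etal/lH].
Qed.
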